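(* Let $(\mu_m)_{m\in\mathbb N}$ be a sequence of quasi-infinitely divisible distributions concentrated on $\mathbb Z$, $\mu$ a quasi-infinitely divisible distribution concentrated on $\mathbb Z$, $c$ a representation function, and denote the characteristic pairs and triplets of $\mu_m$ and $\mu$ with respect to $c$ by $(\zeta_m,\gamma_m)_c$, $(\zeta,\gamma)_c$, $(0,\nu_m,\gamma_m)_c$ and $(0,\nu,\gamma)_c$, respectively. Denote the drifts of $\mu_m$ and $\mu$ by $k_m$ and $k$, respectively. Then the following are equivalent: (i) $\mu_m$ converges weakly to $\mu$ as $m\to\infty$. (ii) $k_m$ converges to $k$ as $m\to\infty$ and $\lim_{m\to\infty}\sum_{n\in\mathbb Z}|\nu_m(\{n\})-\nu(\{n\})|=0$, i.e. $(\nu_m(\{n\}))_{n\in\mathbb Z}$ converges in $\ell^1$ to $(\nu(\{n\}))_{n\in\mathbb Z}$ as $m\to\infty$. (iii) $\gamma_m\to\gamma$ and $\zeta_m$ converges weakly to $\zeta$ as $m\to\infty$. In particular, for quasi-infinitely divisible distributions $\mu_m$ concentrated on $\mathbb Z$, weak convergence of $\mu_m$ to a quasi-infinitely divisible distribution implies tightness and uniform boundedness of $(\zeta_m)_{m\in\mathbb N}$.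
   Context: A representation function is a bounded Borel measurable function $c:\mathbb R\to\mathbb R$ with $\lim_{x\to0}(c(x)-x)/x^2=0$. Put $g_c(x,z)=(\mathrm e^{\mathrm i zx}-1-\mathrm i zc(x))/(1\wedge x^2)$ for $x\ne0$ and $g_c(0,z)=-z^2/2$. A probability distribution $\mu$ on $\mathbb R$ is quasi-infinitely divisible if, for a fixed representation function $c$, there are $\gamma\in\mathbb R$ and a finite signed Borel measure $\zeta$ on $\mathbb R$ with $\widehat\mu(z)=\int\mathrm e^{\mathrm i zx}\mu(\mathrm dx)=\exp(\mathrm i\gamma z+\int_{\mathbb R}g_c(x,z)\,\zeta(\mathrm dx))$ for all $z\in\mathbb R$. (This property does not depend on $c$; for given $c$ the pair $(\zeta,\gamma)=(\zeta,\gamma)_c$ is unique and called the characteristic pair of $\mu$ with respect to $c$.) The Gaussian variance of $\mu$ is $a=\zeta(\{0\})$; the quasi-Lévy measure of $\mu$ is $\nu(B)=\int_B(1\wedge x^2)^{-1}\zeta(\mathrm dx)$ for Borel sets $B$ bounded away from $0$; $(a,\nu,\gamma)_c$ is the characteristic triplet of $\mu$ with respect to $c$. If $\nu$ extends to a signed measure on all Borel sets it is identified with this extension, and $\nu(\{0\})=0$. For a quasi-infinitely divisible distribution concentrated on $\mathbb Z$ it is known that $a=0$, that $\nu$ is a finite signed measure concentrated on $\mathbb Z$ (so $\nu=\zeta$), and that it has a drift, i.e. a unique $k\in\mathbb R$ (in fact $k\in\mathbb Z$) with $\widehat\mu(z)=\exp(\mathrm i kz+\int_{\mathbb R}(\mathrm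 e^{\mathrm i zx}-1)\,\nu(\mathrm dx))$, $z\in\mathbb R$. Finite signed measures $\zeta_m$ converge weakly to a finite signed measure $\zeta$ if $\int f\,\mathrm d\zeta_m\to\int f\,\mathrm d\zeta$ for all bounded continuous $f:\mathbb R\to\mathbb R$. With $|\zeta_m|$ the total variation measure, $(\zeta_m)$ is uniformly bounded if $\sup_m|\zeta_m|(\mathbb R)<\infty$, and tight if for every $\varepsilon>0$ there is a compact $K\subset\mathbb R$ with $\sup_m|\zeta_m|(\mathbb R\setminus K)\le\varepsilon$. *)

(* Defs.v *)
From HB Require Import structures.
From mathcomp Require Export all_boot all_order all_algebra.
From mathcomp Require Export complex.
From mathcomp Require Export all_classical all_reals all_analysis.

Set Implicit Arguments.
Unset Strict Implicit.
Unset Printing Implicit Defensive.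

Export Order.TTheory GRing.Theory Num.Theory.
Export numFieldNormedType.Exports.

Local Open Scope classical_set_scope.
Local Open Scope ring_scope.
Local Open Scope complex_scope.

(* Distributions on R are [probability (measurableTypeR R) R]. Finite signed
   Borel measures are charges: a charge takes only finite values. The imaginary
   number i*t is written [0 +i* t], which avoids the clash between the two
   notations for the imaginary unit. *)
Notation signed_measure R :=
  (({charge set (measurableTypeR R) -> \bar R})%R) (only parsing).

Definition cexp (R : realType) (w : R[i]) : R[i] :=
  (expR (complex.Re w) * cos (complex.Im w)) +i* (expR (complex.Re w) * sin (complex.Im w)).

Section signed_integration.
Context {R : realType}.
Implicit Types nu : signed_measure R.

Definition hahn_pos nu : set (measurableTypeR R) :=
  projT1 (cid (Hahn_decomposition nu)).

Definition hahn_neg nu : set (measurableTypeR R) :=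
  projT1 (cid (projT2 (cid (Hahn_decomposition nu)))).

Definition hahn nu : hahn_decomposition nu (hahn_pos nu) (hahn_neg nu) :=
  projT2 (cid (projT2 (cid (Hahn_decomposition nu)))).

(* The Jordan parts do not depend on the Hahn decomposition picked above. *)
Definition total_variation nu : set (measurableTypeR R) -> \bar R :=
  charge_variation (hahn nu).

Definition sintegral nu (D : set R) (f : R -> R) : R :=
  Rintegral (jordan_pos (hahn nu)) D f - Rintegral (jordan_neg (hahn nu)) D f.

Definition csintegral nu (f : R -> R[i]) : R[i] :=
  sintegral nu setT (fun x => complex.Re (f x)) +i* sintegral nu setT (fun x => complex.Im (f x)).

End signed_integration.

Section quasi_infinite_divisibility.
Context {R : realType}.
Implicit Types (c : R -> R) (mu : probability (measurableTypeR R) R)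
  (zeta nu : signed_measure R) (gamma k : R).

Definition char_fun mu (z : R) : R[i] :=
  Rintegral mu setT (fun x : R => complex.Re (cexp (0 +i* (z * x)))) +i*
  Rintegral mu setT (fun x : R => complex.Im (cexp (0 +i* (z * x)))).

Definition representation_function c : Prop :=
  [/\ exists M : R, forall x, `|c x| <= M,
      measurable_fun [set: measurableTypeR R] (c : _ -> measurableTypeR R) &
      (c x - x) / x ^+ 2 @[x --> (0 : R)^'] --> (0 : R)].

Definition g_fun c (x z : R) : R[i] :=
  if x == 0 then (- (z ^+ 2 / 2))%:C
  else (cexp (0 +i* (z * x)) - 1 - (0 +i* (z * c x)))
       / (Num.min 1 (x ^+ 2))%:C.

Definition characteristic_pair c mu zeta gamma : Prop :=
  forall z : R, char_fun mu z =
    cexp ((0 +i* (gamma * z)) + csintegral zeta (fun x => g_fun c x z)).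

Definition quasi_infinitely_divisible c mu : Prop :=
  exists gamma zeta, characteristic_pair c mu zeta gamma.

Definition gaussian_variance zeta : \bar R := zeta [set (0 : R)].

Definition bounded_away_from_0 (B : set R) : Prop :=
  exists2 e : R, 0 < e & forall x, B x -> e <= `|x|.

(* [nu] is the quasi-Levy measure attached to [zeta], in the case where the
   latter extends to a finite signed measure on all Borel sets. *)
Definition quasi_levy_measure zeta nu : Prop :=
  nu [set (0 : R)] = 0%E /\
  forall B : set (measurableTypeR R), measurable B -> bounded_away_from_0 B ->
    nu B = (sintegral zeta B (fun x => (Num.min 1 (x ^+ 2))^-1))%:E.

Definition drift mu nu k : Prop :=
  forall z : R, char_fun mu z =
    cexp ((0 +i* (k * z)) + csintegral nu (fun x => cexp (0 +i* (z * x)) - 1)).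

Definition concentrated_on_Z mu : Prop :=
  mu (range (fun n : int => n%:~R : R)) = 1%E.

End quasi_infinite_divisibility.

Section convergence.
Context {R : realType}.

Definition bounded_continuous (f : R -> R) : Prop :=
  continuous f /\ exists M : R, forall x, `|f x| <= M.

Definition weak_cvg (mu_ : nat -> probability (measurableTypeR R) R)
    (mu : probability (measurableTypeR R) R) : Prop :=
  forall f : R -> R, bounded_continuous f ->
    Rintegral (mu_ m) setT f @[m --> \oo] --> Rintegral mu setT f.

Definition signed_weak_cvg (zeta_ : nat -> signed_measure R)
    (zeta : signed_measure R) : Prop :=
  forall f : R -> R, bounded_continuous f ->
    sintegral (zeta_ m) setT f @[m --> \oo] --> sintegral zeta setT f.

Definition uniformly_bounded (zeta_ : nat -> signed_measure R) : Prop :=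
  (ereal_sup (range (fun m => total_variation (zeta_ m) setT)) < +oo)%E.

Definition tight (zeta_ : nat -> signed_measure R) : Prop :=
  forall e : R, 0 < e -> exists2 K : set R, compact K &
    (ereal_sup (range (fun m => total_variation (zeta_ m) (~` K))) <= e%:E)%E.

End convergence.

(* Main.v *)
Require Import Defs.
From mathcomp Require Import zify ring lra measurable_realfun.
Import ComplexField.Normc.

(** Why the theorem holds.

    Everything is reduced to the signed measures zeta_m and zeta, which turn
    out to be carried by the nonzero integers. If mu lives on the integers, its
    characteristic function is 2 pi-periodic, so that the exponent
    Psi(z) = i gamma z + int g_c(x, z) zeta(dx) changes by a constant over a
    period: the change is continuous with values in 2 pi i Z. Hence
    Psi(z + 4 pi) - 2 Psi(z + 2 pi) + Psi(z) = 0. This second difference is the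
    Fourier transform of zeta weighted by -4 sin(pi x)^2 / min(1, x^2), up to a
    shift of z, and the weight vanishes exactly at the nonzero integers. By the
    uniqueness of Fourier transforms zeta gives no mass to the other points
    ([zeta_onZ0]). There min(1, x^2) = 1, so the quasi-Levy measure is zeta
    itself ([levy_measureE]), the drift is k = gamma - int c dzeta, and
    muhat(z) = exp (i k z + int (e^(izx) - 1) zeta(dx)) with k an integer.

    (i) => (ii). Weak convergence on the integers is convergence of the atoms,
    hence convergence in total variation ([scheffe]): muhat_m - muhat is small
    in the norm of absolutely convergent Fourier series. As 1 / muhat is the
    exponential of an element of this Banach algebra, muhat_m / muhat = 1 + f
    with f small. The difference H of the two exponents solves exp H = 1 + f,
    it is continuous and vanishes at 0, hence it is small everywhere by the
    intermediate value theorem ([log_small]). It is thus the limit of a Picard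
    iteration that stays in a small ball of the algebra ([wiener_log]), so its
    Fourier coefficients, which are those of zeta_m - zeta, are small in l1,
    and k_m = k because H is bounded ([exponent_cvg]).

    The norm is handled by duality: f has norm at most C when every finite
    combination of point evaluations that is bounded by B on all characters
    e^(inz) is bounded by C B at f ([wiener]). Stability under products and
    pointwise limits is then immediate, and no convolution of sequences is
    needed; coefficients are recovered by sampling at roots of unity
    ([wiener_elim]).

    (ii) => (iii) is the bound of an integral by the total variation, applied
    to bounded continuous functions and to c. (iii) => (i): every bounded
    function on the integers, in particular c, extends to a bounded continuous
    function on the line ([int_extension]), hence k_m and the exponents
    converge pointwise, and so do the characteristic functions; the atoms
    converge by Fourier inversion on a period ([char_cvg_atoms]).

    For the last assertion the limit is itself carried by the integers
    ([weak_cvg_onZ]), so that zeta_m tends to zeta in total variation, which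
    gives tightness and boundedness ([tight_of_tv]).

    Integrals against finite signed measures are treated as functionals on
    bounded Borel functions, linear and continuous under bounded convergence
    ([daniell]). The uniqueness theorem ([daniell_unique]) is proved at this
    level, by bounded pointwise limits of trigonometric polynomials. *)

Set Implicit Arguments.
Unset Strict Implicit.
Unset Printing Implicit Defensive.

Local Open Scope classical_set_scope.
Local Open Scope ring_scope.

(** * Signed measures as functionals on bounded Borel functions *)

Section daniell.
Context {R : realType}.
Implicit Types (f g : R -> R) (L : (R -> R) -> R).

(** Bounded Borel functions are integrable against every finite signed measure,
    and stable under bounded pointwise limits. *)
Definition bmeas f : Prop :=
  measurable_fun [set: measurableTypeR R] (f : _ -> measurableTypeR R) /\
  exists M : R, forall x, `|f x| <= M.

Lemma bmeas_cst a : bmeas (fun=> a).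
Proof. by split; [exact: measurable_cst|exists `|a|]. Qed.

Lemma bmeasD f g : bmeas f -> bmeas g -> bmeas (fun x => f x + g x).
Proof.
move=> [mf [M fM]] [mg [N gN]]; split; first exact: measurable_funD.
by exists (M + N) => x; rewrite (le_trans (ler_normD _ _))// lerD.
Qed.

Lemma bmeasM f g : bmeas f -> bmeas g -> bmeas (fun x => f x * g x).
Proof.
move=> [mf [M fM]] [mg [N gN]]; split; first exact: measurable_funM.
by exists (M * N) => x; rewrite normrM ler_pM.
Qed.

Lemma bmeasZ a f : bmeas f -> bmeas (fun x => a * f x).
Proof. by move=> bf; apply: bmeasM => //; exact: bmeas_cst. Qed.

Lemma bmeasN f : bmeas f -> bmeas (fun x => - f x).
Proof.
move=> [mf [M fM]]; split; first exact: measurable_funN.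
by exists M => x; rewrite normrN.
Qed.

Lemma bmeasB f g : bmeas f -> bmeas g -> bmeas (fun x => f x - g x).
Proof. by move=> bf bg; apply: bmeasD => //; exact: bmeasN. Qed.

Lemma bmeasX f n : bmeas f -> bmeas (fun x => f x ^+ n).
Proof.
move=> bf; elim: n => [|n IH]; first exact: bmeas_cst.
by under eq_fun do rewrite exprS; exact: bmeasM.
Qed.

Lemma bmeas_sum (I : Type) (s : seq I) (P : pred I) (F : I -> R -> R) :
  (forall i, bmeas (F i)) -> bmeas (fun x => \sum_(i <- s | P i) F i x).
Proof.
move=> bF; elim: s => [|i s IH].
  by under eq_fun do rewrite big_nil; exact: bmeas_cst.
under eq_fun do rewrite big_cons; case: (P i) => //.
exact: bmeasD.
Qed.

Lemma bmeas_lim (f_ : nat -> R -> R) f (M : R) : (forall k, bmeas (f_ k)) ->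
  (forall k x, `|f_ k x| <= M) ->
  (forall x, f_ k x @[k --> \oo] --> f x) -> bmeas f.
Proof.
move=> bf fM cf; split.
  by apply: (@measurable_fun_cvg _ _ _ _ f_) => // k; case: (bf k).
exists M => x.
have h : `|f_ k x| @[k --> \oo] --> `|f x| by apply: cvg_norm; exact: cf.
rewrite -(cvg_lim (@Rhausdorff R) h); apply: limr_le.
  by apply/cvg_ex; eexists; exact: h.
exact: nearW.
Qed.

Lemma bmeas_indic (A : set R) : measurable (A : set (measurableTypeR R)) ->
  bmeas (\1_A).
Proof.
move=> mA; split; first exact: measurable_indic.
by exists 1 => x; rewrite indicE; case: (_ \in _); rewrite ?normr1 ?normr0.
Qed.

Lemma bmeas_continuous f M : continuous f -> (forall x, `|f x| <= M) -> bmeas f.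
Proof.
by move=> cf fM; split; [exact: continuous_measurable_fun|exists M].
Qed.

Lemma bmeas_cos z : bmeas (fun x => cos (z * x)).
Proof.
apply: (@bmeas_continuous _ 1) => x; last exact: cos_max.
apply: continuous_comp; last exact: continuous_cos.
by apply: cvgM; [exact: cvg_cst|].
Qed.

Lemma bmeas_sin z : bmeas (fun x => sin (z * x)).
Proof.
apply: (@bmeas_continuous _ 1) => x; last exact: sin_max.
apply: continuous_comp; last exact: continuous_sin.
by apply: cvgM; [exact: cvg_cst|].
Qed.

(** The trace of a finite signed measure on bounded Borel functions: a signed
    Daniell integral. In this form the differences of two integrals and the
    integrals against a density are again objects of the same kind. *)
Definition daniell L : Prop := [/\
  forall a f g, bmeas f -> bmeas g ->
    L (fun x => a * f x + g x) = a * L f + L g,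
  exists C : R, forall f (M : R), bmeas f -> (forall x, `|f x| <= M) ->
    `|L f| <= C * M &
  forall (f_ : nat -> R -> R) f (M : R), (forall k, bmeas (f_ k)) ->
    (forall k x, `|f_ k x| <= M) ->
    (forall x, f_ k x @[k --> \oo] --> f x) -> L (f_ k) @[k --> \oo] --> L f].

Section theory.
Variable L : (R -> R) -> R.
Hypothesis dL : daniell L.

Lemma daniell0 : L (fun=> 0) = 0.
Proof.
have [lin _ _] := dL; have := lin 1 (fun=> 0) (fun=> 0) (bmeas_cst 0) (bmeas_cst 0).
under eq_fun do rewrite mulr0 addr0.
by rewrite mul1r => /eqP; rewrite eq_sym -subr_eq0 addrK => /eqP.
Qed.

Lemma daniellZ a f : bmeas f -> L (fun x => a * f x) = a * L f.
Proof.
move=> bf; have [lin _ _] := dL; have := lin a f (fun=> 0) bf (bmeas_cst 0).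
by rewrite daniell0 addr0; under eq_fun do rewrite addr0.
Qed.

Lemma daniellD f g : bmeas f -> bmeas g -> L (fun x => f x + g x) = L f + L g.
Proof.
move=> bf bg; have [lin _ _] := dL; have := lin 1 f g bf bg.
by rewrite mul1r; under eq_fun do rewrite mul1r.
Qed.

Lemma daniellN f : bmeas f -> L (fun x => - f x) = - L f.
Proof.
move=> bf; rewrite -[RHS]mulN1r -daniellZ//; congr L.
by apply/funext => x; rewrite mulN1r.
Qed.

Lemma daniellB f g : bmeas f -> bmeas g -> L (fun x => f x - g x) = L f - L g.
Proof. by move=> bf bg; rewrite daniellD ?daniellN//; exact: bmeasN. Qed.

Lemma daniell_sum (I : Type) (s : seq I) (P : pred I) (F : I -> R -> R) :
  (forall i, bmeas (F i)) ->
  L (fun x => \sum_(i <- s | P i) F i x) = \sum_(i <- s | P i) L (F i).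
Proof.
move=> bF; elim: s => [|i s IH].
  by under eq_fun do rewrite big_nil; rewrite big_nil daniell0.
rewrite big_cons; under eq_fun do rewrite big_cons; case: (P i) => //.
by rewrite daniellD ?IH//; exact: bmeas_sum.
Qed.

End theory.

Lemma daniell_sub (L L' : (R -> R) -> R) : daniell L -> daniell L' ->
  daniell (fun f => L f - L' f).
Proof.
move=> [l1 [C c1] b1] [l2 [D c2] b2]; split.
- by move=> a f g bf bg; rewrite l1// l2//; ring.
- exists (C + D) => f M bf fM.
  by rewrite (le_trans (ler_normB _ _))// mulrDl lerD// ?c1 ?c2.
- by move=> f_ f M bf fM cf; apply: cvgB; [exact: b1 cf|exact: b2 cf].
Qed.

Lemma daniell_mul L w : daniell L -> bmeas w -> daniell (fun f => L (fun x => w x * f x)).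
Proof.
move=> dL bw; have [l1 [C c1] b1] := dL; have [_ [W wW]] := bw; split.
- move=> a f g bf bg; rewrite -l1; [|exact: bmeasM|exact: bmeasM].
  by congr L; apply/funext => x; ring.
- exists (C * W) => f M bf fM; rewrite -mulrA; apply: c1; first exact: bmeasM.
  by move=> x; rewrite normrM ler_pM.
- move=> f_ f M bf fM cf; apply: (b1 _ _ (W * M)) => [k|k x|x].
  + exact: bmeasM.
  + by rewrite normrM ler_pM.
  + by apply: cvgM; [exact: cvg_cst|exact: cf].
Qed.

Lemma bmeas_integrable (mu : {finite_measure set (measurableTypeR R) -> \bar R}) f :
  bmeas f -> mu.-integrable setT (EFin \o f).
Proof.
move=> [mf [M fM]]; apply: (@measurable_bounded_integrable _ _ _ mu f setT) => //.
  by rewrite -ge0_fin_numE//; exact: fin_num_measure.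
exists M; split; first exact: num_real.
by move=> x Mx t _; exact: le_trans (fM t) (ltW Mx).
Qed.

Lemma daniell_Rintegral (mu : {finite_measure set (measurableTypeR R) -> \bar R}) :
  daniell (fun f => Rintegral mu setT f).
Proof.
split.
- move=> a f g bf bg; rewrite RintegralD ?RintegralZl//.
  + exact: bmeas_integrable.
  + by apply: bmeas_integrable; exact: bmeasZ.
  + exact: bmeas_integrable.
- exists (fine (mu setT)) => f M bf fM.
  apply: (le_trans (le_normr_Rintegral _ _)) => //; first exact: bmeas_integrable.
  rewrite mulrC -(@Rintegral_cst _ _ _ mu setT measurableT).
  apply: le_Rintegral => //.
    by have /integrable_norm := bmeas_integrable mu bf.
  exact: bmeas_integrable (bmeas_cst M).
- move=> f_ f M bf fM cf.
  have bF := bmeas_lim bf fM cf.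
  have cE : {ae mu, forall x, setT x -> (EFin \o f_ k) x @[k --> \oo] --> (EFin \o f) x}.
    by apply: aeW => x _; apply: cvg_EFin; [exact: nearW|exact: cf].
  have leM : {ae mu, forall x k, setT x -> (`|(EFin \o f_ k) x| <= M%:E)%E}.
    by apply: aeW => x k _; rewrite lee_fin.
  have [_ _ h] := @dominated_convergence _ _ _ mu setT measurableT
    (fun k => EFin \o f_ k) (EFin \o f) (fun=> M%:E)
    (fun k => measurable_int _ (bmeas_integrable mu (bf k)))
    (measurable_int _ (bmeas_integrable mu bF))
    cE
    (bmeas_integrable mu (bmeas_cst M)) leM.
  apply: fine_cvg; rewrite fineK//; exact: integrable_fin_num (bmeas_integrable mu bF).
Qed.

End daniell.

(** * Uniqueness of Fourier transforms *)

Section uniqueness.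
Context {R : realType}.
Implicit Types (f g : R -> R) (L : (R -> R) -> R).

Lemma cvg_dist_le (u v : nat -> R) (l : R) :
  (forall k, `|u k - l| <= v k) -> v k @[k --> \oo] --> 0 ->
  u k @[k --> \oo] --> l.
Proof.
move=> uv v0; apply/cvgrPdist_le => e e0; near=> k.
rewrite distrC (le_trans (uv k))//.
have : `|0 - v k| <= e by near: k; move/cvgrPdist_le : v0; exact.
by rewrite sub0r normrN; exact: le_trans (ler_norm _).
Unshelve. all: by end_near. Qed.

Lemma cvg_invn (C : R) : C / k.+1%:R @[k --> \oo] --> (0 : R).
Proof. by rewrite -(mulr0 C); apply: cvgM; [exact: cvg_cst|exact: cvg_harmonic]. Qed.

(** The number of positive integers below y is its floor. This writes a function
    rounded to a grid as a sum of indicators of superlevel sets. *)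
Lemma sum_threshold (K : nat) (y : R) : 0 <= y <= K%:R ->
  `|\sum_(j < K) \1_[set t : R | j.+1%:R <= t] y - y| <= 1.
Proof.
elim: K => [|K IH] /andP[y0 yK].
  by have -> : y = 0 by [apply/le_anti; rewrite y0 yK]; rewrite big_ord0 subr0 normr0.
rewrite big_ord_recr /=; have [yK'|Ky] := leP y K%:R.
  have [yeq|yne] := eqVneq y K.+1%:R.
    by move: yK'; rewrite yeq ler_nat ltnn.
  rewrite indicE memNset ?addr0 ?IH ?y0//= => h.
  by move/negP: yne; apply; rewrite eq_le h yK.
rewrite (eq_bigr (fun=> 1)) => [|i _]; last first.
  rewrite indicE mem_set//=; apply: le_trans (ltW Ky).
  by rewrite ler_nat ltn_ord.
rewrite sumr_const card_ord indicE.
move: yK Ky; rewrite -natr1; set k := K%:R => yK Ky.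
by case: (_ \in _); rewrite ler_norml; apply/andP; split; rewrite /=; lra.
Qed.

(** A bounded function is uniformly within 1 / n of a combination of finitely
    many indicators, those of its superlevel sets at multiples of 1 / n. *)
Lemma daniell_indic_eq0 L : daniell L ->
  (forall B : set (measurableTypeR R), measurable B -> L (\1_B) = 0) ->
  forall g, bmeas g -> L g = 0.
Proof.
move=> dL L0 g bg; have [_ _ blim] := dL; have [mg [M gM]] := bg.
pose B := Num.bound `|M|.
have MB : M < B%:R by apply: le_lt_trans (archi_boundP (normr_ge0 M)); exact: ler_norm.
have gB x : 0 <= g x + B%:R <= (2 * B)%:R.
  have := le_lt_trans (gM x) MB; rewrite ltr_norml natrM => /andP[? ?].
  by apply/andP; split; lra.
pose A n j := [set x | j.+1%:R <= n.+1%:R * (g x + B%:R)].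
have mA n j : measurable (A n j : set (measurableTypeR R)).
  have mG : measurable_fun [set: measurableTypeR R]
      ((fun x => n.+1%:R * (g x + B%:R)) : _ -> measurableTypeR R).
    by case: (bmeasZ n.+1%:R (bmeasD bg (bmeas_cst B%:R))).
  rewrite -[X in measurable X]setTI.
  rewrite (_ : A n j = (fun x => n.+1%:R * (g x + B%:R)) @^-1` `[j.+1%:R, +oo[).
    by apply: mG => //; exact: measurable_itv.
  by rewrite preimage_itvcy.
pose g_ (n : nat) (x : R) : R := n.+1%:R^-1 * (\sum_(j < n.+1 * (2 * B)) \1_(A n j) x) - B%:R.
have gg n x : `|g_ n x - g x| <= n.+1%:R^-1.
  have := @sum_threshold (n.+1 * (2 * B)) (n.+1%:R * (g x + B%:R)).
  have n0 : 0 < n.+1%:R :> R by [].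
  have /andP[h1 h2] := gB x.
  rewrite natrM mulr_ge0 ?ler_wpM2l// => /(_ isT).
  set S := \sum_(_ < _) _ => hS.
  have -> : g_ n x - g x = n.+1%:R^-1 * (S - n.+1%:R * (g x + B%:R)).
    by rewrite mulrBr mulKf ?gt_eqF// /g_ -/S opprD addrA addrAC.
  by rewrite normrM gtr0_norm ?invr_gt0// ler_piMr// invr_ge0.
have bg_ n : bmeas (g_ n).
  apply: bmeasB; last exact: bmeas_cst.
  by apply: bmeasZ; apply: bmeas_sum => j; exact: bmeas_indic.
have Lg n : L (g_ n) = - (B%:R * L (\1_setT)).
  rewrite daniellB//; last exact: bmeas_cst.
    rewrite daniellZ//; last by apply: bmeas_sum => j; exact: bmeas_indic.
    rewrite daniell_sum//; last by move=> j; exact: bmeas_indic.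
    rewrite big1 ?mulr0 ?sub0r// => [|j _]; last exact: L0.
    rewrite -daniellZ//; last exact: bmeas_indic.
    by congr (- L _); apply/funext => x; rewrite indicT mulr1.
  by apply: bmeasZ; apply: bmeas_sum => j; exact: bmeas_indic.
have cg : L (g_ n) @[n --> \oo] --> L g.
  apply: (blim _ _ (M + 1)) => // [n x|x].
    rewrite -[g_ n x](subrK (g x)) addrC (le_trans (ler_normD _ _))//.
    by rewrite lerD// (le_trans (gg n x))// invf_le1// ler1n.
  apply: (@cvg_dist_le _ (fun n => 1 / n.+1%:R)); last exact: cvg_invn.
  by move=> n; rewrite div1r.
move: cg; under eq_fun do rewrite Lg L0// mulr0 oppr0.
by move/cvg_lim => <-//; rewrite lim_cst.
Qed.

(** The iterates of this cubic tend to the sign function on [-1, 1] and stay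
    bounded by 1: they approximate a jump by bounded polynomials. *)
Definition step3 (t : R) : R := (3 * t - t ^+ 3) / 2.

Lemma step3_bound t : `|t| <= 1 -> `|step3 t| <= 1.
Proof.
rewrite !ler_norml /step3 => /andP[t1 t2].
have h1 : 0 <= (1 - t) ^+ 2 * (2 + t) by apply: mulr_ge0; [exact: sqr_ge0|lra].
have h2 : 0 <= (1 + t) ^+ 2 * (2 - t) by apply: mulr_ge0; [exact: sqr_ge0|lra].
apply/andP; split; rewrite -subr_ge0.
- by rewrite (_ : _ - _ = (1 + t) ^+ 2 * (2 - t) / 2) ?divr_ge0//; field.
- by rewrite (_ : _ - _ = (1 - t) ^+ 2 * (2 + t) / 2) ?divr_ge0//; field.
Qed.

Lemma iter_step3_bound k t : `|t| <= 1 -> `|iter k step3 t| <= 1.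
Proof. by move=> t1; elim: k => //= k; exact: step3_bound. Qed.

Lemma iter_step3N k t : iter k step3 (- t) = - iter k step3 t.
Proof. by elim: k => //= k ->; rewrite /step3; field. Qed.

(** Since 1 - step3 u = (1 - u)^2 (2 + u) / 2, one step multiplies the distance
    to the fixed point 1 by at most 1 - t / 2 as long as t <= u. *)
Lemma iter_step3_gt0 k t : 0 < t <= 1 ->
  t <= iter k step3 t <= 1 /\ 1 - iter k step3 t <= (1 - t / 2) ^+ k.
Proof.
move=> /andP[t0 t1]; elim: k => [|k [/andP[h1 h2] h3]] /=.
  by rewrite lexx t1 expr0; split => //; lra.
set u := iter k step3 t in h1 h2 h3 *; split.
  apply/andP; split; last first.
    by have := @step3_bound u; rewrite !ler_norml => /(_ _)/andP[|_ ->//]; lra.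
  apply: (le_trans h1); rewrite -subr_ge0.
  have -> : step3 u - u = u * (1 - u) * (1 + u) / 2 by rewrite /step3; field.
  by apply: divr_ge0 => //; apply: mulr_ge0; [apply: mulr_ge0; lra|lra].
rewrite exprSr; apply: le_trans (_ : (1 - u) * (1 - t / 2) <= _).
  have -> : 1 - step3 u = (1 - u) * ((1 - u) * (2 + u) / 2) by rewrite /step3; field.
  apply: ler_wpM2l; first by lra.
  have := sqr_ge0 u; have -> : (1 - u) * (2 + u) / 2 = 1 - (u + u ^+ 2) / 2 by field.
  by lra.
by apply: ler_wpM2r => //; lra.
Qed.

Lemma cvg_iter_step3 t : `|t| <= 1 ->
  iter k step3 t @[k --> \oo] --> Num.sg t.
Proof.
have pos u : 0 < u <= 1 -> iter k step3 u @[k --> \oo] --> (1 : R).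
  move=> u01; apply: (@cvg_dist_le _ (fun k => (1 - u / 2) ^+ k)).
    move=> k; have [/andP[_ h2] h3] := iter_step3_gt0 k u01.
    by rewrite distrC ger0_norm ?subr_ge0.
  apply: cvg_expr; move: u01 => /andP[? ?].
  by rewrite ger0_norm; lra.
rewrite ler_norml => /andP[tN1 t1]; have [t0|t0|->] := ltgtP t 0.
- have -> : (fun k => iter k step3 t) = (fun k => - iter k step3 (- t)).
    by apply/funext => k; rewrite iter_step3N opprK.
  by rewrite ltr0_sg//; apply: cvgN; apply: pos; lra.
- by rewrite gtr0_sg//; apply: pos; lra.
- rewrite sgr0 (_ : (fun _ => _) = fun=> 0); first exact: cvg_cst.
  by apply/funext; elim => //= k ->; rewrite /step3; field.
Qed.

(** As soon as |u| / n < 2, the sine of u / n has the sign of u. *)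
Lemma cvg_sgn_sin (u : R) : Num.sg (sin (n.+1%:R^-1 * u)) @[n --> \oo] --> Num.sg u.
Proof.
wlog u0 : u / 0 <= u => [h|].
  have [/h//|u0] := leP 0 u.
  rewrite -[u]opprK sgrN; under eq_fun do rewrite mulrN sinN sgrN.
  by apply: cvgN; apply: h; rewrite oppr_ge0 ltW.
have [->|une] := eqVneq u 0.
  by under eq_fun do rewrite mulr0 sin0; exact: cvg_cst.
have {une}u0 : 0 < u by rewrite lt_neqAle eq_sym une.
apply: cvg_near_cst.
have /cvgrPdist_lt /(_ 2 ltac:(by [])) := cvg_invn u.
apply: filterS => n; rewrite sub0r normrN ger0_norm ?divr_ge0 1?ltW// => h.
rewrite (gtr0_sg u0) gtr0_sg// mulrC; apply: sin2_gt0.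
by rewrite h divr_gt0.
Qed.

Section orthogonal_to_characters.
Variable L : (R -> R) -> R.
Hypothesis dL : daniell L.
Hypothesis Lcos : forall z, L (fun x => cos (z * x)) = 0.
Hypothesis Lsin : forall z, L (fun x => sin (z * x)) = 0.

(** Densities with respect to which the Fourier transform vanishes. *)
Let orth f := bmeas f /\ forall z,
  L (fun x => f x * cos (z * x)) = 0 /\ L (fun x => f x * sin (z * x)) = 0.

(** The multipliers of the previous class form an algebra, closed under bounded
    pointwise limits, that contains the characters. *)
Let mult g := bmeas g /\ forall f, orth f -> orth (fun x => f x * g x).

Let orthZD a f g : orth f -> orth g -> orth (fun x => a * f x + g x).
Proof.
move=> [bf of_] [bg og]; split; first by apply: bmeasD => //; exact: bmeasZ.
have [lin _ _] := dL.
have aux h : bmeas h -> L (fun x => f x * h x) = 0 -> L (fun x => g x * h x) = 0 ->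
    L (fun x => (a * f x + g x) * h x) = 0.
  move=> bh f0 g0; under eq_fun do rewrite mulrDl -mulrA.
  by rewrite lin ?f0 ?g0 ?mulr0 ?addr0//; exact: bmeasM.
move=> z; have [? ?] := of_ z; have [? ?] := og z.
by split; apply: aux => //; [exact: bmeas_cos|exact: bmeas_sin].
Qed.

Let multZD a f g : mult f -> mult g -> mult (fun x => a * f x + g x).
Proof.
move=> [bf mf] [bg mg]; split; first by apply: bmeasD => //; exact: bmeasZ.
move=> h oh; under eq_fun do rewrite mulrDr mulrCA.
by apply: orthZD; [exact: mf|exact: mg].
Qed.

Let multM f g : mult f -> mult g -> mult (fun x => f x * g x).
Proof.
move=> [bf mf] [bg mg]; split; first exact: bmeasM.
by move=> h oh; under eq_fun do rewrite mulrA; apply: mg; exact: mf.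
Qed.

Let orth0 : orth (fun=> 0).
Proof.
split; first exact: bmeas_cst.
by move=> z; split; under eq_fun do rewrite mul0r; exact: daniell0.
Qed.

Let mult0 : mult (fun=> 0).
Proof.
split; first exact: bmeas_cst.
by move=> f _; under eq_fun do rewrite mulr0; exact: orth0.
Qed.

Let multZ a f : mult f -> mult (fun x => a * f x).
Proof.
move=> mf; have := multZD a mf mult0.
by under eq_fun do rewrite addr0.
Qed.

Let mult1 : mult (fun=> 1).
Proof.
split; first exact: bmeas_cst.
by move=> f of_; under eq_fun do rewrite mulr1.
Qed.

Let mult_lim (f_ : nat -> R -> R) f M : (forall k, mult (f_ k)) ->
  (forall k x, `|f_ k x| <= M) -> (forall x, f_ k x @[k --> \oo] --> f x) ->
  mult f.
Proof.
move=> mf fM cf; have bf : bmeas f.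
  by apply: (bmeas_lim _ fM cf) => k; case: (mf k).
split=> // h oh; have [[bh bh2] _] := oh; have [H hH] := bh2.
split; first exact: bmeasM.
have [_ _ blim] := dL.
have aux c : bmeas c -> (forall x, `|c x| <= 1) ->
    (forall k, L (fun x => h x * f_ k x * c x) = 0) -> L (fun x => h x * f x * c x) = 0.
  move=> bc c1 h0.
  have : L (fun x => h x * f_ k x * c x) @[k --> \oo] --> L (fun x => h x * f x * c x).
    apply: (blim _ _ (H * M * 1)) => [k|k x|x].
    + by apply: bmeasM => //; apply: bmeasM => //; case: (mf k).
    + by rewrite !normrM ler_pM// ler_pM.
    + by apply: cvgM; [apply: cvgM; [exact: cvg_cst|exact: cf]|exact: cvg_cst].
  by under eq_fun do rewrite h0; move/cvg_lim => <-//; rewrite lim_cst.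
move=> z; split; apply: aux => [|x|k].
- exact: bmeas_cos.
- exact: cos_max.
- by have [_ /(_ _ oh)[_ /(_ z)[]]] := mf k.
- exact: bmeas_sin.
- exact: sin_max.
- by have [_ /(_ _ oh)[_ /(_ z)[]]] := mf k.
Qed.

Let mult_cos a : mult (fun x => cos (a * x)).
Proof.
split; first exact: bmeas_cos.
move=> f [bf of_]; split; first by apply: bmeasM => //; exact: bmeas_cos.
have [lin _ _] := dL.
have aux (c d e : R -> R) : bmeas c -> bmeas d ->
   L (fun x => f x * c x) = 0 -> L (fun x => f x * d x) = 0 ->
   (forall x, e x = 2^-1 * c x + 2^-1 * d x) -> L (fun x => f x * e x) = 0.
  move=> bc bd c0 d0 eE.
  have -> : (fun x => f x * e x) = (fun x => 2^-1 * (f x * c x) + 2^-1 * (f x * d x)).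
    by apply/funext => x; rewrite eE; ring.
  rewrite lin ?c0 ?daniellZ ?d0 ?mulr0 ?addr0//; do ?exact: bmeasM.
  by apply: bmeasZ; exact: bmeasM.
move=> z; have [cD sD] := of_ (z + a); have [cB sB] := of_ (z - a).
split.
- under eq_fun do rewrite -mulrA.
  apply: (aux (fun x => cos ((z + a) * x)) (fun x => cos ((z - a) * x))) => //.
  + exact: bmeas_cos.
  + exact: bmeas_cos.
  + by move=> x; rewrite mulrDl mulrBl cosD cosB; field.
- under eq_fun do rewrite -mulrA.
  apply: (aux (fun x => sin ((z + a) * x)) (fun x => sin ((z - a) * x))) => //.
  + exact: bmeas_sin.
  + exact: bmeas_sin.
  + by move=> x; rewrite mulrDl mulrBl sinD sinB; field.
Qed.

Let mult_sin a : mult (fun x => sin (a * x)).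
Proof.
split; first exact: bmeas_sin.
move=> f [bf of_]; split; first by apply: bmeasM => //; exact: bmeas_sin.
have [lin _ _] := dL.
have aux (c d e : R -> R) b : bmeas c -> bmeas d ->
   L (fun x => f x * c x) = 0 -> L (fun x => f x * d x) = 0 ->
   (forall x, e x = b * c x + (- b) * d x) -> L (fun x => f x * e x) = 0.
  move=> bc bd c0 d0 eE.
  have -> : (fun x => f x * e x) = (fun x => b * (f x * c x) + (- b) * (f x * d x)).
    by apply/funext => x; rewrite eE; ring.
  rewrite lin ?c0 ?daniellZ ?d0 ?mulr0 ?addr0//; do ?exact: bmeasM.
  by apply: bmeasZ; exact: bmeasM.
move=> z; have [cD sD] := of_ (z + a); have [cB sB] := of_ (z - a).
split.
- under eq_fun do rewrite -mulrA.
  apply: (aux (fun x => sin ((z + a) * x)) (fun x => sin ((z - a) * x)) _ 2^-1) => //.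
  + exact: bmeas_sin.
  + exact: bmeas_sin.
  + by move=> x; rewrite mulrDl mulrBl sinD sinB; field.
- under eq_fun do rewrite -mulrA.
  apply: (aux (fun x => cos ((z + a) * x)) (fun x => cos ((z - a) * x)) _ (- 2^-1)) => //.
  + exact: bmeas_cos.
  + exact: bmeas_cos.
  + by move=> x; rewrite mulrDl mulrBl cosD cosB; field.
Qed.

(** The sign of sin (z (x - y)) is a limit of polynomials in a trigonometric
    polynomial; letting z tend to 0 gives the sign of x - y. *)
Let mult_sgn y : mult (fun x => Num.sg (x - y)).
Proof.
apply: (@mult_lim (fun n x => Num.sg (sin (n.+1%:R^-1 * (x - y)))) _ 1) => [n|n x|x].
- set z := n.+1%:R^-1.
  apply: (@mult_lim (fun k x => iter k step3 (sin (z * (x - y)))) _ 1) => [k|k x|x].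
  + elim: k => [|k IH] /=.
      have -> : (fun x => sin (z * (x - y))) =
          (fun x => cos (z * y) * sin (z * x) + (- sin (z * y)) * cos (z * x)).
        by apply/funext => x; rewrite mulrBr sinB; ring.
      by apply: multZD; [exact: mult_sin|apply: multZ; exact: mult_cos].
    pose u x := iter k step3 (sin (z * (x - y))).
    have -> : (fun x => step3 (iter k step3 (sin (z * (x - y))))) =
        (fun x => 3 / 2 * u x + (- 2^-1) * (u x * (u x * u x))).
      by apply/funext => x; rewrite /step3 -/(u x); field.
    apply: multZD => //; apply: multZ; apply: multM => //; exact: multM.
  + by apply: iter_step3_bound; exact: sin_max.
  + by apply: cvg_iter_step3; exact: sin_max.
- by rewrite normr_sg; case: (_ != 0) => /=.
- exact: cvg_sgn_sin.
Qed.

Let mult_itv y : mult (\1_(`]y, +oo[%classic : set R)).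
Proof.
have -> : \1_(`]y, +oo[%classic : set R) =
    (fun x => 2^-1 * (Num.sg (x - y) * Num.sg (x - y)) + 2^-1 * Num.sg (x - y)).
  apply/funext => x; rewrite indicE; have [xy|xy|->] := ltgtP x y.
  - rewrite memNset ?ltr0_sg ?subr_lt0//=; first by field.
    by rewrite in_itv/= andbT => /(lt_trans xy); rewrite ltxx.
  - rewrite mem_set ?gtr0_sg ?subr_gt0//=; first by field.
    by rewrite in_itv/= andbT.
  - rewrite subrr sgr0 !mulr0 addr0 memNset//=.
    by rewrite in_itv/= andbT ltxx.
by apply: multZD; [apply: multM; exact: mult_sgn|apply: multZ; exact: mult_sgn].
Qed.

Let orth1 : orth (fun=> 1).
Proof.
split; first exact: bmeas_cst.
by move=> z; split; under eq_fun do rewrite mul1r.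
Qed.

Let mult_eq0 f : mult f -> L f = 0.
Proof.
move=> [_ /(_ _ orth1)[_ /(_ 0)[+ _]]].
by under eq_fun do rewrite mul1r mul0r cos0 mulr1.
Qed.

(** Half-lines form a pi-system that generates the Borel sets. *)
Let L_indic (B : set (measurableTypeR R)) : measurable B -> L (\1_B) = 0.
Proof.
rewrite RGenOInfty.measurableE.
apply: (@dynkin_induction _ (measurableTypeR R) (@RGenOInfty.G R) [set B | L (\1_B) = 0]).
- exact: RGenOInfty.measurableE.
- move=> _ _ [x ->] [y ->]; exists (Num.max x y).
  apply/seteqP; split => t /=; rewrite !in_itv /= !andbT gt_max.
    by case=> -> ->.
  by move=> /andP[].
- by rewrite /= indicT; exact: mult_eq0 mult1.
- by move=> _ [y ->]; exact: mult_eq0.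
- move=> S mS /= S0.
  have -> : \1_(~` S) = (fun x => 1 - \1_S x) :> (R -> R).
    by apply/funext => x; rewrite !indicE in_setC; case: (_ \in _) => /=; lra.
  rewrite daniellB// ?S0 ?subr0; first exact: mult_eq0 mult1.
    exact: bmeas_cst.
  exact: bmeas_indic.
- move=> F mF tF /= F0; have [_ _ blim] := dL.
  have sumF x i n : F i x ->
      \sum_(k < n) \1_(F k) x = if (i < n)%N then 1 else 0 :> R.
    move=> Fi; have Fk (k : nat) : k != i -> \1_(F k) x = 0 :> R.
      move=> ki; rewrite indicE memNset// => Fk; move/trivIsetP : tF => /(_ k i I I ki).
      by apply/eqP/set0P; exists x.
    case: ifPn => [ni|ni].
      rewrite (bigD1 (Ordinal ni))//= indicE mem_set// big1 ?addr0// => k ki.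
      by apply: Fk; move: ki; rewrite -val_eqE.
    rewrite big1// => k _; apply: Fk; apply: contraNneq ni => <-; exact: ltn_ord.
  have h : L (fun x => \sum_(k < n) \1_(F k) x) @[n --> \oo] --> L (\1_(\bigcup_k F k)).
    apply: (blim _ _ 1) => [n|n x|x].
    + by apply: bmeas_sum => k; exact: bmeas_indic.
    + have [[i iF]|nF] := pselect (exists i, F i x); last first.
        rewrite big1 ?normr0// => k _; rewrite indicE memNset// => Fk.
        by apply: nF; exists k.
      rewrite (sumF _ i)//; case: ifP; rewrite ?normr1 ?normr0//.
    + have [[i iF]|nF] := pselect (exists i, F i x); last first.
        rewrite indicE memNset; last by case=> k _ Fk; apply: nF; exists k.
        rewrite (_ : (fun _ => _) = fun=> 0); first exact: cvg_cst.
        apply/funext => n; rewrite big1// => k _; rewrite indicE memNset// => Fk.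
        by apply: nF; exists k.
      rewrite indicE mem_set; last by exists i.
      by apply: cvg_near_cst; exists i.+1 => // n /= ni; rewrite (sumF _ i)// ni.
  have h0 n : L (fun x => \sum_(k < n) \1_(F k) x) = 0.
    rewrite daniell_sum//; last by move=> k; exact: bmeas_indic.
    by rewrite big1// => k _; exact: F0.
  move: h; under eq_fun do rewrite h0.
  by move/cvg_lim => <-//; rewrite lim_cst.
Qed.

(** Uniqueness of Fourier transforms of finite signed measures. *)
Lemma daniell_unique f : bmeas f -> L f = 0.
Proof. by apply: daniell_indic_eq0 => // B; exact: L_indic. Qed.

End orthogonal_to_characters.

End uniqueness.

(** * Elementary trigonometry *)

Section trigonometry.
Context {R : realType}.
Implicit Types (x t : R).

Lemma MVT_le (f df : R -> R) t (C : R) : (forall x, is_derive x (1 : R) f (df x)) ->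
  (forall x, `|x| <= `|t| -> `|df x| <= C) -> `|f t - f 0| <= C * `|t|.
Proof.
move=> fdf dfC.
have cf a b : {within `[a, b], continuous f}.
  apply: continuous_subspaceT => x.
  by apply/differentiable_continuous/derivable1_diffP; case: (fdf x).
have [t0|t0] := leP 0 t.
  have [c /itvP ct ->] := @MVT_segment _ f df 0 t t0 (fun x _ => fdf x) (cf _ _).
  rewrite subr0 normrM ler_wpM2r// dfC// !ger0_norm//; by rewrite ct.
have [c /itvP ct h] := @MVT_segment _ f df t 0 (ltW t0) (fun x _ => fdf x) (cf _ _).
rewrite distrC h sub0r normrM normrN ler_wpM2r// dfC//.
by rewrite (ltr0_norm t0) ler0_norm ?lerN2 ct.
Qed.

Lemma norm_sin_le t : `|sin t| <= `|t|.
Proof.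
have := @MVT_le sin cos t 1 (fun x => is_derive_sin x) (fun x _ => cos_max x).
by rewrite sin0 subr0 mul1r.
Qed.

Lemma norm_cosB1_le t : `|cos t - 1| <= t ^+ 2.
Proof.
have h : forall x, `|x| <= `|t| -> `|- sin x| <= `|t|.
  by move=> x xt; rewrite normrN (le_trans (norm_sin_le x)).
have := @MVT_le cos (fun x => - sin x) t `|t| (fun x => is_derive_cos x) h.
by rewrite cos0 -expr2 real_normK ?num_real.
Qed.

(** A quadratic bound is enough here: it makes (sin (z x) - z x) / x^2 bounded. *)
Lemma norm_sinB_le t : `|sin t - t| <= 2 * t ^+ 2.
Proof.
have h : forall x, `|x| <= `|t| -> `|cos x - 1| <= 2 * `|t|.
  move=> x xt; have [t1|t1] := leP `|t| 1.
    rewrite (le_trans (norm_cosB1_le x))// -real_normK ?num_real//.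
    by have := normr_ge0 x; have := normr_ge0 t; nra.
  rewrite (le_trans (ler_normB _ _))// normr1.
  by have := cos_max x; lra.
have := @MVT_le (fun x => sin x - x) (fun x => cos x - 1) t (2 * `|t|) _ h.
rewrite sin0 subr0 subr0 -mulrA -expr2 real_normK ?num_real//; exact.
Qed.

Lemma sin_pi_int (n : int) : sin (pi * n%:~R) = 0 :> R.
Proof.
have nat0 (k : nat) : sin (pi * k%:R) = 0 :> R.
  elim: k => [|k IH]; first by rewrite mulr0 sin0.
  by rewrite -natr1 mulrDr mulr1 sinDpi IH oppr0.
case: n => k; first exact: nat0.
by rewrite NegzE mulrNz mulrN sinN nat0 oppr0.
Qed.

Lemma sin_pi_eq0 x : sin (pi * x) = 0 -> exists n : int, x = n%:~R.
Proof.
move=> x0; exists (Num.floor x).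
have /andP[t0 t1] : 0 <= x - (Num.floor x)%:~R < 1.
  by rewrite subr_ge0 Num.Theory.floor_le_tmp ltrBlDl//
    -{2}[1]/(1%:~R) -intrD Num.Theory.floorD1_gt.
set t := x - _ in t0 t1.
have st : sin (pi * t) = 0.
  by rewrite mulrBr sinB x0 sin_pi_int mul0r mulr0 subr0.
have [t00|] := eqVneq t 0; first by apply/eqP; rewrite -subr_eq0 -/t t00.
move=> tn0; have : 0 < sin (pi * t).
  apply: sin_gt0_pi; have := @pi_gt0 R; move=> p0; rewrite mulr_gt0//=.
    by rewrite gtr_pMr.
  by rewrite lt_neqAle eq_sym tn0.
by rewrite st ltxx.
Qed.

Lemma sin_2pi_int (n : int) : sin (2 * pi * n%:~R) = 0 :> R.
Proof.
rewrite -mulrA [X in sin X](_ : _ = (pi * n%:~R) *+ 2); last by rewrite mulr_natl.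
by rewrite sin_mulr2n sin_pi_int mulr0 mul0rn.
Qed.

Lemma cos_2pi_int (n : int) : cos (2 * pi * n%:~R) = 1 :> R.
Proof.
rewrite -mulrA [X in cos X](_ : _ = (pi * n%:~R) *+ 2); last by rewrite mulr_natl.
by rewrite cos_mulr2n cos2sin2 sin_pi_int expr0n subr0 mulr2n addrK.
Qed.

Lemma cos_eq1_int x : cos (2 * pi * x) = 1 -> exists n : int, x = n%:~R.
Proof.
rewrite -mulrA [X in cos X](_ : _ = (pi * x) *+ 2); last by rewrite mulr_natl.
rewrite cos_mulr2n cos2sin2 => h; apply: sin_pi_eq0.
by apply/eqP; rewrite -sqrf_eq0; apply/eqP; lra.
Qed.

(** The set where cos = 1 is discrete, so a continuous function with values in
    it cannot move. *)
Lemma cos_comp_cst (f : R -> R) : continuous f ->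
  (forall z, cos (f z) = 1) -> forall a b, f a = f b.
Proof.
move=> cf f1; have lt a b : ~ (f a < f b).
  move=> ab; pose d := Num.min pi (f b - f a).
  have d0 : 0 < d by rewrite lt_min pi_gt0 subr_gt0.
  have dpi : d <= pi by rewrite ge_min lexx.
  have dab : f a + d <= f b by rewrite -lerBrDl ge_min lexx orbT.
  have [c fc] : exists c, f c = f a + d.
    have mm : Num.min (f a) (f b) <= f a + d <= Num.max (f a) (f b).
      by rewrite ge_min le_max dab orbT andbT lerDl (ltW d0).
    have [le|le] := leP a b.
      by have [||c _ <-] := @IVT _ f a b (f a + d) le; [exact: continuous_subspaceT| |exists c].
    have [||c _ <-] := @IVT _ f b a (f a + d) (ltW le); [exact: continuous_subspaceT| |by exists c].
    by rewrite minC maxC.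
  have := f1 c; rewrite fc cosD f1 (cos1sin0 (_ : `|cos (f a)| = 1)) ?f1 ?normr1//.
  rewrite mul0r subr0 mul1r -cos0 => /cos_inj h.
  suff d00 : d = 0 by move: d0; rewrite d00 ltxx.
  by apply: h; rewrite in_itv/= ?lexx ?pi_ge0 ?(ltW d0).
by move=> a b; apply/eqP; have [/lt//|/lt//|//] := ltgtP (f a) (f b).
Qed.

End trigonometry.

(** * Functionals carried by the integers *)

Section on_integers.
Context {R : realType}.
Implicit Types (f g c : R -> R) (L : (R -> R) -> R).
Implicit Types (mu : probability (measurableTypeR R) R).
Implicit Types (zeta nu : signed_measure R).

Definition on_Z L : Prop :=
  forall f, bmeas f -> (forall n : int, f n%:~R = 0) -> L f = 0.

Lemma daniell_sintegral zeta : daniell (fun f => sintegral zeta setT f).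
Proof. by apply: daniell_sub; exact: daniell_Rintegral. Qed.

Lemma Rintegral_indic (mu : {finite_measure set (measurableTypeR R) -> \bar R})
  (B : set (measurableTypeR R)) : measurable B -> Rintegral mu setT \1_B = fine (mu B).
Proof. by move=> mB; rewrite /Rintegral integral_indic// setIT. Qed.

Lemma sintegral_indic zeta (B : set (measurableTypeR R)) : measurable B ->
  (sintegral zeta setT \1_B)%:E = zeta B.
Proof.
move=> mB; rewrite /sintegral !Rintegral_indic//.
rewrite (jordan_decomp (hahn zeta) mB) /cadd/= cscaleN1.
by rewrite EFinB !fineK ?fin_num_measure.
Qed.

Lemma daniell_onZ_eq L f g : daniell L -> on_Z L -> bmeas f -> bmeas g ->
  (forall n : int, f n%:~R = g n%:~R) -> L f = L g.
Proof.
move=> dL oL bf bg fg; apply/eqP; rewrite -subr_eq0 -daniellB//; apply/eqP.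
by apply: oL => [|n]; [exact: bmeasB|rewrite fg subrr].
Qed.

Definition intset : set R := range (fun n : int => n%:~R : R).

Lemma countable_intset : countable intset.
Proof. by apply: sub_countable (card_image_le _ _) _; exact: countableP. Qed.

Lemma measurable_intset : measurable (intset : set (measurableTypeR R)).
Proof.
apply: countable_measurable; last exact: countable_intset.
by move=> t; exact: measurable_set1.
Qed.

Lemma probability_onZ mu : concentrated_on_Z mu -> on_Z (fun f => Rintegral mu setT f).
Proof.
move=> muZ f bf f0; rewrite /Rintegral (ae_eq_integral (cst 0%E))//; last 2 first.
- by apply/measurable_EFinP; case: bf.
- exists (~` intset); split.
  + by apply: measurableC; exact: measurable_intset.
  + by have := probability_setC mu measurable_intset; rewrite muZ subee.
  + move=> x /= h [n _ nx]; apply: h => _; rewrite -nx.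
    by rewrite /= f0.
by rewrite integral0.
Qed.

(** The weight of the kernel g_c away from the origin. Its value at the origin is
    0, the inverse of 0, so that the atom at 0 is accounted for separately. *)
Definition invmin1 (x : R) : R := (Num.min 1 (x ^+ 2))^-1.

Lemma measurable_invmin1 :
  measurable_fun [set: measurableTypeR R] (invmin1 : _ -> measurableTypeR R).
Proof.
(* t / (t^2 + 1 / n) tends to the inverse of t, also for t = 0. *)
pose d n x : R := Num.min 1 (x ^+ 2) ^+ 2 + n.+1%:R^-1.
have m0 (x : R) : 0 <= Num.min 1 (x ^+ 2) by rewrite le_min ler01 sqr_ge0.
have d0 n x : 0 < d n x by rewrite ltr_wpDl ?sqr_ge0 ?invr_gt0.
apply: (@measurable_fun_cvg _ (measurableTypeR R) R setT
  (fun n x => Num.min 1 (x ^+ 2) / d n x)) => [n|x _].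
  apply: continuous_measurable_fun => x.
  have cm : {for x, continuous (fun x : R => Num.min 1 (x ^+ 2))}.
    have := @continuous_min R R (fun=> 1) (fun x => x ^+ 2) x.
    by apply; [exact: cvg_cst|exact: exprn_continuous].
  apply: cvgM; first exact: cm.
  apply: cvgV; first by rewrite gt_eqF.
  apply: cvgD; last exact: cvg_cst.
  apply: (@continuous_comp _ _ _ (fun x : R => Num.min 1 (x ^+ 2)) (fun x => x ^+ 2)) => //.
  exact: exprn_continuous.
rewrite /invmin1; have [->|mn0] := eqVneq (Num.min 1 (x ^+ 2)) 0.
  by under eq_fun do rewrite mul0r; rewrite invr0; exact: cvg_cst.
have -> : (Num.min 1 (x ^+ 2))^-1 = Num.min 1 (x ^+ 2) / (Num.min 1 (x ^+ 2) ^+ 2 + 0).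
  by rewrite addr0; field.
apply: cvgM; first exact: cvg_cst.
apply: cvgV; first by rewrite addr0 expf_neq0.
by apply: cvgD; [exact: cvg_cst|exact: cvg_harmonic].
Qed.

Lemma bmeas_invmin1M (f : R -> R) (K : R) :
  measurable_fun [set: measurableTypeR R] (f : _ -> measurableTypeR R) ->
  (forall x, `|f x| <= K * Num.min 1 (x ^+ 2)) -> bmeas (fun x => f x * invmin1 x).
Proof.
move=> mf fK; split; first by apply: measurable_funM => //; exact: measurable_invmin1.
exists `|K| => x; rewrite normrM /invmin1.
have m0 : 0 <= Num.min 1 (x ^+ 2) by rewrite le_min ler01 sqr_ge0.
rewrite normfV (ger0_norm m0); have [m00|mn0] := eqVneq (Num.min 1 (x ^+ 2)) 0.
  by rewrite m00 invr0 mulr0.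
have mgt : 0 < Num.min 1 (x ^+ 2) by rewrite lt_neqAle eq_sym mn0.
by rewrite ler_pdivrMr// (le_trans (fK x))// ler_wpM2r// ler_norm.
Qed.

(** Up to a factor -4 and a character, the second difference of g_c in z with
    step 2 pi. The value pi^2 at the origin is the one of the continuous
    extension of sin (pi x)^2 / x^2. *)
Definition wZ (x : R) : R := sin (pi * x) ^+ 2 * invmin1 x + pi ^+ 2 * \1_[set (0 : R)] x.

Lemma le_min1 (K t x : R) : t <= K -> t <= K * x ^+ 2 -> t <= K * Num.min 1 (x ^+ 2).
Proof. by move=> h1 h2; have [] := leP 1 (x ^+ 2); rewrite ?mulr1. Qed.

Lemma bmeas_wZ : bmeas wZ.
Proof.
apply: bmeasD; last by apply: bmeasZ; apply: bmeas_indic; exact: measurable_set1.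
apply: (@bmeas_invmin1M (fun x => sin (pi * x) ^+ 2) (1 + pi ^+ 2)).
  by have [] := bmeasX 2 (@bmeas_sin R pi).
move=> x; rewrite normrX; apply: le_min1.
  rewrite (@le_trans _ _ 1)// ?expr_le1 ?sin_max// lerDl sqr_ge0//.
rewrite (@le_trans _ _ ((pi * x) ^+ 2))//.
  by rewrite -[leRHS]real_normK ?num_real// lerXn2r ?nnegrE// norm_sin_le.
by rewrite exprMn ler_wpM2r ?sqr_ge0// lerDr.
Qed.

Lemma wZ_ge0 x : 0 <= wZ x.
Proof.
apply: addr_ge0; first by rewrite mulr_ge0 ?sqr_ge0// invr_ge0 le_min ler01 sqr_ge0.
by rewrite mulr_ge0 ?sqr_ge0// indicE.
Qed.

Lemma wZ_eq0 x : wZ x = 0 -> x != 0 /\ exists n : int, x = n%:~R.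
Proof.
rewrite /wZ; have p0 : pi ^+ 2 != 0 :> R by rewrite expf_neq0// gt_eqF// pi_gt0.
have [->|xn0] := eqVneq x 0.
  rewrite mulr0 sin0 expr0n mul0r add0r indicE mem_set//= mulr1 => /eqP.
  by rewrite (negbTE p0).
rewrite indicE memNset => [|/= /eqP]; last by rewrite (negbTE xn0).
rewrite mulr0 addr0 => /eqP; rewrite mulf_eq0 sqrf_eq0 => /orP[/eqP /sin_pi_eq0//|].
rewrite invr_eq0 => /eqP m0; exfalso; move: m0.
have x2 : 0 < x ^+ 2 by rewrite lt_neqAle sqr_ge0 eq_sym expf_neq0.
by have [_ /eqP|_ /eqP] := leP 1 (x ^+ 2); rewrite ?oner_eq0// gt_eqF.
Qed.

End on_integers.

(** * Support of the signed measure *)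

Section support.
Local Open Scope complex_scope.
Context {R : realType}.
Implicit Types (f g c : R -> R) (L : (R -> R) -> R).
Implicit Types (mu : probability (measurableTypeR R) R).
Implicit Types (zeta nu : signed_measure R).

Lemma cexp_im (t : R) : cexp (0 +i* t) = cos t +i* sin t.
Proof. by rewrite /cexp /= expR0 !mul1r. Qed.

(** The real and imaginary parts of g_c. The special value of g_c at the origin
    is carried by an indicator, since [invmin1] vanishes there. *)
Definition gre (z x : R) : R :=
  (cos (z * x) - 1) * invmin1 x - (z ^+ 2 / 2) * \1_[set (0 : R)] x.

Definition gim c (z x : R) : R := (sin (z * x) - z * c x) * invmin1 x.

Lemma invmin1_0 : invmin1 (0 : R) = 0.
Proof. by rewrite /invmin1 expr0n/= minEle ler10 invr0. Qed.

Lemma complex_divC (a b r : R) : (a +i* b) / r%:C = (a / r) +i* (b / r).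
Proof. by rewrite -fmorphV /=; simpc. Qed.

Lemma g_funE c x z : g_fun c x z = gre z x +i* gim c z x.
Proof.
rewrite /g_fun /gre /gim; have [->|xn0] := eqVneq x 0.
  by rewrite invmin1_0 !mulr0 indicE mem_set//= mulr1 sub0r; simpc.
rewrite cexp_im indicE memNset; last by apply/eqP.
rewrite mulr0 subr0 -complex_divC; congr (_ / _).
by simpc.
Qed.

Lemma gre_bound z x : `|gre z x| <= 2 + 2 * z ^+ 2.
Proof.
rewrite /gre indicE; have [->|xn0] := eqVneq x 0.
  rewrite invmin1_0 mulr0 sub0r mem_set// mulr1 normrN ger0_norm ?divr_ge0 ?sqr_ge0//.
  by have := sqr_ge0 z; lra.
rewrite memNset; last by apply/eqP.
have mgt : 0 < Num.min 1 (x ^+ 2).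
  by rewrite lt_min ltr01 lt_neqAle sqr_ge0 eq_sym expf_neq0.
rewrite mulr0 subr0 normrM /invmin1 normfV (gtr0_norm mgt) ler_pdivrMr//.
apply: le_min1.
  rewrite (le_trans (ler_normB _ _))// normr1.
  by have := cos_max (z * x); have := sqr_ge0 z; lra.
rewrite (le_trans (norm_cosB1_le _))// exprMn ler_wpM2r ?sqr_ge0//.
by have := sqr_ge0 z; lra.
Qed.

Lemma bmeas_gre z : bmeas (gre z).
Proof.
split; last by exists (2 + 2 * z ^+ 2) => x; exact: gre_bound.
apply: measurable_funB.
  apply: measurable_funM; last exact: measurable_invmin1.
  by have [] := bmeasB (bmeas_cos z) (@bmeas_cst R 1).
by have [] := bmeasZ (z ^+ 2 / 2) (bmeas_indic (measurable_set1 (0 : R))).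
Qed.

Section representation.
Variable c : R -> R.
Hypothesis rc : representation_function c.

Lemma bmeas_rep : bmeas c. Proof. by have [? ? _] := rc; split. Qed.

(** Near the origin sin (z x) - z c(x) = (sin (z x) - z x) - z (c(x) - x), where
    both terms are O(x^2): for the second one this is the defining property of
    representation functions. Away from the origin c is merely bounded. *)
Lemma gim_bound : exists K : R, forall z x, `|gim c z x| <= K * (1 + z ^+ 2).
Proof.
have [[M cM] _ c0] := rc; have M0 : 0 <= M := le_trans (normr_ge0 _) (cM 0).
have : \forall x \near (0 : R)^', `|0 - (c x - x) / x ^+ 2| <= 1.
  by move/cvgrPdist_le : c0; apply.
rewrite near_withinE => /nbhs_ballP[d /= d0 hd].
pose e := Num.min d 1; have e0 : 0 < e by rewrite lt_min d0 ltr01.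
have e1 : e <= 1 by rewrite ge_min lexx orbT.
exists (2 + (1 + M) / e ^+ 2 + 1) => z x; rewrite /gim.
have zz : `|z| <= 1 + z ^+ 2.
  by rewrite -[z ^+ 2]real_normK ?num_real//; have := normr_ge0 z; nra.
have z2 : 1 <= 1 + z ^+ 2 by rewrite lerDl sqr_ge0.
have e2 : 0 < e ^+ 2 by rewrite exprn_gt0.
have Me : 0 <= (1 + M) / e ^+ 2 by rewrite divr_ge0 ?addr_ge0// ltW.
have [->|xn0] := eqVneq x 0.
  rewrite invmin1_0 mulr0 normr0 mulr_ge0// ?(le_trans _ z2)//.
  by lra.
have x20 : 0 < x ^+ 2 by rewrite lt_neqAle sqr_ge0 eq_sym expf_neq0.
have [xe|ex] := ltP `|x| e.
  have x1 : x ^+ 2 <= 1.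
    by rewrite -[x ^+ 2]real_normK ?num_real// expr_le1// (le_trans (ltW xe)).
  rewrite /invmin1 (min_idPr x1) normrM normfV (gtr0_norm x20) ler_pdivrMr//.
  have -> : sin (z * x) - z * c x = (sin (z * x) - z * x) - z * (c x - x) by ring.
  rewrite (le_trans (ler_normB _ _))// normrM.
  have h1 := norm_sinB_le (z * x).
  have h2 : `|c x - x| <= x ^+ 2.
    have /= := hd x; rewrite /ball /= sub0r normrN => /(_ _ xn0).
    rewrite sub0r !normrN normrM normfV (gtr0_norm x20) ler_pdivrMr// mul1r; apply.
    by rewrite (lt_le_trans xe)// ge_min lexx.
  rewrite exprMn in h1.
  have h3 : `|z| * `|c x - x| <= (1 + z ^+ 2) * x ^+ 2 by rewrite ler_pM.
  have h4 : 0 <= (1 + M) / e ^+ 2 * (1 + z ^+ 2) * x ^+ 2.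
    by apply: mulr_ge0 (ltW x20); apply: mulr_ge0 => //; exact: le_trans ler01 z2.
  have h5 : z ^+ 2 * x ^+ 2 <= (1 + z ^+ 2) * x ^+ 2.
    by apply: ler_wpM2r; [exact: ltW|rewrite lerDr].
  rewrite !mulrDl; lra.
have me : e ^+ 2 <= Num.min 1 (x ^+ 2).
  rewrite le_min expr_le1 ?(ltW e0)//= -[x ^+ 2]real_normK ?num_real//.
  by rewrite lerXn2r ?nnegrE ?(ltW e0)// e1.
have m0 := lt_le_trans e2 me.
rewrite /invmin1 normrM normfV (gtr0_norm m0).
apply: (@le_trans _ _ ((1 + M) / e ^+ 2 * (1 + z ^+ 2))); last first.
  by rewrite ler_wpM2r ?(le_trans _ z2)//; lra.
rewrite mulrAC ler_pM ?invr_ge0 ?(ltW m0)//; last by rewrite lef_pV2.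
rewrite (le_trans (ler_normB _ _))// normrM mulrDl mul1r lerD//.
  by rewrite (le_trans (sin_max _)).
by rewrite mulrC ler_pM.
Qed.

Lemma bmeas_gim z : bmeas (gim c z).
Proof.
have [K hK] := gim_bound; split; last by exists (K * (1 + z ^+ 2)) => x; exact: hK.
apply: measurable_funM; last exact: measurable_invmin1.
by have [] := bmeasB (bmeas_sin z) (bmeasZ z bmeas_rep).
Qed.

Lemma csintegral_gE zeta z : csintegral zeta (fun x => g_fun c x z) =
  sintegral zeta setT (gre z) +i* sintegral zeta setT (gim c z).
Proof.
by rewrite /csintegral; congr (_ +i* _); congr (sintegral _ _ _);
  apply/funext => x; rewrite g_funE.
Qed.

(** Equality of exponentials determines the exponent up to a multiple of 2 pi i. *)
Lemma cexp_eq (a b a' b' : R) : cexp (a +i* b) = cexp (a' +i* b') ->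
  a = a' /\ cos (b - b') = 1.
Proof.
rewrite /cexp /= => -[h1 h2].
have h3 : expR a ^+ 2 = expR a' ^+ 2.
  rewrite -[LHS]mulr1 -[RHS]mulr1 -{1}(cos2Dsin2 b) -(cos2Dsin2 b') !mulrDr -!exprMn.
  by rewrite h1 h2.
have h4 : expR a = expR a'.
  by apply/eqP; rewrite -(@eqrXn2 _ 2) ?expR_ge0// h3.
have aa : a = a' by exact: expR_inj.
split => //; move: h1 h2; rewrite h4.
have e0 : expR a' != 0 by rewrite gt_eqF// expR_gt0.
by move=> /(mulfI e0) h1 /(mulfI e0) h2; rewrite cosB h1 h2 -!expr2 cos2Dsin2.
Qed.

Lemma char_funE mu z : char_fun mu z =
  Rintegral mu setT (fun x => cos (z * x)) +i* Rintegral mu setT (fun x => sin (z * x)).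
Proof.
by rewrite /char_fun; congr (_ +i* _); congr Rintegral; apply/funext => x;
  rewrite cexp_im.
Qed.

Lemma char_fun_periodic mu : concentrated_on_Z mu ->
  forall z, char_fun mu (z + 2 * pi) = char_fun mu z.
Proof.
move=> /probability_onZ muZ z; rewrite !char_funE.
congr (_ +i* _); apply: (daniell_onZ_eq (daniell_Rintegral mu) muZ).
- exact: bmeas_cos.
- exact: bmeas_cos.
- by move=> n; rewrite mulrDl cosD sin_2pi_int cos_2pi_int mulr1 mulr0 subr0.
- exact: bmeas_sin.
- exact: bmeas_sin.
- by move=> n; rewrite mulrDl sinD sin_2pi_int cos_2pi_int mulr1 mulr0 addr0.
Qed.

Lemma continuous_daniell L (F : R -> R -> R) : daniell L -> (forall z, bmeas (F z)) ->
  (forall M : R, exists C : R, forall z x, `|z| <= M -> `|F z x| <= C) ->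
  (forall x, continuous (F ^~ x)) -> continuous (fun z => L (F z)).
Proof.
move=> [_ _ blim] bF Fbd cF z; apply/(@cvg_nbhsP _ R^o) => u uz.
have [M hM] : exists M, forall n, `|u n| <= M.
  have /cvg_seq_bounded : cvgn u by apply/cvg_ex; exists z.
  by move=> [M [_ hM]]; exists (M + 1) => n; apply: hM => //; rewrite ltrDl.
have [C FC] := Fbd M; apply: (blim _ _ C) => [k|k x|x].
- exact: bF.
- exact: FC.
- by have /(@cvg_nbhsP _ R^o) := cF x z; apply.
Qed.

(** The increment of B over a period has values in 2 pi Z, hence is constant. *)
Lemma second_difference_cst (B : R -> R) : continuous B ->
  (forall z, cos (B (z + 2 * pi) - B z) = 1) ->
  forall z, B (z + 2 * pi + 2 * pi) - 2 * B (z + 2 * pi) + B z = 0.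
Proof.
move=> cB B1 z.
have cd : continuous (fun z => B (z + 2 * pi) - B z).
  move=> y; apply: cvgB; last exact: cB.
  apply: (@continuous_comp _ _ _ (fun z => z + 2 * pi) B); last exact: cB.
  by apply: cvgD; [exact: cvg_id|exact: cvg_cst].
by have := cos_comp_cst cd B1 (z + 2 * pi) z; lra.
Qed.

Lemma bmeas_inv_max (f : R -> R) n : bmeas f ->
  bmeas (fun x => (Num.max (f x) n.+1%:R^-1)^-1).
Proof.
move=> [mf _]; have d0 : 0 < n.+1%:R^-1 :> R by rewrite invr_gt0.
have m0 (t : R) : 0 < Num.max t n.+1%:R^-1 by rewrite lt_max d0 orbT.
split.
  apply: (@measurableT_comp _ _ _ _ _ _ (fun t : R => (Num.max t n.+1%:R^-1)^-1)) => //.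
  apply: continuous_measurable_fun => t; apply: cvgV; first by rewrite gt_eqF.
  have := @continuous_max R R id (fun=> n.+1%:R^-1) t.
  by apply; [exact: cvg_id|exact: cvg_cst].
exists n.+1%:R => x; rewrite normfV gtr0_norm// invf_ple ?posrE//.
by rewrite le_max lexx orbT.
Qed.

(** By periodicity the second difference of the exponent with step 2 pi vanishes,
    which says that the Fourier transform of zeta weighted by [wZ] is zero. As
    [wZ] vanishes only at the nonzero integers, zeta ignores all other points. *)
Lemma zeta_onZ0 mu zeta gamma : concentrated_on_Z mu ->
  characteristic_pair c mu zeta gamma ->
  forall f, bmeas f -> (forall n : int, n != 0 -> f n%:~R = 0) ->
  sintegral zeta setT f = 0.
Proof.
move=> muZ mup.
pose L f := sintegral zeta setT f; have dL : daniell L := daniell_sintegral zeta.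
pose A z := L (gre z); pose B z := gamma * z + L (gim c z).
have muE z : char_fun mu z = cexp (A z +i* B z).
  by rewrite mup csintegral_gE; congr cexp; simpc.
have per z : A (z + 2 * pi) = A z /\ cos (B (z + 2 * pi) - B z) = 1.
  by apply: cexp_eq; rewrite -!muE char_fun_periodic.
have cB : continuous B.
  move=> z; apply: cvgD; first by apply: cvgM; [exact: cvg_cst|exact: cvg_id].
  have [K hK] := gim_bound.
  apply: (@continuous_daniell L (gim c)) => //.
  + exact: bmeas_gim.
  + move=> M; exists (`|K| * (1 + M ^+ 2)) => y x yM; apply: (le_trans (hK _ _)).
    apply: (@le_trans _ _ (`|K| * (1 + y ^+ 2))).
      by rewrite ler_wpM2r ?ler_norm// addr_ge0// sqr_ge0.
    rewrite ler_wpM2l// lerD2l -[M ^+ 2]real_normK ?num_real//.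
    by rewrite -[y ^+ 2]real_normK ?num_real// lerXn2r ?nnegrE// (le_trans yM)// ler_norm.
  + move=> x y; apply: cvgM; last exact: cvg_cst.
    apply: cvgB; last by apply: cvgM; [exact: cvg_id|exact: cvg_cst].
    apply: continuous_comp; last exact: continuous_sin.
    by apply: cvgM; [exact: cvg_id|exact: cvg_cst].
have cos2 x : cos (2 * pi * x) = 1 - 2 * sin (pi * x) ^+ 2 :> R.
  rewrite -mulrA [X in cos X](_ : _ = (pi * x) *+ 2); last by rewrite mulr_natl.
  by rewrite cos_mulr2n cos2sin2; ring.
(* With u = z x: cos (u + 2 pi x) - 2 cos u + cos (u - 2 pi x) = - 4 sin (pi x)^2 cos u. *)
have second (F : R -> R -> R) : (forall y, bmeas (F y)) ->
    (forall y, L (F (y + 2 * pi + 2 * pi)) - 2 * L (F (y + 2 * pi)) + L (F y) = 0) ->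
    forall z h, bmeas h ->
    (forall x, F (z + 2 * pi) x - 2 * F z x + F (z - 2 * pi) x = - 4 * (wZ x * h x)) ->
    L (fun x => wZ x * h x) = 0.
  move=> bF F0 z h bh Fh; have := F0 (z - 2 * pi); rewrite subrK.
  rewrite -daniellZ// -daniellB//; last by apply: bmeasZ.
  rewrite -daniellD//; last by apply: bmeasB => //; apply: bmeasZ.
  under eq_fun do rewrite Fh.
  rewrite daniellZ//; last by apply: bmeasM => //; exact: bmeas_wZ.
  by move/eqP; rewrite mulf_eq0 => /orP[/eqP|/eqP//]; lra.
have w0 f : bmeas f -> L (fun x => wZ x * f x) = 0.
  move=> bf; apply: (daniell_unique (daniell_mul dL bmeas_wZ)) => // z.
  - apply: (@second gre bmeas_gre _ z (fun x => cos (z * x))); last 2 first.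
    + exact: bmeas_cos.
    + move=> x; rewrite /gre /wZ (_ : (z + 2 * pi) * x = z * x + 2 * pi * x); last by ring.
      rewrite (_ : (z - 2 * pi) * x = z * x - 2 * pi * x); last by ring.
      rewrite cosD cosB cos2.
      have [->|/eqP x0] := eqVneq x 0.
        by rewrite indicE mem_set//= !mulr0 cos0 sin0; field.
      by rewrite indicE memNset//=; ring.
    + by move=> y; rewrite -/(A _) -/(A _) -/(A y) !(per _).1; ring.
  - apply: (@second (gim c) bmeas_gim _ z (fun x => sin (z * x))); last 2 first.
    + exact: bmeas_sin.
    + move=> x; rewrite /gim /wZ (_ : (z + 2 * pi) * x = z * x + 2 * pi * x); last by ring.
      rewrite (_ : (z - 2 * pi) * x = z * x - 2 * pi * x); last by ring.
      rewrite sinD sinB cos2.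
      have [->|/eqP x0] := eqVneq x 0.
        by rewrite indicE mem_set//= !mulr0 cos0 sin0 invmin1_0; ring.
      by rewrite indicE memNset//=; ring.
    + move=> y; have := second_difference_cst cB (fun z => (per z).2) y.
      by rewrite /B => h; rewrite -[RHS]h; ring.
move=> f bf f0; have [mf [M fM]] := bf.
(* Where wZ >= 1 / n, a function is wZ times a bounded function. *)
pose D n := [set x : R | n.+1%:R^-1 <= wZ x].
have mw := bmeas_wZ.1.
have mD n : measurable (D n : set (measurableTypeR R)).
  rewrite -[X in measurable X]setTI (_ : D n = wZ @^-1` `[n.+1%:R^-1, +oo[).
    by apply: mw => //; exact: measurable_itv.
  by rewrite preimage_itvcy.
have [_ _ blim] := dL.
have Lf : L (fun x => f x * \1_(D n) x) @[n --> \oo] --> L f.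
  apply: (blim _ _ M) => [n|n x|x].
  - by apply: bmeasM => //; exact: bmeas_indic.
  - rewrite normrM indicE; case: (_ \in _); rewrite ?normr1 ?mulr1 ?normr0 ?mulr0//.
    exact: le_trans (normr_ge0 _) (fM x).
  have [w00|wn0] := eqVneq (wZ x) 0.
    have [xn0 [k xk]] := wZ_eq0 w00; rewrite xk f0; last first.
      by apply: contraNneq xn0 => k0; rewrite xk k0.
    by under eq_fun do rewrite mul0r; exact: cvg_cst.
  apply: cvg_near_cst; have wgt : 0 < wZ x by rewrite lt_neqAle eq_sym wn0 wZ_ge0.
  have /cvgrPdist_lt /(_ _ wgt) := cvg_invn (1 : R).
  apply: filterS => n; rewrite sub0r normrN ger0_norm ?div1r ?invr_ge0// => h.
  by rewrite indicE mem_set ?mulr1//; exact: ltW.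
have Lf0 n : L (fun x => f x * \1_(D n) x) = 0.
  have bq : bmeas (fun x => f x * \1_(D n) x * (Num.max (wZ x) n.+1%:R^-1)^-1).
    apply: bmeasM; first by apply: bmeasM => //; exact: bmeas_indic.
    exact: bmeas_inv_max bmeas_wZ.
  rewrite -[RHS](w0 _ bq); congr L; apply/funext => x; rewrite indicE.
  have [/set_mem|xD] := boolP (x \in D n); last by rewrite !(mulr0, mul0r).
  move=> /= wn; rewrite mulr1 (max_idPl wn) mulrC divfK// gt_eqF//.
  by apply: lt_le_trans wn; rewrite invr_gt0.
rewrite -/(L f) -(cvg_lim (@Rhausdorff R) Lf).
by under eq_fun do rewrite Lf0; rewrite lim_cst.
Qed.

End representation.
End support.

(** * Quasi-Levy measure and drift *)

Section drift_form.
Local Open Scope complex_scope.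
Context {R : realType}.
Implicit Types (f g c : R -> R) (L : (R -> R) -> R).
Implicit Types (mu : probability (measurableTypeR R) R).
Implicit Types (zeta nu : signed_measure R).

Definition on_Z0 L : Prop :=
  forall f, bmeas f -> (forall n : int, n != 0 -> f n%:~R = 0) -> L f = 0.

Lemma on_Z0_Z L : on_Z0 L -> on_Z L.
Proof. by move=> oL f bf f0; apply: oL => // n _; exact: f0. Qed.

Lemma daniell_onZ0_eq L f g : daniell L -> on_Z0 L -> bmeas f -> bmeas g ->
  (forall n : int, n != 0 -> f n%:~R = g n%:~R) -> L f = L g.
Proof.
move=> dL oL bf bg fg; apply/eqP; rewrite -subr_eq0 -daniellB//; apply/eqP.
by apply: oL => [|n n0]; [exact: bmeasB|rewrite fg// subrr].
Qed.

Lemma sqr_int_ge1 (n : int) : n != 0 -> 1 <= (n%:~R : R) ^+ 2.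
Proof.
move=> n0; rewrite -[_ ^+ 2]real_normK ?num_real// exprn_ege1//.
by rewrite -intr_norm ler1z -gtz0_ge1 normr_gt0.
Qed.

Lemma invmin1_int (n : int) : n != 0 -> invmin1 (n%:~R : R) = 1.
Proof. by move=> n0; rewrite /invmin1 (min_idPl (sqr_int_ge1 n0)) invr1. Qed.

Lemma indic0_int (n : int) : n != 0 -> \1_[set (0 : R)] (n%:~R : R) = 0 :> R.
Proof. by move=> n0; rewrite indicE memNset//= => /eqP; rewrite intr_eq0 (negbTE n0). Qed.

(** On a set bounded away from 0, nu integrates min(1, x^2)^-1 against zeta; this
    weight is 1 on the nonzero integers. The sets bounded away from 0 exhaust the
    complement of 0, to which neither measure gives mass. *)
Lemma levy_measureE zeta nu : on_Z0 (fun f => sintegral zeta setT f) ->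
  quasi_levy_measure zeta nu ->
  forall f, bmeas f -> sintegral nu setT f = sintegral zeta setT f.
Proof.
move=> oz [nu0 nuB] f bf; apply/eqP; rewrite -subr_eq0; apply/eqP.
have dz := daniell_sintegral zeta; have dn := daniell_sintegral nu.
have dL := daniell_sub dn dz.
move: f bf; apply: (daniell_indic_eq0 dL) => B mB /=.
have away (e : R) (A : set (measurableTypeR R)) : 0 < e -> measurable A ->
    (forall x, A x -> e <= `|x|) -> sintegral nu setT \1_A = sintegral zeta setT \1_A.
  move=> e0 mA Ae; apply: EFin_inj; rewrite sintegral_indic// nuB//; last by exists e.
  congr EFin; rewrite /sintegral !(Rintegral_mkcond _ A) -/(sintegral zeta setT _).
  rewrite patch_indic; apply: (daniell_onZ0_eq dz oz).
  - rewrite (_ : _ \* _ = fun x => \1_A x * invmin1 x); last first.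
      by apply/funext => x /=; rewrite mulrC.
    have m0 : 0 < Num.min 1 (e ^+ 2) by rewrite lt_min ltr01 exprn_gt0.
    apply: (@bmeas_invmin1M _ \1_A (Num.min 1 (e ^+ 2))^-1) => [|x].
      by have [] := bmeas_indic mA.
    rewrite indicE; have [xA|xA] := boolP (x \in A); last first.
      by rewrite normr0 mulr_ge0// ?invr_ge0 ?(ltW m0)// le_min ler01 sqr_ge0.
    rewrite normr1 mulrC ler_pdivlMr// mul1r le_min ge_min lexx/= ge_min.
    by rewrite -[x ^+ 2]real_normK ?num_real// lerXn2r ?orbT// ?nnegrE ?(ltW e0)// Ae// -inE.
  - exact: bmeas_indic.
  - by move=> n n0 /=; rewrite -/(invmin1 _) invmin1_int// mul1r.
have null (A : set (measurableTypeR R)) : measurable A -> A `<=` [set 0] ->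
    sintegral nu setT \1_A = sintegral zeta setT \1_A.
  move=> mA A0; rewrite [RHS]oz; last 2 first.
  - exact: bmeas_indic.
  - move=> n n0; rewrite indicE memNset// => /A0 /= /eqP.
    by rewrite intr_eq0 (negbTE n0).
  apply: EFin_inj; rewrite sintegral_indic//.
  by have [->|->] := subset_set1 A0; rewrite ?charge0 ?nu0.
pose D n : set (measurableTypeR R) := B `&` [set x : R | n.+1%:R^-1 <= `|x|].
have mD n : measurable (D n).
  apply: measurableI => //.
  rewrite -[X in measurable X]setTI
    -[X in _ `&` X](_ : (@Num.norm R R) @^-1` `[n.+1%:R^-1, +oo[ = _).
    by apply: normr_measurable => //; exact: measurable_itv.
  by rewrite preimage_itvcy.
have m0 : measurable (B `&` [set (0 : R)] : set (measurableTypeR R)).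
  by apply: measurableI => //; exact: measurable_set1.
have [_ _ blim] := dL.
have h : sintegral nu setT (fun x => \1_(D n) x + \1_(B `&` [set 0]) x) -
         sintegral zeta setT (fun x => \1_(D n) x + \1_(B `&` [set 0]) x) @[n --> \oo]
         --> sintegral nu setT \1_B - sintegral zeta setT \1_B.
  apply: (blim _ _ 2) => [n|n x|x].
  - by apply: bmeasD; exact: bmeas_indic.
  - by rewrite !indicE; do 2 case: (_ \in _) => /=;
      rewrite ger0_norm; lra.
  - apply: cvg_near_cst; have [->|x0] := eqVneq x 0.
      near=> n; rewrite !indicE (@memNset _ (D n)) ?add0r; last first.
        by move=> [_ /=]; rewrite normr0 leNgt invr_gt0 ltr0n.
      by rewrite in_setI (mem_set (erefl : [set (0 : R)] 0)) andbT.
    have := cvg_invn (1 : R) => /cvgrPdist_lt /(_ `|x|); rewrite normr_gt0 => /(_ x0).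
    apply: filterS => n; rewrite sub0r normrN ger0_norm ?div1r ?invr_ge0// => nx.
    rewrite !indicE in_setI (@memNset _ [set 0])/=; last exact/eqP.
    have xm : x \in [set x : R | n.+1%:R^-1 <= `|x|] by rewrite inE /=; exact: ltW.
    by rewrite in_setI andbF addr0 xm andbT.
have h0 n : sintegral nu setT (fun x => \1_(D n) x + \1_(B `&` [set 0]) x) -
         sintegral zeta setT (fun x => \1_(D n) x + \1_(B `&` [set 0]) x) = 0.
  rewrite (daniellD dn) ?(daniellD dz); do ?exact: bmeas_indic.
  rewrite (away n.+1%:R^-1 (D n)) ?invr_gt0//; last by move=> x [].
  by rewrite null ?subrr//; exact: subIsetr.
rewrite -(cvg_lim (@Rhausdorff R) h).
by under eq_fun do rewrite h0; rewrite lim_cst.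
Unshelve. all: by end_near. Qed.

(** The representation of the characteristic function with a drift and without
    compensator, for a signed measure given as a functional. *)
Definition drift_form mu L (k : R) : Prop := forall z : R, char_fun mu z =
  cexp (L (fun x => cos (z * x) - 1) +i* (k * z + L (fun x => sin (z * x)))).

Lemma drift_form_pair c mu zeta gamma : representation_function c ->
  on_Z0 (fun f => sintegral zeta setT f) ->
  characteristic_pair c mu zeta gamma ->
  drift_form mu (fun f => sintegral zeta setT f) (gamma - sintegral zeta setT c).
Proof.
move=> rc oz mup z; rewrite mup csintegral_gE //.
have dz := daniell_sintegral zeta.
rewrite (daniell_onZ0_eq dz oz (bmeas_gre z) (bmeasB (bmeas_cos z) (bmeas_cst 1))); last first.
  by move=> n n0; rewrite /gre invmin1_int// indic0_int// mulr1 mulr0 subr0.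
rewrite (daniell_onZ0_eq dz oz (bmeas_gim rc z)
  (bmeasB (bmeas_sin z) (bmeasZ z (bmeas_rep rc)))); last first.
  by move=> n n0; rewrite /gim invmin1_int// mulr1.
rewrite (daniellB dz (bmeas_sin z) (bmeasZ z (bmeas_rep rc))) (daniellZ dz)//;
  last exact: bmeas_rep.
by congr cexp; apply/eqP; rewrite eq_complex /= add0r eqxx /=; apply/eqP; ring.
Qed.

Lemma drift_form_drift mu nu zeta k :
  (forall f, bmeas f -> sintegral nu setT f = sintegral zeta setT f) ->
  drift mu nu k -> drift_form mu (fun f => sintegral zeta setT f) k.
Proof.
move=> nuz muk z; rewrite muk /csintegral; congr cexp.
rewrite -(nuz _ (bmeasB (bmeas_cos z) (bmeas_cst 1))) -(nuz _ (bmeas_sin z)); simpc.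
by congr (_ +i* (_ + _)); congr (sintegral _ _ _); apply/funext => x; rewrite cexp_im; simpc.
Qed.

Lemma drift_form_unique mu L k k' : drift_form mu L k -> drift_form mu L k' -> k = k'.
Proof.
move=> mk mk'; have h z : cos ((k - k') * z) = 1.
  have [_ <-] := cexp_eq (eq_trans (esym (mk z)) (mk' z)).
  by congr cos; ring.
have cf : continuous (fun z => (k - k') * z).
  by move=> z; apply: cvgM; [exact: cvg_cst|exact: cvg_id].
have := cos_comp_cst cf h 1 0.
by rewrite mulr1 mulr0 => /eqP; rewrite subr_eq0 => /eqP.
Qed.

(** Periodicity of the characteristic function forces cos (2 pi k) = 1. *)
Lemma drift_form_int mu L k : daniell L -> on_Z L -> concentrated_on_Z mu ->
  drift_form mu L k -> exists j : int, k = j%:~R.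
Proof.
move=> dL oL muZ mk; apply: cos_eq1_int.
have := char_fun_periodic muZ 0; rewrite add0r !mk.
move=> /cexp_eq [_]; rewrite mulr0 add0r.
rewrite (oL (fun x => sin (2 * pi * x)) (bmeas_sin _) (@sin_2pi_int R)) addr0.
rewrite (oL (fun x => sin (0 * x)) (bmeas_sin _)) ?subr0 1?mulrC//.
by move=> n; rewrite mul0r sin0.
Qed.

End drift_form.

(** * Convergence of atoms and convergence in total variation *)

Section truncation.
Context {R : realType}.
Implicit Types (f g : R -> R) (L : (R -> R) -> R).
Implicit Types (mu : probability (measurableTypeR R) R).

(** The integers of [-K, K], indexed by an ordinal type. *)
Definition itv_int (K : nat) (i : 'I_(2 * K).+1) : int := (i : nat)%:Z - K%:Z.

Lemma itv_int_inj K : injective (@itv_int K).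
Proof. by move=> i j /addIr [] /val_inj. Qed.

Lemma itv_intP K (n : int) : (`|n| <= K%:Z)%R -> exists i, @itv_int K i = n.
Proof.
rewrite ler_norml => /andP[h1 h2].
have : 0 <= n + K%:Z by lia.
case E : (n + K%:Z) => [k|//] _.
have ik : (k < (2 * K).+1)%N by lia.
by exists (Ordinal ik); rewrite /itv_int /=; lia.
Qed.

Definition trunc (K : nat) (x : R) : R :=
  \sum_(i < (2 * K).+1) \1_[set (itv_int i)%:~R] x.

Lemma indic_int (m n : int) : \1_[set (m%:~R : R)] (n%:~R : R) = (n == m)%:R :> R.
Proof.
rewrite indicE; have [->|nm] := eqVneq n m; first by rewrite mem_set.
by rewrite memNset//= => /eqP; rewrite eqr_int (negbTE nm).
Qed.

Lemma sum_itv_int (K : nat) (F : int -> R) (n : int) :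
  \sum_(i < (2 * K).+1) F (itv_int i) * (n == itv_int i)%:R =
  if (`|n| <= K%:Z)%R then F n else 0.
Proof.
case: ifPn => nK; last first.
  rewrite big1// => i _; case: eqP => [nE|]; last by rewrite mulr0.
  by exfalso; move: nK; rewrite nE /itv_int; have := ltn_ord i; lia.
have [i iE] := itv_intP nK; rewrite (bigD1 i)//= iE eqxx mulr1 big1 ?addr0// => j ji.
case: eqP => [nE|]; last by rewrite mulr0.
by move: ji; rewrite (_ : j = i) ?eqxx//; apply: itv_int_inj; rewrite iE.
Qed.

Lemma trunc_int K (n : int) : trunc K n%:~R = if (`|n| <= K%:Z)%R then 1 else 0.
Proof.
rewrite -(@sum_itv_int K (fun=> 1)); apply: eq_bigr => i _.
by rewrite indic_int mul1r.
Qed.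

Lemma bmeas_trunc K : bmeas (trunc K).
Proof. by apply: bmeas_sum => i; apply: bmeas_indic; exact: measurable_set1. Qed.

Lemma bmeas_indic_int (n : int) : bmeas (\1_[set (n%:~R : R)]).
Proof. by apply: bmeas_indic; exact: measurable_set1. Qed.

Lemma trunc_notin K (x : R) : ~ intset x -> trunc K x = 0.
Proof.
move=> xZ; rewrite /trunc big1// => i _; rewrite indicE memNset//= => xE.
by apply: xZ; exists (itv_int i).
Qed.

Lemma trunc_01 K x : 0 <= trunc K x <= 1.
Proof.
have [[n _ <-]|/trunc_notin ->] := pselect (intset x); last by rewrite lexx ler01.
by rewrite trunc_int; case: ifP => _; rewrite lexx ler01.
Qed.

Lemma cvg_trunc x : trunc K x @[K --> \oo] --> (\1_intset x : R).
Proof.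
apply: cvg_near_cst; have [[n _ <-]|xZ] := pselect (intset x); last first.
  by near=> K; rewrite trunc_notin// indicE memNset.
exists `|n|%N => // K /= nK; rewrite trunc_int ifT; last by lia.
by rewrite indicE mem_set//; exists n.
Unshelve. all: by end_near. Qed.

Lemma bmeas_intset : bmeas (\1_(@intset R)).
Proof. by apply: bmeas_indic; exact: measurable_intset. Qed.

Lemma indic_intset (n : int) : \1_intset (n%:~R : R) = 1 :> R.
Proof. by rewrite indicE mem_set//; exists n. Qed.

Section functional.
Variable L : (R -> R) -> R.
Hypothesis (dL : daniell L) (oL : on_Z L).

Lemma daniell_intset f : bmeas f -> L f = L (fun x => f x * \1_intset x).
Proof.
move=> bf; apply: daniell_onZ_eq => //; first by apply: bmeasM => //; exact: bmeas_intset.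
by move=> n; rewrite indic_intset mulr1.
Qed.

Lemma cvg_daniell_trunc f : bmeas f ->
  L (fun x => f x * trunc K x) @[K --> \oo] --> L f.
Proof.
move=> bf; have [_ [M fM]] := bf; have [_ _ blim] := dL.
rewrite daniell_intset//; apply: (blim _ _ M) => [K|K x|x].
- by apply: bmeasM => //; exact: bmeas_trunc.
- have /andP[t0 t1] := trunc_01 K x.
  by rewrite normrM (ger0_norm t0) (le_trans _ (fM x))// ler_piMr.
- by apply: cvgM; [exact: cvg_cst|exact: cvg_trunc].
Qed.

Lemma daniell_truncE f K : bmeas f -> L (fun x => f x * trunc K x) =
  \sum_(i < (2 * K).+1) f (itv_int i)%:~R * L (\1_[set (itv_int i)%:~R]).
Proof.
move=> bf; under [RHS]eq_bigr => i _.
  rewrite -daniellZ//; last exact: bmeas_indic_int.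
  over.
rewrite -daniell_sum//; last by move=> i; apply: bmeasZ; exact: bmeas_indic_int.
congr L; apply/funext => x; rewrite mulr_sumr; apply: eq_bigr => i _.
rewrite indicE; case: (boolP (x \in _)) => [/set_mem /= ->//|]; by rewrite !mulr0.
Qed.

(** A functional carried by the integers does not see the values of f elsewhere,
    where f can be replaced by 0. *)
Lemma daniell_bound_onZ : exists2 C : R, 0 <= C & forall f (M : R), bmeas f ->
  (forall n : int, `|f n%:~R| <= M) -> `|L f| <= C * M.
Proof.
have [_ [C hC] _] := dL; exists `|C| => // f M bf fM.
have M0 : 0 <= M := le_trans (normr_ge0 _) (fM 0).
apply: (@le_trans _ _ (C * M)); last by rewrite ler_wpM2r// ler_norm.
rewrite daniell_intset//; apply: hC; first by apply: bmeasM => //; exact: bmeas_intset.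
move=> x; have [[n _ <-]|xZ] := pselect (intset x).
  by rewrite indic_intset mulr1.
by rewrite indicE memNset// mulr0 normr0.
Qed.

End functional.

Lemma le_Rintegral_onZ mu f g : concentrated_on_Z mu -> bmeas f -> bmeas g ->
  (forall n : int, f n%:~R <= g n%:~R) -> Rintegral mu setT f <= Rintegral mu setT g.
Proof.
move=> muZ bf bg fg; have oZ := probability_onZ muZ.
have dL := daniell_Rintegral mu.
rewrite (daniell_intset dL oZ bf) (daniell_intset dL oZ bg); apply: le_Rintegral => //.
- by apply: bmeas_integrable; apply: bmeasM => //; exact: bmeas_intset.
- by apply: bmeas_integrable; apply: bmeasM => //; exact: bmeas_intset.
move=> x _; have [[n _ <-]|xZ] := pselect (intset x).
  by rewrite indic_intset !mulr1.
by rewrite indicE memNset// !mulr0.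
Qed.

Lemma norm_Rintegral_onZ mu f g : concentrated_on_Z mu -> bmeas f -> bmeas g ->
  (forall n : int, `|f n%:~R| <= g n%:~R) -> `|Rintegral mu setT f| <= Rintegral mu setT g.
Proof.
move=> muZ bf bg fg; have dL := daniell_Rintegral mu.
rewrite ler_norml lerNl -(daniellN dL)//.
by apply/andP; split; apply: le_Rintegral_onZ => //; do ?exact: bmeasN => // n;
  move=> n; have := fg n; rewrite ler_norml lerNl => /andP[].
Qed.

Lemma Rintegral_prob1 mu : Rintegral mu setT (fun=> 1) = 1.
Proof. by rewrite Rintegral_cst// mul1r; exact: (congr1 fine (@probability_setT _ _ _ mu)). Qed.

Lemma cvg_sumr (I : Type) (s : seq I) (F : I -> nat -> R) (l : I -> R) :
  (forall i, F i k @[k --> \oo] --> l i) ->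
  \sum_(i <- s) F i k @[k --> \oo] --> \sum_(i <- s) l i.
Proof.
by move=> Fl; apply: cvg_big => // x; exact: add_continuous.
Qed.

Lemma mul1_trunc K : (fun x => 1 * trunc K x) = trunc K :> (R -> R).
Proof. by apply/funext => x; rewrite mul1r. Qed.

(** Once the atoms in a large window converge, the mass left outside converges
    too, since the total mass is 1. The bound is uniform over all functions
    bounded by B on the integers, which is convergence in total variation. *)
Lemma scheffe (mu_ : nat -> probability (measurableTypeR R) R) mu :
  (forall m, concentrated_on_Z (mu_ m)) -> concentrated_on_Z mu ->
  (forall n : int, Rintegral (mu_ m) setT \1_[set (n%:~R : R)] @[m --> \oo] -->
     Rintegral mu setT \1_[set (n%:~R : R)]) ->
  forall e : R, 0 < e -> \forall m \near \oo, forall f (B : R), bmeas f ->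
    (forall n : int, `|f n%:~R| <= B) ->
    `|Rintegral (mu_ m) setT f - Rintegral mu setT f| <= e * B.
Proof.
move=> mZ muZ pcvg e e0.
have e4 : 0 < e / 4 by rewrite divr_gt0.
have dmu := daniell_Rintegral mu.
have oZ := probability_onZ muZ.
have [K hK] : exists K, 1 - Rintegral mu setT (trunc K) <= e / 4.
  have := cvg_daniell_trunc dmu oZ (bmeas_cst 1).
  rewrite Rintegral_prob1 => /cvgrPdist_le /(_ _ e4) [K _ /(_ K (leqnn K))] h.
  exists K; apply: le_trans h; rewrite -{1}mul1_trunc; exact: ler_norm.
pose p m (i : 'I_(2 * K).+1) := Rintegral (mu_ m) setT \1_[set (itv_int i)%:~R : R].
pose q (i : 'I_(2 * K).+1) := Rintegral mu setT \1_[set (itv_int i)%:~R : R].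
have pq : \sum_i `|p m i - q i| @[m --> \oo] --> (0 : R).
  have := @cvg_sumr _ (index_enum 'I_(2 * K).+1) (fun i m => `|p m i - q i|) (fun=> 0).
  rewrite big1_eq; apply=> i; rewrite -[X in _ --> X](normr0 R) -(subrr (q i)).
  by apply: cvg_norm; apply: cvgB; [exact: pcvg|exact: cvg_cst].
move/cvgrPdist_le : pq => /(_ _ e4); apply: filterS => m.
rewrite sub0r normrN ger0_norm ?sumr_ge0// => hm f B bf fB.
have B0 : 0 <= B := le_trans (normr_ge0 _) (fB 0).
have tK := bmeas_trunc K.
have split_f (mu' : probability (measurableTypeR R) R) : Rintegral mu' setT f =
    Rintegral mu' setT (fun x => f x * trunc K x) +
    Rintegral mu' setT (fun x => f x * (1 - trunc K x)).
  rewrite -(daniellD (daniell_Rintegral mu')); first last.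
  - by apply: bmeasM => //; apply: bmeasB => //; exact: bmeas_cst.
  - exact: bmeasM.
  by congr (Rintegral _ _ _); apply/funext => x; ring.
have tail (mu' : probability (measurableTypeR R) R) : concentrated_on_Z mu' ->
    `|Rintegral mu' setT (fun x => f x * (1 - trunc K x))| <=
    B * (1 - Rintegral mu' setT (trunc K)).
  move=> mZ'; rewrite -{2}(Rintegral_prob1 mu') -(daniellB (daniell_Rintegral mu'))//;
    last exact: bmeas_cst.
  rewrite -(daniellZ (daniell_Rintegral mu')); last by apply: bmeasB => //; exact: bmeas_cst.
  apply: norm_Rintegral_onZ => // [||n].
  - by apply: bmeasM => //; apply: bmeasB => //; exact: bmeas_cst.
  - by apply: bmeasZ; apply: bmeasB => //; exact: bmeas_cst.
  rewrite normrM; apply: ler_pM => //; rewrite ger0_norm// subr_ge0.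
  by have /andP[] := trunc_01 K n%:~R.
have Et (mu' : probability (measurableTypeR R) R) : Rintegral mu' setT (trunc K) =
    \sum_(i < (2 * K).+1) Rintegral mu' setT \1_[set (itv_int i)%:~R : R].
  rewrite -mul1_trunc (daniell_truncE (daniell_Rintegral mu') _ (bmeas_cst 1)).
  by apply: eq_bigr => i _; rewrite mul1r.
have h1 := tail _ (mZ m); have h2 := tail _ muZ.
have h3 : `|Rintegral (mu_ m) setT (fun x => f x * trunc K x) -
   Rintegral mu setT (fun x => f x * trunc K x)| <= B * (e / 4).
  rewrite !(daniell_truncE (daniell_Rintegral _))// -sumrB.
  apply: (le_trans (ler_norm_sum _ _ _)).
  apply: (@le_trans _ _ (B * \sum_i `|p m i - q i|)); last by rewrite ler_wpM2l.
  rewrite mulr_sumr; apply: ler_sum => i _; rewrite -mulrBr normrM.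
  by rewrite ler_wpM2r.
have h4 : 1 - Rintegral (mu_ m) setT (trunc K) <= e / 4 + e / 4.
  apply: le_trans (lerD hm hK); rewrite !Et -/(p m) -/q.
  rewrite -lerBlDr [X in X <= _](_ : _ = \sum_i (q i - p m i)); last first.
    by rewrite sumrB; ring.
  by apply: ler_sum => i _; rewrite distrC ler_norm.
rewrite (split_f (mu_ m)) (split_f mu) opprD addrACA.
apply: (le_trans (ler_normD _ _)).
have h5 := ler_wpM2l B0 h4; have h6 := ler_wpM2l B0 hK.
have h7 := ler_normB (Rintegral (mu_ m) setT (fun x => f x * (1 - trunc K x)))
  (Rintegral mu setT (fun x => f x * (1 - trunc K x))).
rewrite (_ : e * B = B * (e / 4) + (B * (e / 4 + e / 4) + B * (e / 4))); last by field.
by apply: lerD => //; lra.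
Qed.

Definition tent (a x : R) : R := Num.max 0 (1 - `|x - a|).

Lemma tent_bounded_continuous a : bounded_continuous (tent a).
Proof.
split; last first.
  exists 1 => x; rewrite /tent; have := normr_ge0 (x - a); set y := `|x - a| => y0.
  by have [h|h] := leP 0 (1 - y); rewrite ?normr0// ger0_norm//; lra.
move=> x; have := @continuous_max R R (fun=> 0) (fun x => 1 - `|x - a|) x.
apply; first exact: cvg_cst.
apply: cvgB; first exact: cvg_cst.
by apply: cvg_norm; apply: cvgB; [exact: cvg_id|exact: cvg_cst].
Qed.

Lemma bounded_continuous_bmeas f : bounded_continuous f -> bmeas f.
Proof. by move=> [cf [M fM]]; exact: bmeas_continuous fM. Qed.

(** On the integers the tent function is an indicator, so a single atom is the
    integral of a bounded continuous function. *)
Lemma tent_int (m n : int) : tent (m%:~R : R) n%:~R = \1_[set (m%:~R : R)] n%:~R.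
Proof.
rewrite indic_int /tent; have [->|nm] := eqVneq n m.
  by rewrite subrr normr0 subr0 max_r.
rewrite max_l// subr_le0 -intrB -intr_norm ler1z -gtz0_ge1 normr_gt0 subr_eq0//.
Qed.

Lemma weak_cvg_atoms (mu_ : nat -> probability (measurableTypeR R) R) mu :
  (forall m, concentrated_on_Z (mu_ m)) -> concentrated_on_Z mu ->
  weak_cvg mu_ mu ->
  forall n : int, Rintegral (mu_ m) setT \1_[set (n%:~R : R)] @[m --> \oo] -->
     Rintegral mu setT \1_[set (n%:~R : R)].
Proof.
move=> mZ muZ mc n; have := mc _ (tent_bounded_continuous n%:~R).
have bt := bounded_continuous_bmeas (tent_bounded_continuous n%:~R).
have E (mu' : probability (measurableTypeR R) R) : concentrated_on_Z mu' ->
    Rintegral mu' setT (tent n%:~R) = Rintegral mu' setT \1_[set (n%:~R : R)].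
  move=> mZ'; apply: (daniell_onZ_eq (daniell_Rintegral mu') (probability_onZ mZ')) => //.
    exact: bmeas_indic_int.
  by move=> k; exact: tent_int.
by rewrite E//; under eq_fun do rewrite E//.
Qed.

End truncation.

(** * The complex exponential *)

Section complex_exponential.
Local Open Scope complex_scope.
Context {R : realType}.
Implicit Types (w d : R[i]).

Lemma ler_normcD (x y : R[i]) : normc (x + y) <= normc x + normc y.
Proof. exact: (@le_normcD R x y). Qed.

Lemma normc_opp (x : R[i]) : normc (- x) = normc x.
Proof. exact: (@normcN R x). Qed.

Lemma ler_normcB (x y : R[i]) : normc (x - y) <= normc x + normc y.
Proof. by rewrite (le_trans (ler_normcD _ _))// normc_opp. Qed.

Lemma normc_distC (x y : R[i]) : normc (x - y) = normc (y - x).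
Proof. by rewrite -normc_opp opprB. Qed.

Lemma normc_ge0 w : 0 <= normc w.
Proof. by case: w => a b; exact: sqrtr_ge0. Qed.

Lemma normcX w n : normc (w ^+ n) = normc w ^+ n.
Proof. by elim: n => [|n IH]; rewrite ?normc1// !exprS normcM IH. Qed.

Lemma normc_real (a : R) : normc (a%:C) = `|a|.
Proof. by rewrite /= expr0n/= addr0 sqrtr_sqr. Qed.

Lemma normc_Re w : `|complex.Re w| <= normc w.
Proof.
by case: w => a b /=; rewrite -sqrtr_sqr ler_wsqrtr// lerDl sqr_ge0.
Qed.

Lemma normc_Im w : `|complex.Im w| <= normc w.
Proof.
by case: w => a b /=; rewrite -sqrtr_sqr ler_wsqrtr// lerDr sqr_ge0.
Qed.

Lemma normc_le_ReIm w : normc w <= `|complex.Re w| + `|complex.Im w|.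
Proof.
case: w => a b /=; rewrite -[leRHS]ger0_norm ?addr_ge0// -sqrtr_sqr ler_wsqrtr//.
rewrite sqrrD !real_normK ?num_real// addrAC lerDl mulrn_wge0// mulr_ge0//.
Qed.

Lemma normc_sqr w : normc w ^+ 2 = complex.Re w ^+ 2 + complex.Im w ^+ 2.
Proof. by case: w => a b /=; rewrite sqr_sqrtr// addr_ge0 ?sqr_ge0. Qed.

Lemma ler_normc_sum (I : Type) (s : seq I) (F : I -> R[i]) :
  normc (\sum_(i <- s) F i) <= \sum_(i <- s) normc (F i).
Proof.
elim: s => [|i s IH]; first by rewrite !big_nil normc0.
by rewrite !big_cons (le_trans (ler_normcD _ _))// lerD2l.
Qed.

Lemma cexpD w d : cexp (w + d) = cexp w * cexp d.
Proof.
case: w d => [a b] [a' b']; rewrite /cexp /= expRD cosD sinD; simpc.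
by congr (_ +i* _); ring.
Qed.

Lemma cexp0 : cexp (0 : R[i]) = 1.
Proof. by rewrite /cexp /= expR0 cos0 sin0 mulr1 mulr0. Qed.

Lemma cexpMn w n : cexp (w *+ n) = cexp w ^+ n.
Proof. by elim: n => [|n IH]; rewrite ?cexp0// mulrS cexpD IH exprS. Qed.

Lemma normc_cexp w : normc (cexp w) = expR (complex.Re w).
Proof.
apply/eqP; rewrite -(@eqrXn2 _ 2) ?normc_ge0 ?expR_ge0// normc_sqr /= !exprMn -mulrDr.
by rewrite cos2Dsin2 mulr1.
Qed.

Lemma normc_cexp_le w : normc (cexp w) <= expR (normc w).
Proof. by rewrite normc_cexp ler_expR (le_trans (ler_norm _))// normc_Re. Qed.

Lemma norm_expRB1_le (t : R) : `|t| <= 1 -> `|expR t - 1| <= expR 1 * `|t|.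
Proof.
move=> t1; have := @MVT_le _ expR expR t (expR 1).
rewrite expR0; apply => x xt.
by rewrite ger0_norm ?expR_ge0// ler_expR (le_trans (ler_norm _))// (le_trans xt).
Qed.

Lemma norm_expRB_le (t : R) : `|t| <= 1 -> `|expR t - 1 - t| <= expR 1 * t ^+ 2.
Proof.
move=> t1; have := @MVT_le _ (fun x => expR x - x) (fun x => expR x - 1) t (expR 1 * `|t|).
rewrite expR0 subr0 -mulrA -expr2 real_normK ?num_real// => h.
rewrite (_ : _ - 1 - t = expR t - t - 1); last by ring.
apply: h => // x xt; rewrite (le_trans (norm_expRB1_le _))// ?ler_wpM2l ?expR_ge0//.
exact: le_trans xt t1.
Qed.

Definition Kexp : R := 4 * expR 1.

Lemma Kexp_ge0 : 0 <= Kexp. Proof. by rewrite mulr_ge0// expR_ge0. Qed.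

(** Any constant would do; this one is explicit to fix the radius of the
    contraction in [log_contraction]. *)
Lemma cexp_second_order w : normc w <= 1 -> normc (cexp w - 1 - w) <= Kexp * normc w ^+ 2.
Proof.
move=> w1; apply: (le_trans (normc_le_ReIm _)); rewrite normc_sqr /Kexp.
have := le_trans (normc_Re w) w1; have := le_trans (normc_Im w) w1.
case: {w1} w => x y /= y1 x1; set E := expR 1.
have E0 : 0 <= E by exact: expR_ge0.
have ex : 0 <= expR x <= E.
  by rewrite expR_ge0 ler_expR (le_trans (ler_norm _)).
have h1 := norm_expRB1_le x1; have h2 := norm_expRB_le x1.
have h3 := norm_cosB1_le y; have h4 := norm_sinB_le y.
move: ex => /andP[ex0 exE]; rewrite -/E in h1 h2.
have r1 : `|expR x * cos y - 1 - x| <= E * y ^+ 2 + E * x ^+ 2.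
  rewrite (_ : _ - 1 - x = expR x * (cos y - 1) + (expR x - 1 - x)); last by ring.
  rewrite (le_trans (ler_normD _ _))// lerD// normrM (ger0_norm ex0).
  by rewrite ler_pM.
have r2 : `|expR x * sin y - 0 - y| <= E * (2 * y ^+ 2) + E * `|x| * `|y|.
  rewrite (_ : _ - 0 - y = expR x * (sin y - y) + (expR x - 1) * y); last by ring.
  rewrite (le_trans (ler_normD _ _))// lerD// normrM ?(ger0_norm ex0).
    by rewrite ler_pM.
  by rewrite ler_wpM2r.
have r3 : `|x| * `|y| <= x ^+ 2 + y ^+ 2.
  rewrite -[x ^+ 2]real_normK ?num_real// -[y ^+ 2]real_normK ?num_real//.
  by have := sqr_ge0 (`|x| - `|y|); have := sqr_ge0 (`|x| + `|y|); rewrite sqrrB sqrrD; lra.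
apply: (le_trans (lerD r1 r2)).
have r4 := ler_wpM2l E0 r3; have r5 := mulr_ge0 E0 (sqr_ge0 x).
rewrite -(mulrA E); lra.
Qed.

Lemma normc_expr_sub (a b : R[i]) (M : R) N : 1 <= M -> normc a <= M -> normc b <= M ->
  normc (a ^+ N - b ^+ N) <= N%:R * M ^+ N * normc (a - b).
Proof.
move=> M1 aM bM; have M0 : 0 <= M := le_trans ler01 M1.
elim: N => [|N IH]; first by rewrite !expr0 subrr normc0 mul0r mul0r.
rewrite !exprS (_ : _ - _ = a * (a ^+ N - b ^+ N) + (a - b) * b ^+ N); last by ring.
rewrite (le_trans (ler_normcD _ _))// !normcM normcX.
apply: (@le_trans _ _ (M * (N%:R * M ^+ N * normc (a - b)) + normc (a - b) * (M * M ^+ N))).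
  apply: lerD; first by apply: ler_pM => //; exact: normc_ge0.
  apply: ler_wpM2l; first exact: normc_ge0.
  apply: (@le_trans _ _ (M ^+ N)); first by rewrite lerXn2r// nnegrE// normc_ge0.
  by rewrite ler_peMl// exprn_ge0.
by rewrite -natr1; lra.
Qed.

(** exp w is the N-th power of exp (w / N), which differs from 1 + w / N by
    O(1 / N^2). *)
Lemma cvg_euler w :
  normc ((1 + w * (n.+1%:R^-1)%:C) ^+ n.+1 - cexp w) @[n --> \oo] --> (0 : R).
Proof.
set B := expR (normc w) * Kexp * normc w ^+ 2.
have [k wk] : exists k : nat, normc w <= k%:R.
  by exists (Num.bound (normc w)); exact/ltW/archi_boundP/normc_ge0.
rewrite -(cvg_shiftn k); apply: (@cvg_dist_le _ _ (fun n => B / n.+1%:R)); last exact: cvg_invn.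
move=> n; rewrite subr0 ger0_norm ?normc_ge0//; set N := (n + k).+1.
have N0 : 0 < N%:R :> R by [].
have nN : n.+1%:R <= N%:R :> R by rewrite ler_nat ltnS leq_addr.
have kN : k%:R <= N%:R :> R by rewrite ler_nat /N; lia.
set d := w * (N%:R^-1)%:C.
have dw : normc d = normc w / N%:R.
  by rewrite normcM normc_real ger0_norm// invr_ge0 ltW.
have d1 : normc d <= 1 by rewrite dw ler_pdivrMr// mul1r (le_trans wk).
have -> : cexp w = cexp d ^+ N.
  rewrite -cexpMn; congr cexp; rewrite /d -mulrnAr -rmorphMn /= -mulr_natr.
  by rewrite mulVf ?gt_eqF// rmorph1 mulr1.
have eM : expR (normc d) ^+ N = expR (normc w).
  by rewrite -expRM_natl dw mulrC divfK// gt_eqF.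
apply: (le_trans (@normc_expr_sub _ _ (expR (normc d)) N _ _ _)).
- by rewrite -expR0 ler_expR normc_ge0.
- by rewrite (le_trans (ler_normcD _ _))// normc1 expR_ge1Dx.
- exact: normc_cexp_le.
rewrite eM normc_distC (_ : cexp d - (1 + d) = cexp d - 1 - d); last by ring.
apply: (@le_trans _ _ (N%:R * expR (normc w) * (Kexp * normc d ^+ 2))).
  by apply: ler_wpM2l; [rewrite mulr_ge0 ?expR_ge0|exact: cexp_second_order].
rewrite dw expr_div_n (_ : _ * _ = B / N%:R); last first.
  by rewrite /B; have := gt_eqF N0; set y : R := N%:R => /negbT yn0; field.
apply: ler_wpM2l; last by rewrite lef_pV2 ?posrE.
by apply: mulr_ge0; [rewrite mulr_ge0 ?expR_ge0 ?Kexp_ge0|exact: sqr_ge0].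
Qed.

Lemma expR_second_order (C : R) : 0 <= C <= 2^-1 -> expR C - 1 - C <= 2 * C ^+ 2.
Proof.
move=> /andP[C0 C1]; have h : expR C * (1 - C) <= 1.
  apply: (@le_trans _ _ (expR C * expR (- C))); last by rewrite expRxMexpNx_1.
  by apply: ler_wpM2l; [exact: expR_ge0|exact: expR_ge1Dx].
have h2 : (expR C - 1 - C) * (1 - C) <= 2 * C ^+ 2 * (1 - C).
  have -> : (expR C - 1 - C) * (1 - C) = expR C * (1 - C) - 1 + C ^+ 2 by ring.
  have C2 := sqr_ge0 C.
  have : C ^+ 2 * C <= C ^+ 2 * 2^-1 by rewrite ler_wpM2l.
  by lra.
by rewrite -(ler_pM2r (_ : 0 < 1 - C))//; lra.
Qed.

(** The map u |-> u - exp u has derivative 1 - exp u, which is small near 0. This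
    makes the iteration h |-> h - (exp h - 1 - f) converge. *)
Lemma log_contraction (u v : R[i]) (r : R) : 0 <= r <= 4^-1 -> (5 * Kexp + 1) * r <= 2^-1 ->
  normc u <= r -> normc v <= r ->
  normc (u - v - (cexp u - cexp v)) <= 2^-1 * normc (u - v).
Proof.
move=> /andP[r0 r1] Kr ur vr; set d := u - v.
have K0 := Kexp_ge0.
have d2 : normc d <= 2 * r by rewrite (le_trans (ler_normcB _ _))//; lra.
have d1 : normc d <= 1 by lra.
have v1 : normc v <= 1 by lra.
have -> : u - v - (cexp u - cexp v) = - (cexp v * (cexp d - 1 - d) + (cexp v - 1) * d).
  by rewrite (_ : u = v + d) ?cexpD; rewrite /d; ring.
rewrite normc_opp (le_trans (ler_normcD _ _))// !normcM.
have n0 := normc_ge0 d; have nv0 := normc_ge0 v.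
have hv : normc (cexp v - 1) <= (Kexp + 1) * r.
  rewrite (_ : _ - 1 = cexp v - 1 - v + v); last by ring.
  rewrite (le_trans (ler_normcD _ _))// mulrDl mul1r lerD//.
  rewrite (le_trans (cexp_second_order v1))// ler_wpM2l//.
  by rewrite (le_trans _ vr)// expr2 ler_piMl.
have hv2 : normc (cexp v) <= 2.
  rewrite (_ : cexp v = cexp v - 1 + 1); last by ring.
  by rewrite (le_trans (ler_normcD _ _))// normc1; have := mulr_ge0 K0 r0; lra.
have hd : normc (cexp d - 1 - d) <= Kexp * (2 * r) * normc d.
  apply: (le_trans (cexp_second_order d1)); rewrite -subr_ge0.
  rewrite (_ : _ - _ = Kexp * normc d * (2 * r - normc d)); last by ring.
  by rewrite !mulr_ge0 ?subr_ge0.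
have t1 : normc (cexp v) * normc (cexp d - 1 - d) <= 2 * (Kexp * (2 * r) * normc d).
  by apply: ler_pM => //; exact: normc_ge0.
have t2 : normc (cexp v - 1) * normc d <= (Kexp + 1) * r * normc d by rewrite ler_wpM2r.
apply: (le_trans (lerD t1 t2)).
have -> : 2 * (Kexp * (2 * r) * normc d) + (Kexp + 1) * r * normc d =
  ((5 * Kexp + 1) * r) * normc d by ring.
by rewrite ler_wpM2r.
Qed.

End complex_exponential.

(** * The norm of absolutely convergent Fourier series, by duality *)

Section wiener.
Local Open Scope complex_scope.
Context {R : realType}.
Implicit Types (f g : R -> R[i]) (C B r : R) (s : seq (R[i] * R)).

Definition eix (t : R) : R[i] := cos t +i* sin t.

Lemma eixD t u : eix (t + u) = eix t * eix u.
Proof. by rewrite /eix cosD sinD; simpc; congr (_ +i* _); rewrite addrC. Qed.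

Lemma eix0 : eix 0 = 1. Proof. by rewrite /eix cos0 sin0. Qed.

Lemma normc_eix t : normc (eix t) = 1.
Proof. by rewrite /= cos2Dsin2 sqrtr1. Qed.

Definition trig s (t : R) : R[i] := \sum_(p <- s) p.1 * eix (t * p.2).

(** The norm of f in the algebra of absolutely convergent Fourier series is at
    most C, expressed by duality: a finitely supported measure acts on f with
    at most C times the supremum of its Fourier coefficients. For
    f(z) = sum_n a_n e^(inz) one can take C = sum_n |a_n|. *)
Definition wiener f C : Prop := forall s B,
  (forall n : int, normc (trig s n%:~R) <= B) ->
  normc (\sum_(p <- s) p.1 * f p.2) <= C * B.

Lemma trig_bound_ge0 s B : (forall n : int, normc (trig s n%:~R) <= B) -> 0 <= B.
Proof. by move=> sB; apply: le_trans (sB 0); exact: normc_ge0. Qed.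

Lemma wiener_le f C C' : wiener f C -> C <= C' -> wiener f C'.
Proof.
move=> wf CC s B sB; apply: (le_trans (wf s B sB)).
by rewrite ler_wpM2r//; exact: trig_bound_ge0 sB.
Qed.

Lemma wiener_pointwise f C z : wiener f C -> normc (f z) <= C.
Proof.
move=> /(_ [:: (1, z)] 1); rewrite big_seq1 mul1r mulr1; apply=> n.
by rewrite /trig big_seq1 mul1r normc_eix.
Qed.

Lemma wiener_ge0 f C : wiener f C -> 0 <= C.
Proof. by move=> /(@wiener_pointwise _ _ 0); apply: le_trans; exact: normc_ge0. Qed.

Lemma wiener_char (n : int) : wiener (fun z => eix (n%:~R * z)) 1.
Proof. by move=> s B sB; rewrite mul1r; exact: sB. Qed.

Lemma wienerD f g C C' : wiener f C -> wiener g C' -> wiener (fun z => f z + g z) (C + C').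
Proof.
move=> wf wg s B sB; under eq_bigr do rewrite mulrDr.
by rewrite big_split /= (le_trans (ler_normcD _ _))// mulrDl lerD// ?wf ?wg.
Qed.

(** The values of one factor are absorbed in the weights; multiplying weights by
    a character only shifts the frequencies. *)
Lemma wienerM f g C C' : wiener f C -> wiener g C' -> wiener (fun z => f z * g z) (C * C').
Proof.
move=> wf wg s B sB; pose s' := [seq (p.1 * g p.2, p.2) | p <- s].
have := wf s' (C' * B); rewrite /s' big_map /= mulrA.
under eq_bigr do rewrite mulrAC -mulrA; apply=> n.
rewrite /trig big_map /=; pose s'' := [seq (p.1 * eix (n%:~R * p.2), p.2) | p <- s].
have := wg s'' B; rewrite /s'' big_map /=.
under eq_bigr do rewrite mulrAC; apply=> m.
rewrite /trig big_map /=; under eq_bigr do rewrite -mulrA -eixD -mulrDl -intrD.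
exact: sB.
Qed.

Lemma wiener_cst (a : R[i]) : wiener (fun=> a) (normc a).
Proof.
move=> s B sB; rewrite -mulr_suml normcM mulrC; apply: ler_wpM2l; first exact: normc_ge0.
by have := sB 0; rewrite /trig; under eq_bigr do rewrite mul0r eix0 mulr1.
Qed.

Lemma wiener1 : wiener (fun=> 1) 1.
Proof. by have := wiener_cst 1; rewrite normc1. Qed.

Lemma wiener0 : wiener (fun=> 0) 0.
Proof. by have := wiener_cst 0; rewrite normc0. Qed.

Lemma wienerN f C : wiener f C -> wiener (fun z => - f z) C.
Proof.
move=> wf s B sB; under eq_bigr do rewrite mulrN.
by rewrite sumrN normc_opp; exact: wf.
Qed.

Lemma wienerB f g C C' : wiener f C -> wiener g C' -> wiener (fun z => f z - g z) (C + C').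
Proof. by move=> wf wg; apply: wienerD => //; exact: wienerN. Qed.

(** Only finitely many values of f occur at a time, so pointwise limits suffice. *)
Lemma wiener_lim (f_ : nat -> R -> R[i]) f C :
  (forall k, wiener (f_ k) C) ->
  (forall z, normc (f_ k z - f z) @[k --> \oo] --> (0 : R)) -> wiener f C.
Proof.
move=> wf cf s B sB.
pose v k := \sum_(p <- s) normc p.1 * normc (f_ k p.2 - f p.2).
have v0 : v k @[k --> \oo] --> (0 : R).
  have := @cvg_sumr R _ s (fun p k => normc p.1 * normc (f_ k p.2 - f p.2)) (fun=> 0).
  rewrite big1_eq; apply=> p; rewrite -(mulr0 (normc p.1)).
  by apply: cvgM; [exact: cvg_cst|exact: cf].
have h : C * B + v k @[k --> \oo] --> C * B + 0.
  by apply: cvgD => //; exact: cvg_cst.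
rewrite -[leRHS]addr0 -(cvg_lim (@Rhausdorff R) h); apply: limr_ge.
  by apply/cvg_ex; eexists; exact: h.
apply: nearW => k.
rewrite (_ : \sum_(p <- s) _ = \sum_(p <- s) p.1 * f_ k p.2 -
   \sum_(p <- s) p.1 * (f_ k p.2 - f p.2)); last first.
  by rewrite -sumrB; apply: eq_bigr => p _; ring.
rewrite (le_trans (ler_normcB _ _))// lerD//; first exact: wf.
by rewrite (le_trans (ler_normc_sum _ _))//; apply: ler_sum => p _; rewrite normcM.
Qed.

Lemma wiener_expr1D f C n : wiener f C -> wiener (fun z => (1 + f z) ^+ n) ((1 + C) ^+ n).
Proof.
move=> wf; elim: n => [|n IH].
  by rewrite expr0; under eq_fun do rewrite expr0; exact: wiener1.
rewrite exprS; under eq_fun do rewrite exprS.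
exact: wienerM (wienerD wiener1 wf) IH.
Qed.

(** The polynomial (1 + X)^n - 1 - n X has nonnegative coefficients. *)
Lemma wiener_expr1D_sub f C n : wiener f C ->
  wiener (fun z => (1 + f z) ^+ n - 1 - n%:R * f z) ((1 + C) ^+ n - 1 - n%:R * C).
Proof.
move=> wf; elim: n => [|n IH].
  rewrite expr0 subrr mul0r subrr; under eq_fun do rewrite expr0 subrr mul0r subrr.
  exact: wiener0.
have -> : (fun z => (1 + f z) ^+ n.+1 - 1 - n.+1%:R * f z) =
    (fun z => ((1 + f z) ^+ n - 1 - n%:R * f z) * (1 + f z) + n%:R * (f z * f z)).
  by apply/funext => z; rewrite exprS -natr1; ring.
have -> : (1 + C) ^+ n.+1 - 1 - n.+1%:R * C =
    ((1 + C) ^+ n - 1 - n%:R * C) * (1 + C) + n%:R * (C * C).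
  by rewrite exprS -natr1; ring.
have w1 := wiener1.
have wn : wiener (fun=> n%:R) n%:R.
  have := wiener_cst (n%:R%:C); rewrite normc_real ger0_norm ?ler0n//.
  by rewrite rmorph_nat.
exact: wienerD (wienerM IH (wienerD w1 wf)) (wienerM wn (wienerM wf wf)).
Qed.

Lemma wienerZr f C (a : R) : 0 <= a -> wiener f C -> wiener (fun z => f z * a%:C) (C * a).
Proof.
move=> a0 wf; have := wienerM wf (wiener_cst a%:C).
by rewrite normc_real ger0_norm.
Qed.

Lemma expr_1Dx_le C n : 0 <= C -> (1 + C * n.+1%:R^-1) ^+ n.+1 <= expR C.
Proof.
move=> C0; have -> : expR C = expR (C * n.+1%:R^-1) ^+ n.+1.
  by rewrite -expRM_natl mulrC divfK.
rewrite lerXn2r ?nnegrE ?expR_ge0 ?expR_ge1Dx//.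
by rewrite addr_ge0// mulr_ge0.
Qed.

(** The exponential is approached by (1 + f / n)^n, whose norm is at most
    (1 + C / n)^n <= exp C. *)
Lemma wiener_exp f C : wiener f C -> wiener (fun z => cexp (f z)) (expR C).
Proof.
move=> wf; apply: (@wiener_lim (fun n z => (1 + f z * (n.+1%:R^-1)%:C) ^+ n.+1)).
  move=> n; apply: wiener_le (expr_1Dx_le n (wiener_ge0 wf)).
  by apply: (wiener_expr1D n.+1 (wienerZr _ wf)).
by move=> z; exact: cvg_euler.
Qed.

Lemma wiener_exp_second f C : wiener f C ->
  wiener (fun z => cexp (f z) - 1 - f z) (expR C - 1 - C).
Proof.
move=> wf; apply: (@wiener_lim (fun n z => (1 + f z * (n.+1%:R^-1)%:C) ^+ n.+1 - 1 - f z)).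
  move=> n; have w := wiener_expr1D_sub n.+1 (wienerZr (_ : 0 <= n.+1%:R^-1) wf).
  have {w}:= w (ltac:(by [])).
  have -> : (fun z => (1 + f z * (n.+1%:R^-1)%:C) ^+ n.+1 - 1 - n.+1%:R * (f z * (n.+1%:R^-1)%:C)) =
    (fun z => (1 + f z * (n.+1%:R^-1)%:C) ^+ n.+1 - 1 - f z).
    apply/funext => z; congr (_ - _).
    by rewrite mulrCA -(rmorph_nat (real_complex R)) -rmorphM/= mulfV// rmorph1 mulr1.
  rewrite mulrCA mulfV// mulr1 => w; apply: wiener_le w _.
  by rewrite !lerD2r expr_1Dx_le//; exact: wiener_ge0 wf.
move=> z; have := cvg_euler (f z).
rewrite (_ : (fun n => normc (_ - cexp (f z))) =
  (fun n => normc ((1 + f z * (n.+1%:R^-1)%:C) ^+ n.+1 - 1 - f z - (cexp (f z) - 1 - f z))))//.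
by apply/funext => n; congr normc; ring.
Qed.

(** Picard iteration for the equation exp h = 1 + f. *)
Fixpoint log_iter f (k : nat) (z : R) : R[i] :=
  if k is k'.+1 then f z - (cexp (log_iter f k' z) - 1 - log_iter f k' z) else 0.

(** The iteration stays in the ball of radius 2 r of the algebra since
    exp (2 r) - 1 - 2 r <= r, and pointwise it converges to the small solution H,
    since [log_contraction] applies to the values. *)
Lemma wiener_log f H r : r <= 8^-1 -> (5 * Kexp + 1) * (2 * r) <= 2^-1 ->
  wiener f r -> (forall z, cexp (H z) = 1 + f z) -> (forall z, normc (H z) <= 2 * r) ->
  wiener H (2 * r).
Proof.
move=> r8 Kr wf Hf Hr; have r0 := wiener_ge0 wf.
have wk k : wiener (log_iter f k) (2 * r).
  elim: k => [|k IH] /=.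
    apply: (@wiener_le _ 0); last by rewrite mulr_ge0.
    exact: wiener0.
  apply: (wiener_le (wienerB wf (wiener_exp_second IH))).
  have := @expR_second_order _ (2 * r).
  rewrite mulr_ge0//= => /(_ _); rewrite exprMn => /(_ ltac:(lra)) h.
  have : r * r <= r * 8^-1 by rewrite ler_wpM2l.
  by lra.
apply: (@wiener_lim (log_iter f)) => // z.
(* The error is halved at each step. *)
apply: (@cvg_dist_le _ _ (fun k => 2 * r * 2^-1 ^+ k)); last first.
  rewrite -(mulr0 (2 * r)); apply: cvgM; first exact: cvg_cst.
  by apply: cvg_expr; rewrite ger0_norm// invf_lt1// ltr1n.
move=> k; rewrite subr0 ger0_norm ?normc_ge0//.
elim: k => [|k IH] /=; first by rewrite sub0r normc_opp expr0 mulr1.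
rewrite (_ : _ - H z = log_iter f k z - H z - (cexp (log_iter f k z) - cexp (H z))); last first.
  by rewrite Hf; ring.
apply: (le_trans (@log_contraction _ _ _ (2 * r) _ _ _ _)) => //.
- by rewrite mulr_ge0//=; lra.
- exact: wiener_pointwise.
by rewrite exprS mulrCA ler_wpM2l.
Qed.

End wiener.

(** * Recovering coefficients from the norm *)

Section elimination.
Local Open Scope complex_scope.
Context {R : realType}.
Implicit Types (L D : (R -> R) -> R) (s : seq (R[i] * R)).

(** Real and imaginary parts of sum_p p.1 (u p.2 x + i v p.2 x): the functionals
    act on real functions. *)
Definition re_comb s (u v : R -> R -> R) (x : R) : R :=
  \sum_(p <- s) (complex.Re p.1 * u p.2 x - complex.Im p.1 * v p.2 x).
Definition im_comb s (u v : R -> R -> R) (x : R) : R :=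
  \sum_(p <- s) (complex.Re p.1 * v p.2 x + complex.Im p.1 * u p.2 x).

Lemma comb_complex s u v x : \sum_(p <- s) p.1 * (u p.2 x +i* v p.2 x) =
  re_comb s u v x +i* im_comb s u v x.
Proof.
rewrite /re_comb /im_comb; elim: s => [|[[a b] t] s IH]; first by rewrite !big_nil.
by rewrite !big_cons IH /=; simpc.
Qed.

Lemma bmeas_re_comb s u v : (forall z, bmeas (u z)) -> (forall z, bmeas (v z)) ->
  bmeas (re_comb s u v).
Proof. by move=> bu bv; apply: bmeas_sum => p; apply: bmeasB; exact: bmeasZ. Qed.

Lemma bmeas_im_comb s u v : (forall z, bmeas (u z)) -> (forall z, bmeas (v z)) ->
  bmeas (im_comb s u v).
Proof. by move=> bu bv; apply: bmeas_sum => p; apply: bmeasD; exact: bmeasZ. Qed.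

Lemma daniell_comb L s u v : daniell L -> (forall z, bmeas (u z)) ->
  (forall z, bmeas (v z)) ->
  \sum_(p <- s) p.1 * (L (u p.2) +i* L (v p.2)) =
  L (re_comb s u v) +i* L (im_comb s u v).
Proof.
move=> dL bu bv; rewrite (@comb_complex s (fun z _ => L (u z)) (fun z _ => L (v z)) 0).
congr (_ +i* _).
- rewrite [in RHS]/re_comb (daniell_sum dL); last by move=> p; apply: bmeasB; exact: bmeasZ.
  by apply: eq_bigr => p _; rewrite (daniellB dL) ?(daniellZ dL)//; exact: bmeasZ.
- rewrite [in RHS]/im_comb (daniell_sum dL); last by move=> p; apply: bmeasD; exact: bmeasZ.
  by apply: eq_bigr => p _; rewrite (daniellD dL) ?(daniellZ dL)//; exact: bmeasZ.
Qed.

Definition fourier L (z : R) : R[i] := L (fun x => cos (z * x)) +i* L (fun x => sin (z * x)).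

(** A combination of values of the Fourier transform is the integral of the same
    combination of characters, evaluated on the integers. Bounding the real and
    imaginary parts separately costs a factor 2. *)
Lemma wiener_daniell L (C : R) : daniell L ->
  (forall f (M : R), bmeas f -> (forall n : int, `|f n%:~R| <= M) -> `|L f| <= C * M) ->
  wiener (fourier L) (2 * C).
Proof.
move=> dL hC s B sB.
rewrite (@daniell_comb L s (fun z x => cos (z * x)) (fun z x => sin (z * x)) dL
  (@bmeas_cos R) (@bmeas_sin R)).
have trigE (n : int) : trig s n%:~R =
    re_comb s (fun z x => cos (z * x)) (fun z x => sin (z * x)) n%:~R +i*
    im_comb s (fun z x => cos (z * x)) (fun z x => sin (z * x)) n%:~R.
  by rewrite -comb_complex; apply: eq_bigr => p _; rewrite /eix (mulrC p.2).
apply: (le_trans (normc_le_ReIm _)); rewrite /= mulrDl mulrDl !mul1r.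
apply: lerD; apply: hC => [|n].
- by apply: bmeas_re_comb; [exact: bmeas_cos|exact: bmeas_sin].
- by apply: le_trans (sB n); rewrite trigE; exact: (normc_Re (_ +i* _)).
- by apply: bmeas_im_comb; [exact: bmeas_cos|exact: bmeas_sin].
- by apply: le_trans (sB n); rewrite trigE; exact: (normc_Im (_ +i* _)).
Qed.

Lemma eixX (t : R) n : eix t ^+ n = eix (t * n%:R).
Proof.
elim: n => [|n IH]; first by rewrite mulr0 eix0.
by rewrite exprS IH -eixD -natr1; congr eix; ring.
Qed.

Lemma eix_2pi_int (n : int) : eix (2 * pi * n%:~R) = 1 :> R[i].
Proof. by rewrite /eix cos_2pi_int sin_2pi_int. Qed.

Lemma sum_roots_of_unity (N : nat) (m : int) : (0 < N)%N ->
  (N%:R^-1)%:C * \sum_(l < N) eix (m%:~R * (2 * pi * l%:R / N%:R)) =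
  ((N%:Z %| m)%Z)%:R :> R[i].
Proof.
move=> N0; have Nn0 : N%:R != 0 :> R by rewrite pnatr_eq0 -lt0n.
pose q : R[i] := eix (2 * pi * (m%:~R / N%:R)).
have qE (l : nat) : eix (m%:~R * (2 * pi * l%:R / N%:R)) = q ^+ l.
  by rewrite eixX; congr eix; field.
under eq_bigr do rewrite qE.
have qN : q ^+ N = 1 by rewrite eixX -mulrA divfK// eix_2pi_int.
case: (boolP (N%:Z %| m)%Z) => [/dvdzP[t mt]|Nm].
  have -> : q = 1 by rewrite /q mt intrM mulfK// eix_2pi_int.
  under eq_bigr do rewrite expr1n.
  by rewrite sumr_const card_ord -(rmorph_nat (real_complex R)) -rmorphM/= mulVf.
have q1 : q - 1 != 0.
  apply: contraNneq Nm => /eqP; rewrite subr_eq0 => /eqP [/cos_eq1_int[t tE] _].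
  apply/dvdzP; exists t; apply/eqP; rewrite -(eqr_int R) intrM -tE.
  by rewrite divfK.
rewrite (_ : \sum_(l < N) _ = 0) ?mulr0//.
by apply: (mulfI q1); rewrite -subrX1 qN subrr mulr0.
Qed.

Section weights.
Variables (phi : R -> R) (K N : nat).

(** A finite measure on the N-th roots of unity whose Fourier transform takes on
    the integers the values of phi, truncated to [-K, K] and made N-periodic. *)
Definition weights : seq (R[i] * R) :=
  [seq ((N%:R^-1)%:C * \sum_(i < (2 * K).+1) (phi (itv_int i)%:~R)%:C *
          eix (- (itv_int i)%:~R * (2 * pi * l%:R / N%:R)),
        2 * pi * l%:R / N%:R) | l <- index_iota 0 N].

(** The truncation of phi to [-K, K], repeated with period N. *)
Definition aliased (n : int) : R :=
  \sum_(i < (2 * K).+1) phi (itv_int i)%:~R * ((N%:Z %| n - itv_int i)%Z)%:R.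

Lemma trig_weights (n : int) : (0 < N)%N -> trig weights n%:~R = (aliased n)%:C.
Proof.
move=> N0; rewrite /trig /weights big_map big_mkord /=.
under eq_bigr => l _.
  rewrite -mulrA mulr_suml mulr_sumr.
  under eq_bigr => i _ do rewrite -mulrA -eixD -mulrDl addrC -intrB mulrCA.
  over.
rewrite exchange_big /= /aliased rmorph_sum /=; apply: eq_bigr => i _.
by rewrite -mulr_sumr -mulr_sumr sum_roots_of_unity// rmorphM /= rmorph_nat.
Qed.

(** When N exceeds the length of the window, at most one of its points lies in a
    given residue class modulo N. *)
Lemma aliased_bound (n : int) : (2 * K < N)%N ->
  (forall n : int, `|phi n%:~R| <= 1) -> `|aliased n| <= 1.
Proof.
move=> KN phi1; rewrite /aliased.
have [[i0 i0P]|none] := pselect (exists i, (N%:Z %| n - @itv_int K i)%Z); last first.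
  rewrite big1 ?normr0// => i _; case: (boolP (_ %| _)%Z) => [h|]; last by rewrite mulr0.
  by exfalso; apply: none; exists i.
rewrite (bigD1 i0)//= i0P mulr1 big1 ?addr0// => j ji.
case: (boolP (_ %| _)%Z) => [h|]; last by rewrite mulr0.
exfalso; move: ji; apply/negP; rewrite negbK; apply/eqP; apply: itv_int_inj.
have : (N%:Z %| itv_int i0 - itv_int j)%Z.
  have -> : itv_int i0 - itv_int j = (n - itv_int j) - (n - itv_int i0) by lia.
  exact: rpredB.
have := ltn_ord i0; have := ltn_ord j; rewrite /itv_int.
move: (nat_of_ord i0) (nat_of_ord j) => a b bK aK /dvdzP[t].
have [->|] := eqVneq t 0; first by lia.
by nia.
Qed.

Lemma aliasedE (n : int) : (`|n| + K < N)%N -> aliased n = phi n%:~R * trunc K n%:~R.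
Proof.
move=> nN; rewrite trunc_int /aliased.
rewrite (eq_bigr (fun i => phi (itv_int i)%:~R * (n == itv_int i)%:R)).
  by rewrite (@sum_itv_int R K (fun n => phi n%:~R)); case: ifP; rewrite ?mulr1 ?mulr0.
move=> i _; congr (_ * (nat_of_bool _)%:R); have := ltn_ord i; rewrite /itv_int.
move: (nat_of_ord i) => a aK; apply/dvdzP/eqP => [[t]|->].
  have [->|] := eqVneq t 0; first by lia.
  by nia.
by exists 0; rewrite subrr mul0r.
Qed.

End weights.

(** Test the norm against [weights]: this integrates against D a periodised
    truncation of phi, which tends to the truncation of phi as N grows, and then
    to phi as the window grows. The constant -1 under the cosine is harmless
    because phi can be taken to vanish at 0. *)
Lemma wiener_elim D (C : R) : daniell D -> on_Z0 D ->
  wiener (fun z => D (fun x => cos (z * x) - 1) +i* D (fun x => sin (z * x))) C ->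
  forall phi, bmeas phi -> (forall n : int, `|phi n%:~R| <= 1) -> `|D phi| <= C.
Proof.
move=> dD oD wD phi0 bphi0 phi01.
have oZ := on_Z0_Z oD.
(* D ignores the value at 0, which can be set to 0. *)
pose phi x := phi0 x * (1 - \1_[set (0 : R)] x).
have b0 : bmeas (\1_[set (0 : R)]) by apply: bmeas_indic; exact: measurable_set1.
have bphi : bmeas phi by apply: bmeasM => //; apply: bmeasB => //; exact: bmeas_cst.
have phi00 : phi 0 = 0 by rewrite /phi indicE mem_set// subrr mulr0.
have -> : D phi0 = D phi.
  apply: (daniell_onZ0_eq dD oD) => // n n0.
  by rewrite /phi indic0_int// subr0 mulr1.
have phi1 (n : int) : `|phi n%:~R| <= 1.
  have [->|n0] := eqVneq n 0; first by rewrite phi00 normr0.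
  by rewrite /phi indic0_int// subr0 mulr1.
suff hK K : `|D (fun x => phi x * trunc K x)| <= C.
  have h : `|D (fun x => phi x * trunc K x)| @[K --> \oo] --> `|D phi|.
    by apply: cvg_norm; exact: cvg_daniell_trunc.
  rewrite -(cvg_lim (@Rhausdorff R) h); apply: limr_le; last exact: nearW.
  by apply/cvg_ex; eexists; exact: h.
pose u z (x : R) := cos (z * x) - 1; pose v z (x : R) := sin (z * x).
have bu z : bmeas (u z) by apply: bmeasB; [exact: bmeas_cos|exact: bmeas_cst].
have bv z : bmeas (v z) by exact: bmeas_sin.
pose N n := (2 * K + n).+1.
pose T n := re_comb (weights phi K (N n)) u v.
have TE n (m : int) : T n m%:~R = aliased phi K (N n) m - aliased phi K (N n) 0.
  have : re_comb (weights phi K (N n)) u v m%:~R +i* im_comb (weights phi K (N n)) u v m%:~R =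
      (aliased phi K (N n) m - aliased phi K (N n) 0)%:C.
    rewrite -comb_complex rmorphB /= -!trig_weights// -sumrB; apply: eq_bigr => p _.
    rewrite -mulrBr mulr0z mul0r eix0; congr (_ * _).
    by rewrite /eix /u /v (mulrC p.2); simpc.
  by move=> /(congr1 (@complex.Re R)).
have KN n : (2 * K < N n)%N by rewrite /N; lia.
have DT n : `|D (T n)| <= C.
  have := wD (weights phi K (N n)) 1.
  rewrite (@daniell_comb D (weights phi K (N n)) u v dD bu bv) mulr1 => h.
  apply: (le_trans (normc_Re (D (T n) +i* _))); apply: h => m.
  by rewrite trig_weights// normc_real; exact: aliased_bound.
have bT n : bmeas (T n) by exact: bmeas_re_comb.
have [_ _ blim] := dD.
have cT : D (fun x => T n x * \1_intset x) @[n --> \oo] -->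
    D (fun x => phi x * trunc K x * \1_intset x).
  apply: (blim _ _ 2) => [n|n x|x].
  - by apply: bmeasM => //; exact: bmeas_intset.
  - have [[m _ <-]|xZ] := pselect (intset x); last by rewrite indicE memNset// mulr0 normr0.
    rewrite indic_intset mulr1 TE (le_trans (ler_normB _ _))//.
    have h1 := aliased_bound m (KN n) phi1; have h2 := aliased_bound 0 (KN n) phi1.
    by lra.
  - have [[m _ <-]|xZ] := pselect (intset x); last first.
      rewrite indicE memNset// mulr0; under eq_fun do rewrite mulr0.
      exact: cvg_cst.
    rewrite indic_intset mulr1; under eq_fun do rewrite mulr1.
    apply: cvg_near_cst; exists `|m|%N => // n /= mn.
    rewrite TE !aliasedE ?phi00 ?mul0r ?subr0//; rewrite /N; lia.
rewrite (daniell_intset dD oZ); last by apply: bmeasM => //; exact: bmeas_trunc.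
have h : `|D (fun x => T n x * \1_intset x)| @[n --> \oo] -->
    `|D (fun x => phi x * trunc K x * \1_intset x)| by apply: cvg_norm.
rewrite -(cvg_lim (@Rhausdorff R) h); apply: limr_le.
  by apply/cvg_ex; eexists; exact: h.
by apply: nearW => n; rewrite -(daniell_intset dD oZ).
Qed.

End elimination.

(** * Convergence of the exponents *)

Section core.
Local Open Scope complex_scope.
Context {R : realType}.
Implicit Types (L D : (R -> R) -> R) (mu : probability (measurableTypeR R) R).

(** If |B| exceeded a given small s > 0 somewhere, it would equal s at some point,
    where |Im (1 + f)| = exp A sin s is not small. The real part is controlled by
    exp A = |1 + f|. *)
Lemma log_small (rho : R) : 0 < rho -> exists2 r : R, 0 < r &
  forall (A B : R -> R) (f : R -> R[i]), continuous B -> B 0 = 0 ->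
    (forall z, cexp (A z +i* B z) = 1 + f z) -> (forall z, normc (f z) <= r) ->
    forall z, normc (A z +i* B z) <= rho.
Proof.
(* s is at most 1, so that its sine is positive. *)
move=> rho0; pose s : R := Num.min (rho / 2) 1.
have s0 : 0 < s by rewrite lt_min divr_gt0//= ltr01.
have s1 : s <= 1 by rewrite ge_min lexx orbT.
have srho : s <= rho / 2 by rewrite ge_min lexx.
have sins : 0 < sin s by apply: sin2_gt0; rewrite s0/=; lra.
pose r : R := Num.min (sin s / 4) (Num.min (rho / 4) 2^-1).
have r0 : 0 < r by rewrite !lt_min !divr_gt0//=.
have r1 : r <= sin s / 4 by rewrite ge_min lexx.
have r2 : r <= rho / 4 by rewrite !ge_min lexx orbT.
have r3 : r <= 2^-1 by rewrite !ge_min lexx !orbT.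
exists r => // A B f cB B0 Hf fr.
have eA z : 1 - r <= expR (A z) <= 1 + r.
  have := congr1 (@normc R) (Hf z); rewrite normc_cexp /= => ->.
  have h1 := ler_normcD 1 (f z); have h2 := ler_normcB (1 + f z) (f z).
  rewrite addrK in h2; rewrite normc1 in h1 h2.
  by have := fr z => ?; apply/andP; split; lra.
have Bs z : `|B z| <= s.
  rewrite leNgt; apply/negP => sB.
  have [y yB] : exists y, `|B y| = s.
    have cnB : continuous (fun z => `|B z|).
      by move=> y; apply: cvg_norm; exact: cB.
    have mm a b : `|B a| = 0 -> s < `|B b| -> Num.min `|B a| `|B b| <= s <= Num.max `|B a| `|B b|.
      by move=> -> sb; rewrite ge_min le_max (ltW s0) (ltW sb) orbT.
    have B00 : `|B 0| = 0 by rewrite B0 normr0.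
    have [z0|z0] := leP 0 z.
      have [||y _ <-] := @IVT _ (fun z => `|B z|) 0 z s z0; last by exists y.
        exact: continuous_subspaceT.
      exact: mm.
    have [||y _ <-] := @IVT _ (fun z => `|B z|) z 0 s (ltW z0); last by exists y.
      exact: continuous_subspaceT.
    by rewrite minC maxC; exact: mm.
  have h1 : normc (f y) >= expR (A y) * sin s.
    apply: le_trans (normc_Im (f y)).
    have -> : complex.Im (f y) = expR (A y) * sin (B y).
      by have := congr1 (@complex.Im R) (Hf y) => /= ->; case: (f y) => a b /=; rewrite add0r.
    rewrite normrM (ger0_norm (expR_ge0 _)) ler_wpM2l ?expR_ge0// -yB.
    have [h|h] := leP 0 (B y); first by rewrite (ger0_norm h) ler_norm.
    by rewrite (ltr0_norm h) sinN -normrN ler_norm.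
  have /andP[h2 _] := eA y; have h3 := fr y.
  have : (1 - r) * sin s <= expR (A y) * sin s by rewrite ler_wpM2r// ltW.
  have : 2^-1 * sin s <= (1 - r) * sin s by rewrite ler_wpM2r ?(ltW sins)//; lra.
  by lra.
move=> z; apply: (le_trans (normc_le_ReIm _)); rewrite /=.
have /andP[h1 h2] := eA z.
have hA1 : A z <= r by have := expR_ge1Dx (A z); lra.
have hA2 : - A z <= 2 * r.
  rewrite leNgt; apply/negP => h.
  have h3 := expR_ge1Dx (- A z).
  have h4 : expR (- A z) * (1 - r) <= 1.
    apply: (@le_trans _ _ (expR (- A z) * expR (A z))).
      by apply: ler_wpM2l => //; exact: expR_ge0.
    by rewrite mulrC expRxMexpNx_1.
  have h5 : (1 - A z) * (1 - r) <= expR (- A z) * (1 - r).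
    by apply: ler_wpM2r => //; lra.
  have h6 : (1 + 2 * r) * (1 - r) < (1 - A z) * (1 - r).
    by rewrite ltr_pM2r; lra.
  (* (1 + 2 r) (1 - r) >= 1 since r <= 1 / 2. *)
  have h7 : 0 <= r * (1 - 2 * r) by apply: mulr_ge0; lra.
  by lra.
have hA : `|A z| <= 2 * r by rewrite ler_norml; apply/andP; split; lra.
by have := Bs z; lra.
Qed.

Lemma archimedean_eq0 (a M : R) : (forall n : nat, `|a| * n%:R <= M) -> a = 0.
Proof.
move=> h; apply/eqP; rewrite -normr_le0 leNgt; apply/negP => a0.
have M0 : 0 <= M by have := h 0; rewrite mulr0.
have := archi_boundP (divr_ge0 M0 (ltW a0)).
by rewrite ltr_pdivrMr// mulrC ltNge h.
Qed.

Section convergence.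
Variables (mu_ : nat -> probability (measurableTypeR R) R) (mu : probability (measurableTypeR R) R).
Variables (L_ : nat -> (R -> R) -> R) (L : (R -> R) -> R) (k_ : nat -> R) (k : R).
Hypotheses (muZ_ : forall m, concentrated_on_Z (mu_ m)) (muZ : concentrated_on_Z mu).
Hypotheses (dL_ : forall m, daniell (L_ m)) (dL : daniell L).
Hypotheses (oL_ : forall m, on_Z0 (L_ m)) (oL : on_Z0 L).
Hypotheses (muL_ : forall m, drift_form (mu_ m) (L_ m) (k_ m)) (muL : drift_form mu L k).

(** The difference of the exponents is a logarithm of muhat_m / muhat, a function
    close to 1 in the Wiener algebra. *)
Lemma exponent_cvg : weak_cvg mu_ mu -> forall e : R, 0 < e ->
  \forall m \near \oo, k_ m = k /\
    forall f, bmeas f -> (forall n : int, `|f n%:~R| <= 1) -> `|L_ m f - L f| <= e.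
Proof.
move=> mc e e0; have atoms := weak_cvg_atoms muZ_ muZ mc.
pose F z : R[i] := L (fun x => cos (z * x) - 1) +i* L (fun x => sin (z * x)).
have [C C0 hC] := daniell_bound_onZ dL (on_Z0_Z oL).
have wF : exists CF, wiener F CF.
  exists (2 * C + normc ((L (fun=> 1))%:C)).
  have := wienerB (wiener_daniell dL hC) (wiener_cst (L (fun=> 1))%:C).
  congr wiener; apply/funext => z; rewrite /fourier /F; simpc.
  by rewrite (daniellB dL)//; [exact: bmeas_cos|exact: bmeas_cst].
move: wF => [CF wF].
have [j jk] := drift_form_int dL (on_Z0_Z oL) muZ muL.
(* G is the inverse of the characteristic function of mu. *)
pose G z := eix ((- j)%:~R * z) * cexp (- F z).
have wG : wiener G (expR CF).
  by have := wienerM (wiener_char (- j)) (wiener_exp (wienerN wF)); rewrite mul1r.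
have muG z : char_fun mu z * G z = 1.
  have -> : char_fun mu z = eix (k * z) * cexp (F z).
    rewrite muL (_ : _ +i* _ = (0 +i* (k * z)) + F z); last by rewrite /F; simpc.
    by rewrite cexpD cexp_im.
  rewrite /G mulrACA -eixD -cexpD subrr cexp0 jk rmorphN /= mulNr subrr eix0 mulr1//.
have [r [r0 r8 Kr re]] : exists r : R, [/\ 0 < r, r <= 8^-1,
    (5 * Kexp + 1) * (2 * r) <= 2^-1 & 2 * r <= e].
  have K0 := @Kexp_ge0 R; have K1 : 0 < 5 * @Kexp R + 1 by lra.
  exists (Num.min 8^-1 (Num.min ((4 * (5 * Kexp + 1))^-1) (e / 2))); split.
  - rewrite !lt_min; apply/and3P; split; [by rewrite invr_gt0|by rewrite invr_gt0 mulr_gt0|].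
    by rewrite divr_gt0.
  - by rewrite ge_min lexx.
  - rewrite mulrCA; apply: (@le_trans _ _ (2 * ((5 * Kexp + 1) * (4 * (5 * Kexp + 1))^-1))).
      by rewrite !ler_wpM2l// ?(ltW K1)// !ge_min lexx orbT.
    rewrite invfM (mulrCA _ 4^-1) mulfV ?gt_eqF//; lra.
  - apply: (@le_trans _ _ (2 * (e / 2))); last by lra.
    by rewrite ler_wpM2l// !ge_min lexx !orbT.
(* r is the radius wanted for the norm of f, and r1 the one that makes H small. *)
have [r1 r10 small] : exists2 r1 : R, 0 < r1 & forall (A B : R -> R) (f : R -> R[i]),
    continuous B -> B 0 = 0 ->
    (forall z, cexp (A z +i* B z) = 1 + f z) -> (forall z, normc (f z) <= r1) ->
    forall z, normc (A z +i* B z) <= 2 * r.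
  by apply: log_small; rewrite mulr_gt0.
pose r2 := Num.min r r1; have r20 : 0 < r2 by rewrite lt_min r0.
have eps0 : 0 < r2 / (2 * expR CF) by rewrite divr_gt0// mulr_gt0// expR_gt0.
have := scheffe muZ_ muZ atoms eps0; apply: filterS => m hm.
pose D f := L_ m f - L f.
have dD : daniell D by exact: daniell_sub.
have oD : on_Z0 D by move=> f bf f0; rewrite /D oL_// oL// subrr.
pose f z := (char_fun (mu_ m) z - char_fun mu z) * G z.
have wf : wiener f r2.
  have dI : daniell (fun f => Rintegral (mu_ m) setT f - Rintegral mu setT f).
    by apply: daniell_sub; exact: daniell_Rintegral.
  have := wienerM (wiener_daniell dI hm) wG.
  rewrite (_ : 2 * _ * _ = r2); last first.
    by have := expR_gt0 CF; set E := expR CF => E0; field; rewrite gt_eqF.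
  congr wiener; apply/funext => z; congr (_ * _).
  by rewrite /fourier !char_funE; simpc.
have r2r : r2 <= r by rewrite ge_min lexx.
have r2r1 : r2 <= r1 by rewrite ge_min lexx orbT.
pose A z := D (fun x => cos (z * x) - 1).
pose S z := D (fun x => sin (z * x)).
pose B z := (k_ m - k) * z + S z.
have cB : continuous B.
  move=> z; apply: cvgD; first by apply: cvgM; [exact: cvg_cst|exact: cvg_id].
  apply: (@continuous_daniell R D (fun z x => sin (z * x))) => //.
  - exact: bmeas_sin.
  - by move=> M; exists 1 => y x _; exact: sin_max.
  - move=> x y; apply: continuous_comp; last exact: continuous_sin.
    by apply: cvgM; [exact: cvg_id|exact: cvg_cst].
have B0 : B 0 = 0.
  rewrite /B mulr0 add0r /S; under eq_fun do rewrite mul0r sin0.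
  exact: (daniell0 dD).
have HE z : cexp (A z +i* B z) = 1 + f z.
  have -> : 1 + f z = char_fun (mu_ m) z * G z.
    by rewrite /f mulrBl muG; ring.
  have -> : G z = cexp (- (0 +i* (k * z)) - F z).
    rewrite cexpD /G; congr (_ * _).
    rewrite (_ : - (0 +i* (k * z)) = 0 +i* (- (k * z))); last by simpc.
    by rewrite cexp_im -[in RHS]mulNr jk rmorphN.
  rewrite muL_ -cexpD; congr cexp; rewrite /F; simpc.
  by congr (_ +i* _); rewrite /A /B /S /D; ring.
have Hr z : normc (A z +i* B z) <= 2 * r.
  apply: (small A B f) => // y; apply: le_trans r2r1; exact: wiener_pointwise.
(* At z = 2 pi n the sines vanish on the integers, and Im H = 2 pi n (k_m - k). *)
have kk : k_ m = k.
  apply/eqP; rewrite -subr_eq0; apply/eqP; apply: (@archimedean_eq0 _ (2 * r)) => n.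
  have p1 : 1 <= 2 * pi :> R by have := @pi_ge2 R; lra.
  have S0 : S (2 * pi * n%:R) = 0.
    rewrite /S (on_Z0_Z oD)//; first exact: bmeas_sin.
    by move=> i; rewrite -mulrA -[n%:R]/(n%:~R) -intrM sin_2pi_int.
  have := le_trans (normc_Im _) (Hr (2 * pi * n%:R)); rewrite /= /B S0 addr0 => h.
  apply: le_trans h; rewrite normrM ler_wpM2l// ger0_norm; last by rewrite !mulr_ge0// pi_ge0.
  by rewrite ler_peMl.
split=> // phi bphi phi1; apply: le_trans re.
apply: (wiener_elim dD oD) => //.
have -> : (fun z => D (fun x => cos (z * x) - 1) +i* D (fun x => sin (z * x))) =
    (fun z => A z +i* B z).
  by apply/funext => z; rewrite /B kk subrr mul0r add0r.
apply: (@wiener_log _ f) => //.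
exact: wiener_le wf r2r.
Qed.

End convergence.
End core.

(** * Functionals and summation over the integers *)

Section ell1.
Context {R : realType}.
Implicit Types (L D : (R -> R) -> R) (mu : probability (measurableTypeR R) R).

Lemma indic_comb_int (s : seq int) (a : int -> R) (n : int) : uniq s ->
  \sum_(i <- s) a i * \1_[set (i%:~R : R)] (n%:~R : R) = if n \in s then a n else 0.
Proof.
move=> us; case: ifPn => ns.
  rewrite (bigD1_seq n)//= indic_int eqxx mulr1 big1 ?addr0// => i ni.
  by rewrite indic_int eq_sym (negbTE ni) mulr0.
rewrite big_seq big1// => i iS; rewrite indic_int; case: eqP => [ni|]; last by rewrite mulr0.
by move: ns; rewrite ni iS.
Qed.

(** The sum of the absolute values of the masses over a finite set is the
    integral of the corresponding signs. *)
Lemma esum_le_daniell D (e : R) : daniell D ->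
  (forall f, bmeas f -> (forall n : int, `|f n%:~R| <= 1) -> `|D f| <= e) ->
  (\esum_(n in [set: int]) (`|D (\1_[set (n%:~R : R)])|)%:E <= e%:E)%E.
Proof.
move=> dD De; apply: ge_ereal_sup => _ [A [finA _] <-].
rewrite fsbig_finite// sumEFin lee_fin; set s : seq int := finmap.enum_fset (fset_set A).
pose f x := \sum_(i <- s) Num.sg (D (\1_[set (i%:~R : R)])) * \1_[set (i%:~R : R)] x.
have bf : bmeas f by apply: bmeas_sum => i; apply: bmeasZ; exact: bmeas_indic_int.
have -> : \sum_(i <- s) `|D (\1_[set (i%:~R : R)])| = D f.
  rewrite daniell_sum//; last by move=> i; apply: bmeasZ; exact: bmeas_indic_int.
  by apply: eq_bigr => i _; rewrite daniellZ ?normrEsg//; exact: bmeas_indic_int.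
rewrite (le_trans (ler_norm _))// De// => n.
rewrite /f indic_comb_int ?finmap.fset_uniq//; case: ifP => _; rewrite ?normr0//.
by rewrite normr_sg; case: (_ != 0).
Qed.

Lemma daniell_le_esum D (e : R) : daniell D -> on_Z D ->
  (\esum_(n in [set: int]) (`|D (\1_[set (n%:~R : R)])|)%:E <= e%:E)%E ->
  forall f (M : R), bmeas f -> (forall n : int, `|f n%:~R| <= M) -> `|D f| <= M * e.
Proof.
move=> dD oD De f M bf fM; have M0 : 0 <= M := le_trans (normr_ge0 _) (fM 0).
have h : `|D (fun x => f x * trunc K x)| @[K --> \oo] --> `|D f|.
  by apply: cvg_norm; exact: cvg_daniell_trunc.
rewrite -(cvg_lim (@Rhausdorff R) h); apply: limr_le.
  by apply/cvg_ex; eexists; exact: h.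
apply: nearW => K; rewrite daniell_truncE//.
apply: (le_trans (ler_norm_sum _ _ _)).
apply: (@le_trans _ _ (\sum_(i < (2 * K).+1) M * `|D (\1_[set (itv_int i)%:~R])|)).
  by apply: ler_sum => i _; rewrite normrM ler_wpM2r.
rewrite -mulr_sumr ler_wpM2l// -lee_fin; apply: le_trans De.
pose s := [seq itv_int i | i <- enum 'I_(2 * K).+1].
have us : uniq s by rewrite map_inj_uniq ?enum_uniq//; exact: itv_int_inj.
apply: esum_ge; exists [set` s]; first by split => //; exact: finite_seq.
by rewrite -fsbig_seq// /s big_map big_enum /= sumEFin.
Qed.

Lemma cvge0_le (u : nat -> \bar R) : (forall m, (0 <= u m)%E) ->
  (forall e : R, 0 < e -> \forall m \near \oo, (u m <= e%:E)%E) ->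
  u m @[m --> \oo] --> 0%E.
Proof.
move=> u0 ue; apply/fine_cvgP; split.
  have := ue _ ltr01; apply: filterS => m um.
  by rewrite ge0_fin_numE//; exact: le_lt_trans um (ltry _).
apply/cvgrPdist_le => e e0; have := ue _ e0; apply: filterS => m um.
rewrite sub0r normrN ger0_norm /= ?fine_ge0// -lee_fin fineK//.
by rewrite ge0_fin_numE//; exact: le_lt_trans um (ltry _).
Qed.

Lemma cvge0_near_le (u : nat -> \bar R) : (forall m, (0 <= u m)%E) ->
  u m @[m --> \oo] --> 0%E ->
  forall e : R, 0 < e -> \forall m \near \oo, (u m <= e%:E)%E.
Proof.
move=> u0 /fine_cvgP[ufin /cvgrPdist_le ue] e e0; near=> m.
rewrite -[u m]fineK; last by near: m.
rewrite lee_fin (le_trans (ler_norm _))//.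
have : `|0 - fine (u m)| <= e by near: m; exact: ue.
by rewrite sub0r normrN.
Unshelve. all: by end_near. Qed.

End ell1.

(** * Inversion of characteristic functions on the integers *)

Section inversion.
Context {R : realType}.
Implicit Types (L D : (R -> R) -> R) (mu : probability (measurableTypeR R) R).

Let two_pi_gt0 : 0 < 2 * pi :> R.
Proof. by rewrite mulr_gt0// pi_gt0. Qed.

(** The Haar measure of the circle, carried by [0, 2 pi]. *)
Definition unif : probability (measurableTypeR R) R := uniform_prob two_pi_gt0.

Lemma Rintegral_unif_cos (a : R) : a != 0 ->
  Rintegral unif setT (fun z => cos (a * z)) = sin (2 * pi * a) / (2 * pi * a).
Proof.
move=> a0; have dU := daniell_Rintegral unif.
have -> : Rintegral unif setT (fun z => cos (a * z)) =
    Rintegral unif setT (fun z => 1 + cos (a * z)) - 1.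
  rewrite (daniellD dU); [|exact: bmeas_cst|exact: bmeas_cos].
  by rewrite Rintegral_prob1 addrAC subrr add0r.
pose F z : R := z + sin (a * z) / a.
have dF (z : R) : is_derive z 1 F (1 + cos (a * z)).
  have h1 : is_derive z 1 (fun z => a * z) a.
    by have := is_deriveZ a (is_derive_id z (1 : R)); rewrite /GRing.scale /= mulr1.
  have h2 : is_derive z 1 (fun z => sin (a * z)) (cos (a * z) * a).
    exact: (is_derive1_comp (is_derive_sin (a * z)) h1).
  have := is_deriveD (is_derive_id z (1 : R)) (is_deriveZ a^-1 h2).
  rewrite (_ : id + a^-1 \*: _ = F); last first.
    by apply/funext => y; rewrite /F /GRing.scale /= mulrC.
  by move=> /is_derive_eq; apply; rewrite /GRing.scale /= mulrCA mulVf// mulr1.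
rewrite /Rintegral integral_uniform; last 2 first.
- have [mc _] := bmeasD (@bmeas_cst R 1) (bmeas_cos a).
  exact/measurable_EFinP.
- by move=> z; rewrite lee_fin; have := cos_geN1 (a * z); lra.
rewrite (@continuous_FTC2 _ _ F)//; last 3 first.
- apply: continuous_subspaceT => z; apply: cvgD; first exact: cvg_cst.
  apply: continuous_comp; last exact: continuous_cos.
  by apply: cvgM; [exact: cvg_cst|exact: cvg_id].
- have cF : continuous F.
    by move=> z; apply/differentiable_continuous/derivable1_diffP; case: (dF z).
  split; first by move=> z _; case: (dF z).
    by apply: cvg_at_right_filter; exact: cF.
  by apply: cvg_at_left_filter; exact: cF.
- by move=> z _; rewrite derive1E; have [_ ->] := dF z.
rewrite subr0 -EFinB -EFinM /= /F mulr0 sin0 mul0r addr0 subr0 (mulrC a).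
have := gt_eqF two_pi_gt0; set p := 2 * pi => /negbT p0.
by field; rewrite a0.
Qed.

Lemma Rintegral_unif_cos_int (m : int) :
  Rintegral unif setT (fun z => cos (m%:~R * z)) = (m == 0)%:R.
Proof.
have [->|m0] := eqVneq m 0.
  by under eq_fun do rewrite mul0r cos0; rewrite Rintegral_prob1.
by rewrite Rintegral_unif_cos ?intr_eq0// sin_2pi_int mul0r.
Qed.

Lemma bmeas_cos_shift (n : int) z : bmeas (fun x : R => cos ((x - n%:~R) * z)).
Proof.
have -> : (fun x => cos ((x - n%:~R) * z)) =
    (fun x => cos (z * x) * cos (z * n%:~R) + sin (z * x) * sin (z * n%:~R)).
  by apply/funext => x; rewrite mulrC mulrBr cosB.
by apply: bmeasD; apply: bmeasM;
  [exact: bmeas_cos|exact: bmeas_cst|exact: bmeas_sin|exact: bmeas_cst].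
Qed.

Lemma char_shiftE mu (n : int) (z : R) :
  Rintegral mu setT (fun x => cos ((x - n%:~R) * z)) =
  cos (n%:~R * z) * Rintegral mu setT (fun x => cos (z * x)) +
  sin (n%:~R * z) * Rintegral mu setT (fun x => sin (z * x)).
Proof.
have dmu := daniell_Rintegral mu.
rewrite -(daniellZ dmu); last exact: bmeas_cos.
rewrite -(daniellZ dmu); last exact: bmeas_sin.
rewrite -(daniellD dmu); [|by apply: bmeasZ; exact: bmeas_cos|by apply: bmeasZ; exact: bmeas_sin].
congr (Rintegral _ _ _); apply/funext => x.
by rewrite mulrBl cosB (mulrC x) [in RHS]mulrC [sin _ * _ in RHS]mulrC.
Qed.

Lemma bmeas_char_shift mu (n : int) :
  bmeas (fun z => Rintegral mu setT (fun x => cos ((x - n%:~R) * z))).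
Proof.
have cont (F : R -> R -> R) : (forall z, bmeas (F z)) -> (forall z x, `|F z x| <= 1) ->
    (forall x, continuous (F ^~ x)) -> continuous (fun z => Rintegral mu setT (F z)).
  move=> bF F1 cF; apply: (continuous_daniell (daniell_Rintegral mu)) => //.
  by move=> M; exists 1.
have [_ [C hC] _] := daniell_Rintegral mu.
apply: (@bmeas_continuous _ _ (C * 1)); last first.
  by move=> z; apply: hC; [exact: bmeas_cos_shift|move=> x; exact: cos_max].
apply: cont => [z|z x|x z].
- exact: bmeas_cos_shift.
- exact: cos_max.
- apply: continuous_comp; last exact: continuous_cos.
  by apply: cvgM; [exact: cvg_cst|exact: cvg_id].
Qed.

(** Integrate cos ((x - n) z) over a period in z and exchange the integrals: only
    x = n contributes among the integers. *)
Lemma atom_inversion mu (n : int) : concentrated_on_Z mu ->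
  Rintegral mu setT \1_[set (n%:~R : R)] =
  Rintegral unif setT (fun z => Rintegral mu setT (fun x => cos ((x - n%:~R) * z))).
Proof.
move=> muZ; have dU := daniell_Rintegral unif; have dmu := daniell_Rintegral mu.
(* Adding 1 makes the integrand nonnegative, so that Tonelli's theorem applies. *)
pose h (p : measurableTypeR R * measurableTypeR R) : R := 1 + cos ((p.1 - n%:~R) * p.2).
have bcos (b : R) : bmeas (fun z => 1 + cos (b * z)).
  by apply: bmeasD; [exact: bmeas_cst|exact: bmeas_cos].
have bcos2 := bmeas_cos_shift n.
have hE1 x : (\int[unif]_z (h (x, z))%:E = (Rintegral unif setT (fun z => h (x, z)))%:E)%E.
  rewrite /Rintegral fineK//; apply: integrable_fin_num => //.
  exact: (bmeas_integrable unif (bcos (x - n%:~R))).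
have bh2 z : bmeas (fun x => h (x, z)) by apply: (bmeasD (bmeas_cst 1) (bcos2 z)).
have hE2 z : (\int[mu]_x (h (x, z))%:E = (Rintegral mu setT (fun x => h (x, z)))%:E)%E.
  rewrite /Rintegral fineK//; apply: integrable_fin_num => //.
  exact: (bmeas_integrable mu (bh2 z)).
have mh : measurable_fun [set: measurableTypeR R * measurableTypeR R] (EFin \o h).
  apply/measurable_EFinP; apply: measurable_funD; first exact: measurable_cst.
  apply: (@measurableT_comp _ _ _ _ _ _ (@cos R)).
    by apply: continuous_measurable_fun; exact: continuous_cos.
  apply: measurable_funM; last exact: measurable_snd.
  by apply: measurable_funB; [exact: measurable_fst|exact: measurable_cst].
have h0 p : (0 <= (EFin \o h) p)%E.
  rewrite /= lee_fin /h; have := cos_geN1 ((p.1 - n%:~R) * p.2); lra.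
have := @fubini_tonelli _ _ _ _ _ mu unif (EFin \o h) mh h0.
under eq_integral do rewrite /= hE1.
under [X in _ = X -> _]eq_integral do rewrite /= hE2.
move=> /(congr1 fine); rewrite -/(Rintegral mu setT _) -/(Rintegral unif setT _) => E.
pose g x := Rintegral unif setT (fun z => h (x, z)).
have mg : measurable_fun [set: measurableTypeR R] (g : _ -> measurableTypeR R).
  apply/measurable_EFinP; rewrite (_ : EFin \o g = fun x => (\int[unif]_z (EFin \o h) (x, z))%E).
    exact: measurable_fun_fubini_tonelli_F.
  by apply/funext => x /=; rewrite hE1.
have bg : bmeas g.
  have [_ [C hC] _] := dU; split=> //; exists (C * 2) => x; apply: hC => [|z].
    exact: (bcos (x - n%:~R)).
  by rewrite (le_trans (ler_normD _ _))// normr1; have := cos_max ((x - n%:~R) * z); lra.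
have bphi := bmeas_char_shift mu n.
move: E; rewrite -/(Rintegral mu setT g).
rewrite (daniell_onZ_eq dmu (probability_onZ muZ) bg
  (bmeasD (@bmeas_cst R 1) (bmeas_indic_int n))); last first.
  move=> m; rewrite /g /h /= (daniellD dU); [|exact: bmeas_cst|exact: bmeas_cos].
  by rewrite Rintegral_prob1 -intrB Rintegral_unif_cos_int subr_eq0 indic_int.
rewrite (daniellD dmu); [|exact: bmeas_cst|exact: bmeas_indic_int].
under [X in _ = Rintegral _ _ X -> _]eq_fun => z.
  rewrite /h /= (daniellD dmu)//; last exact: bmeas_cst.
  rewrite Rintegral_prob1.
  over.
rewrite (daniellD dU)//; last exact: bmeas_cst.
by rewrite !Rintegral_prob1 => /addrI.
Qed.

Lemma char_cvg_atoms (mu_ : nat -> probability (measurableTypeR R) R) mu :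
  (forall m, concentrated_on_Z (mu_ m)) -> concentrated_on_Z mu ->
  (forall z, Rintegral (mu_ m) setT (fun x => cos (z * x)) @[m --> \oo] -->
     Rintegral mu setT (fun x => cos (z * x))) ->
  (forall z, Rintegral (mu_ m) setT (fun x => sin (z * x)) @[m --> \oo] -->
     Rintegral mu setT (fun x => sin (z * x))) ->
  forall n : int, Rintegral (mu_ m) setT \1_[set (n%:~R : R)] @[m --> \oo] -->
     Rintegral mu setT \1_[set (n%:~R : R)].
Proof.
move=> mZ muZ ccos csin n; rewrite atom_inversion//.
under eq_fun do rewrite atom_inversion//.
have [_ _ blim] := daniell_Rintegral unif.
apply: (blim _ _ 1) => [m|m z|z].
- exact: bmeas_char_shift.
- apply: (@le_trans _ _ (Rintegral (mu_ m) setT (fun=> 1))); last by rewrite Rintegral_prob1.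
  apply: norm_Rintegral_onZ => // [||k].
  + exact: bmeas_cos_shift.
  + exact: bmeas_cst.
  + exact: cos_max.
rewrite char_shiftE; under eq_fun do rewrite char_shiftE.
by apply: cvgD; apply: cvgM; [exact: cvg_cst|exact: ccos|exact: cvg_cst|exact: csin].
Qed.

End inversion.

(** * Continuous extensions, tightness and total variation *)

Section extension.
Context {R : realType}.
Implicit Types (L D : (R -> R) -> R) (mu : probability (measurableTypeR R) R).
Implicit Types (zeta : signed_measure R).

Lemma intsetE : @intset R = (fun x => sin (pi * x)) @^-1` [set 0].
Proof.
apply/seteqP; split => [_ [n _ <-]|x /= /sin_pi_eq0[n ->]]; last by exists n.
exact: sin_pi_int.
Qed.

Lemma continuous_sin_pi : continuous (fun x : R => sin (pi * x)).
Proof.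
move=> x; apply: continuous_comp; last exact: continuous_sin.
by apply: cvgM; [exact: cvg_cst|exact: cvg_id].
Qed.

Lemma closed_intset : closed (@intset R).
Proof.
rewrite intsetE; apply: closed_comp; last exact: closed_eq.
by move=> x _; exact: continuous_sin_pi.
Qed.

(** The integers form a closed discrete set, so any function on them is continuous
    and Tietze's theorem applies. *)
Lemma int_extension (f : R -> R) : bmeas f ->
  exists2 g : R -> R, bounded_continuous g & forall n : int, g n%:~R = f n%:~R.
Proof.
move=> [_ [M fM]].
have M0 : 0 < `|M| + 1 by rewrite ltr_wpDl.
have cf : {within intset, continuous f}.
  apply/subspace_continuousP => _ [n _ <-]; apply: cvg_near_cst.
  near=> x; suff -> : x = n%:~R by [].
  have [m _ mx] : intset x by near: x; exact: withinT.
  have : `|n%:~R - x| < 1 by near: x; apply: cvg_within;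
    exact: (@cvgr_dist_lt _ _ _ (nbhs (n%:~R : R)) _ id _ cvg_id).
  rewrite -mx -intrB -intr_norm ltrz1 => h; congr (_%:~R); lia.
have fM' x : `|f x| <= `|M| + 1.
  by rewrite (le_trans (fM x))// (le_trans (ler_norm M))// lerDl.
have [g [fg cg gM]] := continuous_bounded_extension pseudometric_normal closed_intset M0 cf
  (fun x _ => fM' x).
exists g; first by split => //; exists (`|M| + 1).
by move=> n; rewrite -fg// inE; exists n.
Unshelve. all: by end_near. Qed.

Definition tv zeta (A : set R) : R :=
  Rintegral (jordan_pos (hahn zeta)) setT \1_A + Rintegral (jordan_neg (hahn zeta)) setT \1_A.

Lemma total_variationE zeta (A : set (measurableTypeR R)) : measurable A ->
  total_variation zeta A = (tv zeta A)%:E.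
Proof.
move=> mA; rewrite /tv !Rintegral_indic// EFinD !fineK ?fin_num_measure//.
Qed.

(** The total variation of A integrates the sign of the Hahn decomposition. *)
Lemma tv_sintegral zeta (A : set (measurableTypeR R)) : measurable A ->
  exists f : R -> R, [/\ bmeas f, forall x, `|f x| <= \1_A x & tv zeta A = sintegral zeta setT f].
Proof.
move=> mA; have dz := daniell_sintegral zeta.
have [[mP _] [mN _] _ _] := hahn zeta.
have mAP : measurable (A `&` hahn_pos zeta) by exact: measurableI.
have mAN : measurable (A `&` hahn_neg zeta) by exact: measurableI.
exists (fun x => \1_(A `&` hahn_pos zeta) x - \1_(A `&` hahn_neg zeta) x); split.
- by apply: bmeasB; exact: bmeas_indic.
- move=> x; rewrite !indicE !in_setI; case: (x \in A) => /=; last by rewrite subrr normr0.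
  by do 2 case: (_ \in _) => /=; rewrite ?subrr ?subr0 ?sub0r ?normrN ?normr1 ?normr0.
- rewrite (daniellB dz) ?bmeas_indic//; do ?exact: bmeas_indic.
  apply: EFin_inj; rewrite -total_variationE// EFinB !sintegral_indic//.
  rewrite /total_variation /charge_variation /= jordan_posE jordan_negE cjordan_posE cjordan_negE.
  by rewrite /crestr0 mem_set// /crestr.
Qed.

Lemma tv_ge0 zeta A : 0 <= tv zeta A.
Proof. by apply: addr_ge0; apply: Rintegral_ge0 => x _; rewrite ler0n. Qed.

Lemma sintegral_le_tv zeta (A : set (measurableTypeR R)) (f : R -> R) : measurable A ->
  bmeas f -> (forall x, `|f x| <= \1_A x) -> `|sintegral zeta setT f| <= tv zeta A.
Proof.
move=> mA bf fA; rewrite (le_trans (ler_normB _ _))// lerD//.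
- rewrite (le_trans (le_normr_Rintegral _ (bmeas_integrable _ bf)))//.
  apply: le_Rintegral => //; last exact: bmeas_integrable (bmeas_indic mA).
  by have /integrable_norm := bmeas_integrable (jordan_pos (hahn zeta)) bf.
- rewrite (le_trans (le_normr_Rintegral _ (bmeas_integrable _ bf)))//.
  apply: le_Rintegral => //; last exact: bmeas_integrable (bmeas_indic mA).
  by have /integrable_norm := bmeas_integrable (jordan_neg (hahn zeta)) bf.
Qed.

Definition outside (K : nat) : set R := ~` `[- K%:R, K%:R].

Lemma measurable_outside K : measurable (outside K : set (measurableTypeR R)).
Proof. by apply: measurableC; exact: measurable_itv. Qed.

(** The complements of large intervals decrease to the empty set. *)
Lemma tv_outside zeta (e : R) : 0 < e -> exists K0, forall K, (K0 <= K)%N ->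
  tv zeta (outside K) <= e.
Proof.
move=> e0.
have co (m : {finite_measure set (measurableTypeR R) -> \bar R}) :
    Rintegral m setT \1_(outside K) @[K --> \oo] --> Rintegral m setT (fun=> 0).
  have [_ _ blim] := daniell_Rintegral m.
  apply: (blim _ _ 1) => [K|K x|x].
  - by apply: bmeas_indic; exact: measurable_outside.
  - by rewrite indicE; case: (_ \in _); rewrite ?normr1 ?normr0.
  - apply: cvg_near_cst; exists (Num.bound `|x|) => // K /= xK.
    rewrite indicE memNset// /outside => /=; apply; rewrite in_itv/= -ler_norml.
    by apply: le_trans (ltW (archi_boundP (normr_ge0 x))) _; rewrite ler_nat.
have : tv zeta (outside K) @[K --> \oo] --> (0 : R).
  rewrite -(addr0 (0 : R)); apply: cvgD.
  - by rewrite -(daniell0 (daniell_Rintegral (jordan_pos (hahn zeta)))); exact: co.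
  - by rewrite -(daniell0 (daniell_Rintegral (jordan_neg (hahn zeta)))); exact: co.
move/cvgrPdist_le => /(_ _ e0)[K0 _ h]; exists K0 => K /h /=.
by rewrite sub0r normrN ger0_norm// tv_ge0.
Qed.

Lemma ereal_sup_tv_le (zeta_ : nat -> signed_measure R) (A : set (measurableTypeR R)) (e : R) :
  measurable A -> (forall m, tv (zeta_ m) A <= e) ->
  (ereal_sup (range (fun m => total_variation (zeta_ m) A)) <= e%:E)%E.
Proof.
by move=> mA tve; apply: ge_ereal_sup => _ [m _ <-]; rewrite total_variationE// lee_fin.
Qed.

(** All but finitely many measures are close to zeta in total variation, so that
    zeta and finitely many measures decide. *)
Lemma tight_of_tv (zeta_ : nat -> signed_measure R) (zeta : signed_measure R) :
  (forall e : R, 0 < e -> \forall m \near \oo, forall f, bmeas f ->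
     (forall x, `|f x| <= 1) -> `|sintegral (zeta_ m) setT f - sintegral zeta setT f| <= e) ->
  tight zeta_ /\ uniformly_bounded zeta_.
Proof.
move=> zc.
have near_tv (e : R) : 0 < e -> \forall m \near \oo, forall A : set (measurableTypeR R),
    measurable A -> tv (zeta_ m) A <= tv zeta A + e.
  move=> e0; have := zc _ e0; apply: filterS => m hm A mA.
  have [f [bf fA ->]] := tv_sintegral (zeta_ m) mA.
  have f1 x : `|f x| <= 1.
    by rewrite (le_trans (fA x))// indicE; case: (_ \in _); rewrite ?lexx ?ler01.
  have := hm f bf f1; have := sintegral_le_tv zeta mA bf fA.
  have := ler_norm (sintegral zeta setT f).
  have := ler_norm (sintegral (zeta_ m) setT f - sintegral zeta setT f).
  by lra.
split.
  move=> e e0; have e2 : 0 < e / 2 by rewrite divr_gt0.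
  have [M _ hM] := near_tv _ e2.
  have [K0 hK0] := tv_outside zeta e2.
  have [Kf hKf] : {Kf : nat -> nat & forall m K, (Kf m <= K)%N -> tv (zeta_ m) (outside K) <= e}.
    by apply: (@choice _ _ (fun m k => forall K, (k <= K)%N -> tv (zeta_ m) (outside K) <= e)) => m;
      exact: tv_outside.
  pose K := (K0 + \sum_(m < M) Kf m)%N.
  exists `[- K%:R, K%:R]%classic; first exact: segment_compact.
  apply: ereal_sup_tv_le => [|m]; first exact: measurable_outside.
  have [mM|mM] := leqP M m.
    have := hM m mM _ (measurable_outside K).
    have := hK0 K (leq_addr _ _); rewrite /outside; lra.
  apply: hKf; rewrite /K (bigD1 (Ordinal mM))//=; lia.
have [M _ hM] := near_tv _ ltr01.
pose B : R := tv zeta setT + 1 + \sum_(m < M) tv (zeta_ m) setT.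
apply: (@le_lt_trans _ _ B%:E); last exact: ltry.
apply: ereal_sup_tv_le => // m; rewrite /B; have [mM|mM] := leqP M m.
  have := hM m mM _ measurableT; rewrite -lerBlDl => h.
  have : 0 <= \sum_(m < M) tv (zeta_ m) setT by apply: sumr_ge0 => i _; exact: tv_ge0.
  by lra.
rewrite (bigD1 (Ordinal mM))//=.
have : 0 <= \sum_(i < M | i != Ordinal mM) tv (zeta_ i) setT.
  by apply: sumr_ge0 => i _; exact: tv_ge0.
have := tv_ge0 zeta setT; lra.
Qed.

(** sin (pi x)^2 is bounded, continuous and vanishes exactly on the integers. *)
Lemma weak_cvg_onZ (mu_ : nat -> probability (measurableTypeR R) R) mu :
  (forall m, concentrated_on_Z (mu_ m)) -> weak_cvg mu_ mu -> concentrated_on_Z mu.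
Proof.
move=> mZ mc; have dmu := daniell_Rintegral mu.
pose q (x : R) := sin (pi * x) ^+ 2.
have bq : bmeas q by apply: bmeasX; exact: bmeas_sin.
have cq : bounded_continuous q.
  have [_ qM] := bq; split => // x.
  apply: (@continuous_comp _ _ _ (fun x => sin (pi * x)) (fun t => t ^+ 2)).
    exact: continuous_sin_pi.
  exact: exprn_continuous.
have q0 : Rintegral mu setT q = 0.
  have := mc q cq; under eq_fun => m.
    rewrite (probability_onZ (mZ m) bq); last by move=> n; rewrite /q sin_pi_int expr0n.
    over.
  by move/cvg_lim => <-//; rewrite lim_cst.
have bk (k : nat) : bmeas (fun x => Num.min 1 (k%:R * q x)).
  split; first by apply: measurable_minr; [exact: measurable_cst|case: (bmeasZ k%:R bq)].
  exists 1 => x; rewrite ger0_norm ?ge_min ?lexx// le_min ler01 mulr_ge0// sqr_ge0//.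
have mC : measurable (~` @intset R : set (measurableTypeR R)).
  by apply: measurableC; exact: measurable_intset.
have [_ _ blim] := dmu.
have h : Rintegral mu setT (fun x => Num.min 1 (k%:R * q x)) @[k --> \oo] -->
    Rintegral mu setT \1_(~` @intset R).
  apply: (blim _ _ 1) => // [k x|x].
    by rewrite ger0_norm ?ge_min ?lexx// le_min ler01 mulr_ge0// sqr_ge0.
  have [[n _ <-]|xZ] := pselect (intset x).
    rewrite indicE memNset//; last by move=> /=; apply; exists n.
    by under eq_fun do rewrite /q sin_pi_int expr0n mulr0 min_r//; exact: cvg_cst.
  have qx : 0 < q x.
    rewrite lt_neqAle sqr_ge0 andbT eq_sym sqrf_eq0; apply/eqP => /sin_pi_eq0[n xn].
    by apply: xZ; exists n.
  rewrite indicE mem_set//; apply: cvg_near_cst; exists (Num.bound (q x)^-1) => // k /= xk.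
  rewrite min_l// -ler_pdivrMr// mul1r.
  apply: le_trans (ltW (archi_boundP _)) _; first by rewrite invr_ge0 ltW.
  by rewrite ler_nat.
have h0 k : Rintegral mu setT (fun x => Num.min 1 (k%:R * q x)) = 0.
  apply/le_anti/andP; split; last first.
    by apply: Rintegral_ge0 => x _; rewrite le_min ler01 mulr_ge0// sqr_ge0.
  apply: (@le_trans _ _ (Rintegral mu setT (fun x => k%:R * q x))).
    apply: le_Rintegral => //.
    - exact: bmeas_integrable.
    - by apply: bmeas_integrable; exact: bmeasZ.
    - by move=> x _; rewrite ge_min lexx orbT.
  by rewrite (daniellZ dmu)// q0 mulr0.
have : Rintegral mu setT \1_(~` @intset R) = 0.
  by rewrite -(cvg_lim (@Rhausdorff R) h); under eq_fun do rewrite h0; rewrite lim_cst.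
rewrite Rintegral_indic// => mu0; rewrite /concentrated_on_Z -/intset.
have := probability_setC mu mC; rewrite setCK => ->.
by rewrite -[mu (~` intset)]fineK ?mu0 ?sube0// fin_num_measure.
Qed.

End extension.

(** * The equivalence *)

Section assembly.
Context {R : realType}.
Implicit Types (L D : (R -> R) -> R) (mu : probability (measurableTypeR R) R).

Lemma drift_form_re_im mu L (k z : R) : drift_form mu L k ->
  Rintegral mu setT (fun x => cos (z * x)) =
    expR (L (fun x => cos (z * x) - 1)) * cos (k * z + L (fun x => sin (z * x))) /\
  Rintegral mu setT (fun x => sin (z * x)) =
    expR (L (fun x => cos (z * x) - 1)) * sin (k * z + L (fun x => sin (z * x))).
Proof. by move=> /(_ z); rewrite char_funE /cexp /= => -[]. Qed.

Lemma atoms_weak_cvg (mu_ : nat -> probability (measurableTypeR R) R) mu :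
  (forall m, concentrated_on_Z (mu_ m)) -> concentrated_on_Z mu ->
  (forall n : int, Rintegral (mu_ m) setT \1_[set (n%:~R : R)] @[m --> \oo] -->
     Rintegral mu setT \1_[set (n%:~R : R)]) -> weak_cvg mu_ mu.
Proof.
move=> mZ muZ atoms f fbc; have bf := bounded_continuous_bmeas fbc.
have [_ [M fM]] := bf; have M1 : 0 < `|M| + 1 by rewrite ltr_wpDl.
apply/cvgrPdist_le => e e0; have e1 : 0 < e / (`|M| + 1) by rewrite divr_gt0.
have := scheffe mZ muZ atoms e1; apply: filterS => m hm.
have := hm f (`|M| + 1) bf; rewrite distrC divfK ?gt_eqF//; apply=> n.
by rewrite (le_trans (fM _))// (le_trans (ler_norm M))// lerDl.
Qed.

Section convergence.
Variables (mu_ : nat -> probability (measurableTypeR R) R) (mu : probability (measurableTypeR R) R).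
Variables (L_ : nat -> (R -> R) -> R) (L : (R -> R) -> R) (k_ : nat -> R) (k : R).
Hypotheses (muZ_ : forall m, concentrated_on_Z (mu_ m)) (muZ : concentrated_on_Z mu).
Hypotheses (muL_ : forall m, drift_form (mu_ m) (L_ m) (k_ m)) (muL : drift_form mu L k).

(** The characteristic functions converge pointwise, hence so do the atoms. *)
Lemma drift_form_weak_cvg : k_ m @[m --> \oo] --> k ->
  (forall f, bmeas f -> L_ m f @[m --> \oo] --> L f) -> weak_cvg mu_ mu.
Proof.
move=> kc Lc; apply: atoms_weak_cvg => //.
have arg z : k_ m * z + L_ m (fun x => sin (z * x)) @[m --> \oo] -->
    k * z + L (fun x => sin (z * x)).
  apply: cvgD; first by apply: cvgM => //; exact: cvg_cst.
  by apply: Lc; exact: bmeas_sin.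
have modulus z : expR (L_ m (fun x => cos (z * x) - 1)) @[m --> \oo] -->
    expR (L (fun x => cos (z * x) - 1)).
  apply: (continuous_cvg _ (@continuous_expR R _)); apply: Lc.
  by apply: bmeasB; [exact: bmeas_cos|exact: bmeas_cst].
apply: char_cvg_atoms => // z.
- have [-> _] := drift_form_re_im z muL.
  under eq_fun do rewrite (drift_form_re_im z (muL_ _)).1.
  by apply: cvgM => //; exact: (continuous_cvg _ (@continuous_cos R _)).
- have [_ ->] := drift_form_re_im z muL.
  under eq_fun do rewrite (drift_form_re_im z (muL_ _)).2.
  by apply: cvgM => //; exact: (continuous_cvg _ (@continuous_sin R _)).
Qed.

End convergence.

Lemma near_le_cvg (u : nat -> R) (l M : R) : 
  (forall e : R, 0 < e -> \forall m \near \oo, `|u m - l| <= M * e) -> u m @[m --> \oo] --> l.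
Proof.
move=> h; apply/cvgrPdist_le => e e0; have M1 : 0 < `|M| + 1 by rewrite ltr_wpDl.
have := h _ (divr_gt0 e0 M1); apply: filterS => m; rewrite distrC => /le_trans; apply.
rewrite mulrCA ler_piMr ?(ltW e0)// ler_pdivrMr// mul1r.
by rewrite (le_trans (ler_norm M))// lerDl.
Qed.

End assembly.

Theorem theorem8p4 (R : realType) (c : R -> R)
    (mu_ : nat -> probability (measurableTypeR R) R)
    (zeta_ : nat -> signed_measure R) (gamma_ : nat -> R) :
  representation_function c ->
  (forall m, concentrated_on_Z (mu_ m)) ->
  (forall m, characteristic_pair c (mu_ m) (zeta_ m) (gamma_ m)) ->
  (forall (mu : probability (measurableTypeR R) R) (zeta : signed_measure R)
      (gamma : R) (nu_ : nat -> signed_measure R) (nu : signed_measure R)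
      (k_ : nat -> R) (k : R),
    concentrated_on_Z mu ->
    characteristic_pair c mu zeta gamma ->
    (forall m, gaussian_variance (zeta_ m) = 0%E) ->
    (forall m, quasi_levy_measure (zeta_ m) (nu_ m)) ->
    gaussian_variance zeta = 0%E ->
    quasi_levy_measure zeta nu ->
    (forall m, drift (mu_ m) (nu_ m) (k_ m)) ->
    drift mu nu k ->
    [<-> weak_cvg mu_ mu;
         k_ m @[m --> \oo] --> k /\
         (\esum_(n in [set: int])
            `|nu_ m [set (n%:~R : R)] - nu [set (n%:~R : R)]|)%E
           @[m --> \oo] --> 0%E;
         gamma_ m @[m --> \oo] --> gamma /\ signed_weak_cvg zeta_ zeta]) /\
  (forall mu : probability (measurableTypeR R) R,
    quasi_infinitely_divisible c mu -> weak_cvg mu_ mu ->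
    tight zeta_ /\ uniformly_bounded zeta_).
Proof.
move=> rc mZ mpair.
have bc := bmeas_rep rc.
pose L_ m f := sintegral (zeta_ m) setT f.
have dL_ m : daniell (L_ m) := daniell_sintegral (zeta_ m).
have oL_ m : on_Z0 (L_ m) := zeta_onZ0 rc (mZ m) (mpair m).
have form_ m : drift_form (mu_ m) (L_ m) (gamma_ m - L_ m c).
  exact: drift_form_pair (oL_ m) (mpair m).
split; last first.
  move=> mu [gamma [zeta mupair]] mc; have muZ := weak_cvg_onZ mZ mc.
  have dL := daniell_sintegral zeta; have oL := zeta_onZ0 rc muZ mupair.
  apply: (@tight_of_tv _ _ zeta) => e e0.
  have := exponent_cvg mZ muZ dL_ dL oL_ oL form_ (drift_form_pair rc oL mupair) mc e0.
  by apply: filterS => m [_ hm] f bf f1; exact: hm.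
move=> mu zeta gamma nu_ nu k_ k muZ mupair _ levy_ _ levy drift_ drift.
pose L f := sintegral zeta setT f.
have dL : daniell L := daniell_sintegral zeta.
have oL : on_Z0 L := zeta_onZ0 rc muZ mupair.
have nuE_ m := levy_measureE (oL_ m) (levy_ m); have nuE := levy_measureE oL levy.
have kform_ m := drift_form_drift (nuE_ m) (drift_ m).
have kform := drift_form_drift nuE drift.
have kE_ m : k_ m = gamma_ m - L_ m c := drift_form_unique (kform_ m) (form_ m).
have kE : k = gamma - L c := drift_form_unique kform (drift_form_pair rc oL mupair).
pose D m f := L_ m f - L f; have dD m : daniell (D m) := daniell_sub (dL_ m) dL.
have oD m : on_Z (D m) by move=> f bf f0; rewrite /D (on_Z0_Z (@oL_ m))// (on_Z0_Z oL)// subrr.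
have ell1 m : (\esum_(n in [set: int])
    `|nu_ m [set (n%:~R : R)] - nu [set (n%:~R : R)]| =
    \esum_(n in [set: int]) (`|D m (\1_[set (n%:~R : R)])|)%:E)%E.
  apply: eq_esum => n _; rewrite -!sintegral_indic; [|exact: measurable_set1..].
  by rewrite nuE_ ?nuE; [|exact: bmeas_indic_int..].
have cvgL_of_esum : (\esum_(n in [set: int])
    `|nu_ m [set (n%:~R : R)] - nu [set (n%:~R : R)]|)%E @[m --> \oo] --> 0%E ->
    forall f, bmeas f -> L_ m f @[m --> \oo] --> L f.
  move=> /cvge0_near_le h f bf; have [_ [M fM]] := bf.
  apply: (@near_le_cvg _ _ _ M) => e e0.
  have /(_ _ e e0) := h; move=> /(_ (fun m => esum_ge0 (fun _ _ => abse_ge0 _))).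
  apply: filterS => m; rewrite ell1 => hm.
  by apply: (daniell_le_esum (dD m) (oD m) hm bf).
tfae.
- move=> mc; have core := exponent_cvg mZ muZ dL_ dL oL_ oL kform_ kform mc.
  split.
    apply: (@near_le_cvg _ _ _ 1) => e e0; have := core e e0.
    by apply: filterS => m [-> _]; rewrite subrr normr0 mul1r ltW.
  apply: cvge0_le => [m|e e0]; first by apply: esum_ge0 => n _; exact: abse_ge0.
  have := core e e0; apply: filterS => m [_ hm]; rewrite ell1.
  exact: esum_le_daniell (dD m) hm.
- move=> [kc /cvgL_of_esum Lc]; split.
    rewrite (_ : gamma = k + L c); last by rewrite kE subrK.
    rewrite (_ : gamma_ = fun m => k_ m + L_ m c); last by apply/funext => m; rewrite kE_ subrK.
    by apply: cvgD => //; exact: Lc.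
  by move=> f fbc; apply: Lc; exact: bounded_continuous_bmeas.
- move=> [gc zc].
  have Lc f : bmeas f -> L_ m f @[m --> \oo] --> L f.
    move=> bf; have [g gbc gf] := int_extension bf.
    have bg := bounded_continuous_bmeas gbc; have := zc g gbc.
    rewrite -/(L g) (daniell_onZ_eq dL (on_Z0_Z oL) bg bf gf).
    by under eq_fun do rewrite -/(L_ _ g) (daniell_onZ_eq (dL_ _) (on_Z0_Z (@oL_ _)) bg bf gf).
  apply: (drift_form_weak_cvg mZ muZ kform_ kform) => //.
  rewrite kE (_ : k_ = fun m => gamma_ m - L_ m c); last by apply/funext => m; rewrite kE_.
  by apply: cvgB => //; exact: Lc.
Qed.
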